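(* Let $\alpha_1,\alpha_2>0$ and $(E_d,B_d)\in Y$. The problem $$\min_{z\in Z}\ \mathcal J(z):=\frac12\|S(z)-(E_d,B_d)\|_Y^2+\frac{\alpha_1}2\|z\|_{L^2(0,T;L^2(\Omega))}^2+\frac{\alpha_2}2\|\operatorname{curl}z\|_{L^2(0,T;L^2(\Omega))}^2$$ admits a unique minimizer $z^*\in Z$.
   Context: $\Omega\subset\mathbb R^3$ is a bounded Lipschitz domain with outward unit normal $\nu$, and $T>0$. $(\cdot,\cdot)$ is the $L^2(\Omega)$ inner product (scalar or vector). The tensors $\varepsilon,\mu,\sigma\in L^\infty(\Omega;\mathbb R^{3\times3})$ are symmetric; there are $\varepsilon_0,\mu_0>0$ with $\xi^\top\varepsilon(x)\xi\ge\varepsilon_0|\xi|^2$, $\xi^\top\mu(x)\xi\ge\mu_0|\xi|^2$ for a.e. $x$ and all $\xi\in\mathbb R^3$; $\sigma$ is positive semidefinite; $I_{\rm src}\in L^2(0,T;L^2(\Omega)^3)$; $E_0,B_0\in L^2(\Omega)^3$ with $\operatorname{div}B_0=0$. $H_0(\operatorname{curl};\Omega)=\{v\in H(\operatorname{curl};\Omega):v\times\nu=0\text{ on }\partial\Omega\}$. $Z=L^2(0,T;H(\operatorname{curl};\Omega))$. $Y=L^2(0,T;L^2(\Omega)^3)\times L^2(0,T;L^2(\Omega)^3)$ with the weighted norm $\|(E,B)\|_Y^2=\int_0^T\big((\varepsilon E,E)+(\mu^{-1}B,B)\big)\,dt$. Control-to-state map $S:Z\to Y$: $S(z)=(E,B)$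 is the unique weak solution with right-hand side $f=I_{\rm src}+\operatorname{curl}z$, i.e. $E\in H^1(0,T;H_0(\operatorname{curl};\Omega)^* )\cap C([0,T];L^2(\Omega)^3)$, $B\in H^1(0,T;H(\operatorname{curl};\Omega)^* )\cap C([0,T];L^2(\Omega)^3)$ and for a.e. $t\in(0,T)$ $$\langle\varepsilon\,\partial_tE,\psi\rangle+(\sigma E,\psi)-(\mu^{-1}B,\operatorname{curl}\psi)=(f,\psi)\ \ \forall\psi\in H_0(\operatorname{curl};\Omega),\qquad\langle\partial_tB,\phi\rangle+(E,\operatorname{curl}\phi)=0\ \ \forall\phi\in H(\operatorname{curl};\Omega),$$ with $E(0)=E_0$, $B(0)=B_0$. Here $\varepsilon\,\partial_tE$ (and membership of $E$ in $H^1(0,T;H_0(\operatorname{curl};\Omega)^* )$) is understood through the functional $\psi\mapsto\frac{d}{dt}(\varepsilon E(t),\psi)$. *)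

(* Defs.v *)
From HB Require Import structures.
From mathcomp Require Import all_boot all_order all_algebra.
From mathcomp Require Import all_classical all_reals all_analysis.

Set Implicit Arguments.
Unset Strict Implicit.
Unset Printing Implicit Defensive.

Import Order.TTheory GRing.Theory Num.Theory.
Import numFieldNormedType.Exports.

Local Open Scope classical_set_scope.
Local Open Scope ring_scope.

(* Points of R^3 are triples, a type that carries both the normed topology and
   the product sigma-algebra; values of vector fields are column matrices. *)
Notation point3 R := (R * R * R)%type.
Notation vfield R := ((R * R * R)%type -> 'cV[R]_3).
Notation tensor3 R := ((R * R * R)%type -> 'M[R]_3).

Definition leb (R : realType) : {measure set (measurableTypeR R) -> \bar R} :=
  @lebesgue_measure R.

Definition leb3 (R : realType) :
    {measure set (point3 (measurableTypeR R)) -> \bar R} :=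
  ((@lebesgue_measure R \x @lebesgue_measure R) \x @lebesgue_measure R)%E.

Definition coords (R : realType) (x : point3 R) : 'cV[R]_3 :=
  \col_(i < 3) nth 0 [:: x.1.1; x.1.2; x.2] i.

Definition basis3 (R : realType) (i : 'I_3) : point3 R :=
  ((i == 0%N :> nat)%:R, (i == 1%N :> nat)%:R, (i == 2%N :> nat)%:R).

Definition dot (R : realType) (a b : 'cV[R]_3) : R :=
  \sum_(i < 3) a i ord0 * b i ord0.

(* Omega is nonempty, open, connected and bounded, and near each boundary point
   it is, after an orthogonal change of coordinates Q, the strict epigraph of a
   Lipschitz function of the first two coordinates. *)
Definition bounded_lipschitz_domain (R : realType) (Omega : set (point3 R)) :=
  [/\ Omega !=set0, open Omega, connected Omega, bounded_set Omega &
    forall p, (closure Omega `\` Omega) p ->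
      exists (Q : 'M[R]_3) (g : R * R -> R),
        [/\ Q *m Q^T = 1%:M, [lipschitz g q | q in setT] &
          \forall x \near p, let y := Q *m coords x in
            Omega x <->
            g (y (inord 0) ord0, y (inord 1) ord0) < y (inord 2) ord0]].

(* C^infinity: every iterated directional derivative is differentiable. *)
Definition smooth (R : realType) (E : normedModType R) (f : E -> R) :=
  forall (vs : seq E) (x : E),
    differentiable (foldr (fun v (g : E -> R) => 'D_v g) f vs) x.

(* C_c^infinity(U) *)
Definition test_fun (R : realType) (E : normedModType R) (U : set E)
    (f : E -> R) :=
  smooth f /\
  exists K : set E, [/\ compact K, K `<=` U & forall x, ~ K x -> f x = 0].

Definition comp3 (R : realType) (u : vfield R) (i : 'I_3) : point3 R -> R :=
  fun x => u x i ord0.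

Definition smooth_field (R : realType) (u : vfield R) :=
  forall i, smooth (comp3 u i).

Definition test_field (R : realType) (U : set (point3 R)) (u : vfield R) :=
  forall i, test_fun U (comp3 u i).

Definition grad (R : realType) (f : point3 R -> R) : vfield R :=
  fun x => \col_(i < 3) 'D_(basis3 R i) f x.

(* Index arithmetic is modulo 3, e.g. component 0 is d_1 u_2 - d_2 u_1. *)
Definition curl (R : realType) (u : vfield R) : vfield R :=
  fun x => \col_(i < 3)
    ('D_(basis3 R (i + 1)) (comp3 u (i + 2%:R)) x
     - 'D_(basis3 R (i + 2%:R)) (comp3 u (i + 1)) x).

(* A space of functions (or of functionals) is given by a set of representatives
   and a seminorm on them; elements at distance 0 represent the same vector. *)
Record space (R : realType) (V : lmodType R) :=
  Space { carrier : set V ; snorm : V -> R }.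

Definition inL2 (R : realType) (Omega : set (point3 R)) (u : vfield R) :=
  (forall i, measurable_fun Omega (comp3 u i)) /\
  (\int[leb3 R]_(x in Omega) (dot (u x) (u x))%:E < +oo)%E.

Definition ip (R : realType) (Omega : set (point3 R)) (u v : vfield R) : R :=
  \int[leb3 R]_(x in Omega) dot (u x) (v x).

Definition L2 (R : realType) (Omega : set (point3 R)) : space (vfield R) :=
  Space (inL2 Omega) (fun u => Num.sqrt (ip Omega u u)).

Definition is_wcurl (R : realType) (Omega : set (point3 R))
    (u c : vfield R) :=
  inL2 Omega c /\
  forall phi, test_field Omega phi -> ip Omega u (curl phi) = ip Omega c phi.

(* The weak curl, well defined up to a null set when it exists (0 otherwise). *)
Definition wcurl (R : realType) (Omega : set (point3 R)) (u : vfield R) :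
  vfield R := xget 0 [set c | is_wcurl Omega u c].

Definition inHcurl (R : realType) (Omega : set (point3 R)) (u : vfield R) :=
  inL2 Omega u /\ exists c, is_wcurl Omega u c.

Definition Hcurl_norm (R : realType) (Omega : set (point3 R))
    (u : vfield R) : R :=
  Num.sqrt (ip Omega u u + ip Omega (wcurl Omega u) (wcurl Omega u)).

Definition Hcurl (R : realType) (Omega : set (point3 R)) : space (vfield R) :=
  Space (inHcurl Omega) (Hcurl_norm Omega).

(* For v in H(curl; Omega) the trace v x nu on the boundary is the functional
   phi |-> \int_(bd Omega) (v x nu) . phi dS, which is defined by Green's formula
   as (v, curl phi) - (curl v, phi), for phi smooth up to the boundary. *)
Definition tangential_trace (R : realType) (Omega : set (point3 R))
    (v phi : vfield R) : R :=
  ip Omega v (curl phi) - ip Omega (wcurl Omega v) phi.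

Definition inH0curl (R : realType) (Omega : set (point3 R)) (v : vfield R) :=
  inHcurl Omega v /\
  forall phi, smooth_field phi -> tangential_trace Omega v phi = 0.

Definition H0curl (R : realType) (Omega : set (point3 R)) : space (vfield R) :=
  Space (inH0curl Omega) (Hcurl_norm Omega).

Definition weak_div_free (R : realType) (Omega : set (point3 R))
    (u : vfield R) :=
  forall f, test_fun Omega f -> ip Omega u (grad f) = 0.

(* The dual of X; only the values of a functional on the carrier of X matter. *)
Definition dual (R : realType) (V : lmodType R) (X : space V) :
    space (V -> R^o) :=
  Space
    [set G : V -> R^o |
      (forall (a : R) u v, carrier X u -> carrier X v ->
         G (a *: u + v) = a * G u + G v) /\
      exists C : R, forall u, carrier X u -> `|G u| <= C * snorm X u]
    (fun G => sup [set `|G u| | u in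
                     [set u | carrier X u /\ snorm X u <= 1]]).

(* Tensors in L^infinity(Omega; R^(3 x 3)) *)
Definition Linfty (R : realType) (Omega : set (point3 R)) (A : tensor3 R) :=
  forall i j, measurable_fun Omega (fun x => A x i j) /\
    exists M : R, {ae leb3 R, forall x, Omega x -> `|A x i j| <= M}.

Definition symmetric_ae (R : realType) (Omega : set (point3 R))
    (A : tensor3 R) :=
  {ae leb3 R, forall x, Omega x -> (A x)^T = A x}.

Definition coercive_ae (R : realType) (Omega : set (point3 R))
    (a0 : R) (A : tensor3 R) :=
  {ae leb3 R, forall x, Omega x ->
    forall xi : 'cV[R]_3, a0 * dot xi xi <= dot xi (A x *m xi)}.

Definition psd_ae (R : realType) (Omega : set (point3 R)) (A : tensor3 R) :=
  {ae leb3 R, forall x, Omega x ->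
    forall xi : 'cV[R]_3, 0 <= dot xi (A x *m xi)}.

Definition app (R : realType) (A : tensor3 R) (u : vfield R) : vfield R :=
  fun x => A x *m u x.

Definition tinv (R : realType) (A : tensor3 R) : tensor3 R :=
  fun x => invmx (A x).

Definition simple_in (R : realType) (V : lmodType R) (X : space V)
    (s : R -> V) :=
  exists (n : nat) (A : 'I_n -> set R) (v : 'I_n -> V),
    (forall i, measurable (A i) /\ carrier X (v i)) /\
    forall t, s t = \sum_(i < n) (\1_(A i) t : R) *: v i.

(* Bochner (strong) measurability on ]0, T[, as a pointwise limit of simple
   functions; every a.e. class of the a.e. variant has such a representative. *)
Definition strongly_measurable (R : realType) (V : lmodType R) (T : R)
    (X : space V) (u : R -> V) :=
  (forall t, 0 < t < T -> carrier X (u t)) /\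
  exists s : nat -> R -> V,
    (forall n, simple_in X (s n)) /\
    forall t, 0 < t < T -> (fun n => snorm X (u t - s n t)) @ \oo --> (0 : R).

(* The Bochner space L^2(0, T; X) and its norm *)
Definition inL2B (R : realType) (V : lmodType R) (T : R) (X : space V)
    (u : R -> V) :=
  strongly_measurable T X u /\
  (\int[leb R]_(t in `]0%R, T[) ((snorm X (u t)) ^+ 2)%:E < +oo)%E.

Definition L2B_norm (R : realType) (V : lmodType R) (T : R) (X : space V)
    (u : R -> V) : R :=
  Num.sqrt (\int[leb R]_(t in `]0, T[) (snorm X (u t)) ^+ 2).

Definition inCB (R : realType) (V : lmodType R) (T : R) (X : space V)
    (u : R -> V) :=
  (forall t, 0 <= t <= T -> carrier X (u t)) /\
  forall t0, 0 <= t0 <= T ->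
    (fun t => snorm X (u t - u t0)) @ within `[0, T]%classic (nbhs t0) --> (0 : R).

(* l is in H^1(0, T; X') with weak time derivative dl. The identity
   \int l eta' = - \int dl eta of Bochner integrals in X' is written out on
   elements of X, evaluation at psi being continuous on X'. *)
Definition H1dual_deriv (R : realType) (V : lmodType R) (T : R) (X : space V)
    (l dl : R -> V -> R^o) :=
  [/\ inL2B T (dual X) l, inL2B T (dual X) dl &
    forall psi, carrier X psi ->
    forall eta : R -> R, test_fun (`]0, T[%classic : set R^o) eta ->
      \int[leb R]_(t in `]0, T[) (l t psi * derive1 eta t) =
      - \int[leb R]_(t in `]0, T[) (dl t psi * eta t)].

Definition eq_aeL2 (R : realType) (Omega : set (point3 R)) (u v : vfield R) :=
  {ae leb3 R, forall x, Omega x -> u x = v x}.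

Definition eq_aeB (R : realType) (T : R) (Omega : set (point3 R))
    (u v : R -> vfield R) :=
  {ae leb R, forall t, 0 < t < T -> eq_aeL2 Omega (u t) (v t)}.

Definition weak_solution (R : realType) (Omega : set (point3 R)) (T : R)
    (eps mu sigma : tensor3 R) (E0 B0 : vfield R)
    (f E B : R -> vfield R) :=
  [/\ inCB T (L2 Omega) E /\ inCB T (L2 Omega) B,
    exists dE : R -> vfield R -> R^o,
      H1dual_deriv T (H0curl Omega)
        (fun t psi => ip Omega (app eps (E t)) psi) dE /\
      {ae leb R, forall t, 0 < t < T ->
        forall psi, carrier (H0curl Omega) psi ->
          dE t psi + ip Omega (app sigma (E t)) psi
          - ip Omega (app (tinv mu) (B t)) (wcurl Omega psi)
          = ip Omega (f t) psi},
    exists dB : R -> vfield R -> R^o,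
      H1dual_deriv T (Hcurl Omega) (fun t phi => ip Omega (B t) phi) dB /\
      {ae leb R, forall t, 0 < t < T ->
        forall phi, carrier (Hcurl Omega) phi ->
          dB t phi + ip Omega (E t) (wcurl Omega phi) = 0},
    eq_aeL2 Omega (E 0) E0 & eq_aeL2 Omega (B 0) B0].

Definition inZ (R : realType) (Omega : set (point3 R)) (T : R)
    (z : R -> vfield R) := inL2B T (Hcurl Omega) z.

Definition inY (R : realType) (Omega : set (point3 R)) (T : R)
    (w : (R -> vfield R) * (R -> vfield R)) :=
  inL2B T (L2 Omega) w.1 /\ inL2B T (L2 Omega) w.2.

Definition Y_norm (R : realType) (Omega : set (point3 R)) (T : R)
    (eps mu : tensor3 R) (w : (R -> vfield R) * (R -> vfield R)) : R :=
  Num.sqrt (\int[leb R]_(t in `]0, T[)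
    (ip Omega (app eps (w.1 t)) (w.1 t)
     + ip Omega (app (tinv mu) (w.2 t)) (w.2 t))).

Definition curlB (R : realType) (Omega : set (point3 R))
    (z : R -> vfield R) : R -> vfield R := fun t => wcurl Omega (z t).

(* S maps every control z to the unique weak solution with right-hand side
   Isrc + curl z, uniqueness being that of the a.e. class, as an element of Y. *)
Definition control_to_state (R : realType) (Omega : set (point3 R)) (T : R)
    (eps mu sigma : tensor3 R) (Isrc : R -> vfield R) (E0 B0 : vfield R)
    (S : (R -> vfield R) -> (R -> vfield R) * (R -> vfield R)) :=
  forall z, inZ Omega T z ->
    let f := Isrc + curlB Omega z in
    weak_solution Omega T eps mu sigma E0 B0 f (S z).1 (S z).2 /\
    forall E B, weak_solution Omega T eps mu sigma E0 B0 f E B ->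
      eq_aeB T Omega E (S z).1 /\ eq_aeB T Omega B (S z).2.

Definition cost (R : realType) (Omega : set (point3 R)) (T : R)
    (eps mu : tensor3 R)
    (S : (R -> vfield R) -> (R -> vfield R) * (R -> vfield R))
    (Ed Bd : R -> vfield R) (alpha1 alpha2 : R) (z : R -> vfield R) : R :=
  2^-1 * Y_norm Omega T eps mu (S z - (Ed, Bd)) ^+ 2
  + alpha1 / 2 * L2B_norm T (L2 Omega) z ^+ 2
  + alpha2 / 2 * L2B_norm T (L2 Omega) (curlB Omega z) ^+ 2.

Definition is_minimizer (U : Type) (R : realType) (Z : set U) (J : U -> R)
    (z : U) := Z z /\ forall z', Z z' -> J z <= J z'.

(* Main.v *)
Require Import Defs.
From HB Require Import structures.
From mathcomp Require Import all_boot all_order all_algebra.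
From mathcomp Require Import all_classical all_reals all_analysis.
From mathcomp Require Import measurable_realfun ring lra.
Import Order.TTheory GRing.Theory Num.Theory.
Import numFieldNormedType.Exports.
Import Defs.
Set Implicit Arguments.
Unset Strict Implicit.
Unset Printing Implicit Defensive.
Local Open Scope classical_set_scope.
Local Open Scope ring_scope.

(** Strong convexity makes a minimizing sequence z_n Cauchy in
    L^2(0,T;H(curl)) and S z_n Cauchy in the L^2 norm, so it remains to see that
    the affine map S has a closed graph. Let d_n = S z_n - S z converge to w.
    Integrated over ]0, b[, the weak formulation contains no time derivative, so
    it passes to the limit for a.e. b. One more integration shows that the
    primitive W(t) = \int_0^t w, defined through the Riesz theorem in
    L^2(Omega), solves the homogeneous problem with zero initial data; the
    uniqueness built into S then gives W = 0, hence w = 0. *)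

(** * Semi-inner products and minimizing sequences *)

(** No energy estimate for [S] is derived. A state is only continuous in time with values in L2, so
    it is not an admissible test function for its own equation. The hypothesis on [S] gives
    existence and uniqueness alone, and the direct method gets by with a closed graph, because the
    cost controls the states as well as the controls: along a minimizing sequence the states
    converge by themselves. The limit w is merely square integrable in time, whereas a weak solution
    must be continuous with values in L2, so uniqueness cannot be applied to w. This is why the
    equations are integrated a second time: the primitive W has the required continuity. Every space
    consists of representatives with a seminorm. The curl and [S] are therefore linear, respectively
    affine, only up to null sets, and limits in L2 and in the Bochner spaces are built as pointwise
    limits along fast subsequences. *)

Definition lin_closed (R : realType) (V : lmodType R) (C : set V) :=
  C 0 /\ forall (a : R) u v, C u -> C v -> C (a *: u + v).

Section lin_closed.
Context (R : realType) (V : lmodType R) (C : set V).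
Hypothesis hC : lin_closed C.

Lemma lin_closed0 : C 0. Proof. exact: hC.1. Qed.

Lemma lin_closedP a u v : C u -> C v -> C (a *: u + v).
Proof. exact: hC.2. Qed.

Lemma lin_closedZ a u : C u -> C (a *: u).
Proof. by move=> Cu; rewrite -[_ *: _]addr0; apply: lin_closedP; [|exact: lin_closed0]. Qed.

Lemma lin_closedD u v : C u -> C v -> C (u + v).
Proof. by move=> Cu Cv; rewrite -[u]scale1r; exact: lin_closedP. Qed.

Lemma lin_closedN u : C u -> C (- u).
Proof. by rewrite -scaleN1r; exact: lin_closedZ. Qed.

Lemma lin_closedB u v : C u -> C v -> C (u - v).
Proof. by move=> Cu Cv; apply: lin_closedD => //; exact: lin_closedN. Qed.

Lemma lin_closed_sum n (a : 'I_n -> R) (v : 'I_n -> V) :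
  (forall i, C (v i)) -> C (\sum_(i < n) a i *: v i).
Proof.
move=> Cv; apply: (big_ind C) => [||i _]; first exact: lin_closed0.
- exact: lin_closedD.
- exact: lin_closedZ.
Qed.

End lin_closed.

(** The laws are restricted to a carrier because an integral such as [ip] is linear only on square
    integrable fields. Definiteness is not among them: vectors of seminorm 0 are the null
    classes. *)
Record semi_ip (R : realType) (V : lmodType R) (C : set V)
    (b : V -> V -> R) : Prop := SemiIp {
  sip_closed : lin_closed C ;
  sip_linear : forall a u v w, C u -> C v -> C w ->
    b (a *: u + v) w = a * b u w + b v w ;
  sip_sym : forall u v, C u -> C v -> b u v = b v u ;
  sip_ge0 : forall u, C u -> 0 <= b u u }.

Section semi_ip.
Context (R : realType) (V : lmodType R) (C : set V) (b : V -> V -> R).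
Hypothesis hb : semi_ip C b.
Let hC : lin_closed C := sip_closed hb.

Lemma sip0l w : C w -> b 0 w = 0.
Proof.
move=> Cw; have := sip_linear hb 1 (lin_closed0 hC) (lin_closed0 hC) Cw.
by rewrite scaler0 addr0 mul1r => h; apply: (addrI (b 0 w)); rewrite addr0 -h.
Qed.

Lemma sipZl a u w : C u -> C w -> b (a *: u) w = a * b u w.
Proof.
move=> Cu Cw; have := sip_linear hb a Cu (lin_closed0 hC) Cw.
by rewrite addr0 sip0l// addr0.
Qed.

Lemma sipDl u v w : C u -> C v -> C w -> b (u + v) w = b u w + b v w.
Proof. by move=> Cu Cv Cw; have := sip_linear hb 1 Cu Cv Cw; rewrite scale1r mul1r. Qed.

Lemma sipZr a u w : C u -> C w -> b w (a *: u) = a * b w u.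
Proof.
move=> Cu Cw; rewrite (sip_sym hb)// ?sipZl// ?(sip_sym hb Cu)//.
exact: (lin_closedZ hC).
Qed.

Lemma sipDr u v w : C u -> C v -> C w -> b w (u + v) = b w u + b w v.
Proof.
move=> Cu Cv Cw; rewrite (sip_sym hb)// ?sipDl// ?(sip_sym hb Cw)//.
exact: (lin_closedD hC).
Qed.

Lemma sipBl u v w : C u -> C v -> C w -> b (u - v) w = b u w - b v w.
Proof.
move=> Cu Cv Cw; rewrite sipDl//; last exact: (lin_closedN hC).
by rewrite -scaleN1r sipZl// mulN1r.
Qed.

Lemma sipBr u v w : C u -> C v -> C w -> b w (u - v) = b w u - b w v.
Proof.
move=> Cu Cv Cw; rewrite sipDr//; last exact: (lin_closedN hC).
by rewrite -scaleN1r sipZr// mulN1r.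
Qed.

Lemma sip_sqD a u v : C u -> C v ->
  b (a *: u + v) (a *: u + v) = a ^+ 2 * b u u + 2 * a * b u v + b v v.
Proof.
move=> Cu Cv; have Cau := lin_closedZ hC a Cu.
have Cs := lin_closedD hC Cau Cv.
rewrite sipDl// !sipDr// !sipZl// !sipZr// (sip_sym hb Cv Cu); ring.
Qed.

Lemma sip_sqB u v : C u -> C v ->
  b (u - v) (u - v) = b u u - 2 * b u v + b v v.
Proof.
move=> Cu Cv; rewrite addrC -scaleN1r sip_sqD// (sip_sym hb Cv Cu); ring.
Qed.

Lemma sip_parallelogram u v : C u -> C v ->
  b (2^-1 *: (u + v)) (2^-1 *: (u + v)) =
  2^-1 * b u u + 2^-1 * b v v - 4^-1 * b (u - v) (u - v).
Proof.
move=> Cu Cv; have Cs := lin_closedD hC Cu Cv.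
rewrite sipZl// ?sipZr//; last exact: (lin_closedZ hC).
rewrite sip_sqB// -[X in b (X + _)]scale1r -[X in b _ (X + _)]scale1r sip_sqD//.
by field.
Qed.

Lemma sip_cauchy_schwarz u v : C u -> C v ->
  `|b u v| <= Num.sqrt (b u u) * Num.sqrt (b v v).
Proof.
move=> Cu Cv; have bu := sip_ge0 hb Cu; have bv := sip_ge0 hb Cv.
rewrite -sqrtrM// -sqrtr_sqr ler_sqrt; last exact: mulr_ge0.
have q a : 0 <= a ^+ 2 * b u u + 2 * a * b u v + b v v.
  by rewrite -sip_sqD//; apply: (sip_ge0 hb); exact: (lin_closedP hC).
have [u0|un0] := eqVneq (b u u) 0.
  (* If [b u u = 0], the quadratic [q] is affine in [a]; were its slope nonzero, this value of [a]
     would make it equal to -1. *)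
  have h : b u v = 0.
    apply/eqP/negPn/negP => n0.
    have := q (- (b v v + 1) / (2 * b u v)); rewrite u0 mulr0 add0r.
    have -> : 2 * (- (b v v + 1) / (2 * b u v)) * b u v = - (b v v + 1).
      by field.
    lra.
  by rewrite h expr0n/= u0 mul0r.
have up : 0 < b u u by rewrite lt_neqAle eq_sym un0.
(* The point where the quadratic is smallest. *)
have := q (- b u v / b u u).
have -> : (- b u v / b u u) ^+ 2 * b u u + 2 * (- b u v / b u u) * b u v + b v v
   = (b u u * b v v - b u v ^+ 2) / b u u by field.
by rewrite pmulr_lge0 ?invr_gt0// subr_ge0.
Qed.

Lemma sip_normD u v : C u -> C v ->
  Num.sqrt (b (u + v) (u + v)) <= Num.sqrt (b u u) + Num.sqrt (b v v).
Proof.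
move=> Cu Cv; have bu := sip_ge0 hb Cu; have bv := sip_ge0 hb Cv.
rewrite -(@ler_pXn2r _ 2)// ?nnegrE ?sqrtr_ge0 ?addr_ge0 ?sqrtr_ge0//.
rewrite sqr_sqrtr; last by apply: (sip_ge0 hb); exact: (lin_closedD hC).
rewrite sqrrD !sqr_sqrtr//.
rewrite -[X in b (X + _)]scale1r -[X in b _ (X + _)]scale1r sip_sqD//.
have := le_trans (ler_norm _) (sip_cauchy_schwarz Cu Cv).
rewrite -mulr_natl; lra.
Qed.

Lemma sip_normZ a u : C u ->
  Num.sqrt (b (a *: u) (a *: u)) = `|a| * Num.sqrt (b u u).
Proof.
move=> Cu; rewrite sipZl ?sipZr//; last exact: (lin_closedZ hC).
by rewrite mulrA -expr2 sqrtrM ?sqr_ge0// sqrtr_sqr.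
Qed.

Lemma sip_sq_quasi u v : C u -> C v ->
  b (u + v) (u + v) <= 2 * b u u + 2 * b v v.
Proof.
move=> Cu Cv.
have : 0 <= b (u - v) (u - v).
  by apply: (sip_ge0 hb); exact: (lin_closedB hC).
rewrite sip_sqB// -[X in b (X + _)]scale1r -[X in b _ (X + _)]scale1r sip_sqD//.
lra.
Qed.

End semi_ip.

(** [D] is the convexity gap at a midpoint. The midpoint costs at least the infimum [j], so for two
    almost minimizers the gap is bounded by their excesses over [j]. Both the Riesz theorem and the
    control problem get their Cauchy sequences from here. *)
Lemma minimizing_sequence (R : realType) (V : lmodType R) (C : set V)
    (J : V -> R) (D : V -> V -> R) (m : R) :
  lin_closed C -> (forall u, C u -> m <= J u) ->
  (forall u v, C u -> C v ->
     J (2^-1 *: (u + v)) <= 2^-1 * J u + 2^-1 * J v - D u v) ->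
  exists (j : R) (z : nat -> V),
    [/\ forall u, C u -> j <= J u, forall n, C (z n),
      forall n, J (z n) <= j + n.+1%:R^-1 &
      forall n p, D (z n) (z p) <= n.+1%:R^-1 + p.+1%:R^-1].
Proof.
move=> hC Jm JD.
have hinf : has_inf [set J u | u in C].
  split; first by exists (J 0), 0 => //; exact: (lin_closed0 hC).
  by exists m => _ [u Cu <-]; exact: Jm.
pose j := inf [set J u | u in C].
have jle u : C u -> j <= J u by move=> Cu; apply: ge_inf; [exact: hinf.2|exists u].
have /choice[z hz] : forall n, exists u, C u /\ J u <= j + n.+1%:R^-1.
  move=> n; have [_ [u Cu <-] hu] := inf_adherent (ltac:(by rewrite invr_gt0 ltr0Sn) : 0 < n.+1%:R^-1 :> R) hinf.
  by exists u; split=> //; exact: ltW.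
exists j, z; split=> // [n|n|n p]; [exact: (hz n).1|exact: (hz n).2|].
have [Cn Jn] := hz n; have [Cp Jp] := hz p.
have := JD _ _ Cn Cp; have := jle _ (lin_closedZ hC 2^-1 (lin_closedD hC Cn Cp)).
have : 0 <= n.+1%:R^-1 :> R by rewrite invr_ge0.
have : 0 <= p.+1%:R^-1 :> R by rewrite invr_ge0.
move: Jn Jp; move: (n.+1%:R^-1) (p.+1%:R^-1) (J _) (J _) (J _) => x y a b c; lra.
Qed.

Definition complete_space (R : realType) (V : lmodType R) (X : space V) :=
  forall u : nat -> V, (forall n, carrier X (u n)) ->
    (forall e, 0 < e -> exists N, forall n p, (N <= n)%N -> (N <= p)%N ->
       snorm X (u n - u p) < e) ->
    exists2 l, carrier X l & (fun n => snorm X (u n - l)) @ \oo --> (0 : R).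

Lemma inv_succ_cvg0 (R : realType) (c e : R) : 0 <= c -> 0 < e ->
  exists N, forall n p, (N <= n)%N -> (N <= p)%N ->
    c * (n.+1%:R^-1 + p.+1%:R^-1) < e.
Proof.
(* The summand 1 keeps the denominator positive when [c = 0]. *)
move=> c0 e0; have q0 : 0 < e / (2 * c + 1) by rewrite divr_gt0//; lra.
have [N hN] := ltr_add_invr q0.
exists N => n p Nn Np; rewrite add0r in hN.
have le k : (N <= k)%N -> k.+1%:R^-1 <= N.+1%:R^-1 :> R.
  by move=> Nk; rewrite lef_pV2 ?posrE// ler_nat.
have [hn hp] := (le _ Nn, le _ Np).
have h : c * (n.+1%:R^-1 + p.+1%:R^-1) <= c * (2 * N.+1%:R^-1).
  apply: ler_wpM2l => //; move: hn hp.
  by move: (n.+1%:R^-1) (p.+1%:R^-1) (N.+1%:R^-1) => x y w; lra.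
apply: (le_lt_trans h).
move: hN; rewrite ltr_pdivlMr; last lra.
have : 0 < N.+1%:R^-1 :> R by rewrite invr_gt0.
move: (N.+1%:R^-1) => x x0; nra.
Qed.

(** The representative is a minimizer of [2^-1 * b u u - F u], whose Euler equation is
    [b w v = F v]. The parallelogram identity makes minimizing sequences Cauchy. *)
Lemma riesz (R : realType) (V : lmodType R) (C : set V) (b : V -> V -> R)
    (F : V -> R) (c : R) :
  semi_ip C b -> complete_space (Space C (fun u => Num.sqrt (b u u))) ->
  (forall a u v, C u -> C v -> F (a *: u + v) = a * F u + F v) ->
  (forall u, C u -> `|F u| <= c * Num.sqrt (b u u)) ->
  exists2 w, C w & forall v, C v -> b w v = F v.
Proof.
move=> hb hX Flin Fc; have hC := sip_closed hb.
have F0 : F 0 = 0.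
  have := Flin 1 _ _ (lin_closed0 hC) (lin_closed0 hC); rewrite scaler0 addr0.
  by rewrite mul1r => h; apply: (addrI (F 0)); rewrite addr0 -h.
have FZ a u : C u -> F (a *: u) = a * F u.
  by move=> Cu; have := Flin a _ _ Cu (lin_closed0 hC); rewrite F0 !addr0.
pose J u := 2^-1 * b u u - F u.
have Jlow u : C u -> - c ^+ 2 / 2 <= J u.
  move=> Cu; have := le_trans (ler_norm _) (Fc _ Cu).
  have : 0 <= (Num.sqrt (b u u) - c) ^+ 2 by exact: sqr_ge0.
  by rewrite /J -{3}(sqr_sqrtr (sip_ge0 hb Cu)) sqrrB -mulr_natl; lra.
have JD u v : C u -> C v ->
    J (2^-1 *: (u + v)) <= 2^-1 * J u + 2^-1 * J v - 8^-1 * b (u - v) (u - v).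
  move=> Cu Cv; rewrite /J (sip_parallelogram hb)// FZ; last exact: (lin_closedD hC).
  by rewrite -[X in F (X + _)]scale1r Flin//; lra.
have [j [z [jle Cz Jz Dz]]] := minimizing_sequence hC Jlow JD.
have [|w Cw zw] := hX z Cz.
  move=> e e0; have [N hN] := inv_succ_cvg0 (ler0n R 8) (exprn_gt0 2 e0).
  exists N => n p Nn Np /=.
  rewrite -(@ltr_pXn2r _ 2)// ?nnegrE ?sqrtr_ge0// ?(ltW e0)//.
  rewrite sqr_sqrtr; last by apply: (sip_ge0 hb); exact: (lin_closedB hC).
  apply: le_lt_trans (hN n p Nn Np); have := Dz n p.
  by move: (n.+1%:R^-1) (p.+1%:R^-1) => x y; lra.
exists w => // v Cv; rewrite /= in zw.
pose s n := Num.sqrt (b (z n - w) (z n - w)).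
have Czw n : C (z n - w) by exact: (lin_closedB hC).
have sE n : s n ^+ 2 = b (z n - w) (z n - w).
  by rewrite sqr_sqrtr//; exact: (sip_ge0 hb).
pose cw := Num.sqrt (b w w).
(* Expanding [J (z n)] around [w] and dropping the nonnegative [2^-1 * s n ^+ 2] bounds
   [J w - J (z n)] by a multiple of the distance [s n]. *)
have jw : J w <= j.
  have lim : (fun n => j + n.+1%:R^-1 + (cw + c) * s n) @ \oo --> j + 0 + (cw + c) * 0.
    apply: cvgD; last by apply: cvgM => //; exact: cvg_cst.
    by apply: cvgD; [exact: cvg_cst|exact: cvg_harmonic].
  rewrite mulr0 !addr0 in lim.
  rewrite -(cvg_lim _ lim)//; apply: limr_ge; first by apply/cvg_ex; exists j.
  apply: nearW => n; have h1 := Jz n.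
  have : J w - J (z n) <= (cw + c) * s n.
    2: by move: h1; move: (n.+1%:R^-1) (J _) (J _) => x y y'; lra.
  have zE : z n = 1 *: (z n - w) + w by rewrite scale1r subrK.
  have -> : J (z n) = 2^-1 * s n ^+ 2 + b (z n - w) w + 2^-1 * b w w - F (z n - w) - F w.
    by rewrite sE {1}zE /J (sip_sqD hb)// Flin//; field.
  have := le_trans (ler_norm _) (Fc _ (Czw n)).
  have := sip_cauchy_schwarz hb (Czw n) Cw; rewrite -/(s n) -/cw ler_norml => /andP[+ _].
  have := sqr_ge0 (s n); rewrite /J; lra.
have q t : 0 <= t ^+ 2 * (2^-1 * b v v) + t * (b w v - F v).
  have Ct := lin_closedP hC t Cv Cw; have := le_trans jw (jle _ Ct).
  by rewrite /J (sip_sqD hb)// Flin// (sip_sym hb Cv Cw); lra.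
have bv := sip_ge0 hb Cv.
(* This [t] turns the quadratic into a negative multiple of [x ^+ 2], so [x = 0]; the summand 1
   covers the case [b v v = 0]. *)
have := q (- (b w v - F v) / (b v v + 1)); set x := b w v - F v.
have -> : (- x / (b v v + 1)) ^+ 2 * (2^-1 * b v v) + - x / (b v v + 1) * x =
   - (x ^+ 2 * (2^-1 * b v v + 1) / (b v v + 1) ^+ 2).
  by field; lra.
rewrite oppr_ge0 => h.
have {h} : x ^+ 2 * (2^-1 * b v v + 1) <= 0.
  by move: h; rewrite pmulr_lle0// invr_gt0 exprn_gt0//; lra.
rewrite pmulr_lle0; last lra.
move=> h; have /eqP : x ^+ 2 = 0 by apply/eqP; rewrite eq_le h sqr_ge0.
by rewrite sqrf_eq0 /x subr_eq0 => /eqP.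
Qed.

(** * Smooth functions *)

Section smoothn.
Context (R : realType) (E : normedModType R).
Implicit Types f g : E -> R.

(** A version of [smooth] graded by the order of differentiation, so that closure properties can be
    proved by induction on [n]. *)
Fixpoint smoothn (n : nat) f : Prop :=
  if n is n'.+1 then
    (forall x, differentiable f x) /\ forall v, smoothn n' (fun x => 'D_v f x)
  else True.

Lemma smoothP f : smooth f <-> forall n, smoothn n f.
Proof.
split=> [hf n|hf vs x].
  elim: n f hf => //= n IH f hf; split; first exact: (hf [::]).
  move=> v; apply: IH => vs x; have := hf (rcons vs v) x.
  by rewrite foldr_rcons.
have : smoothn (size vs).+1 f by exact: hf.
(* [foldr] applies the last direction first, so the list is taken apart from its end. *)
elim/last_ind: vs f {hf} => [f /= [+ _]//|vs v IH f].
rewrite size_rcons foldr_rcons => -[_ hf]; exact: (IH (fun x => 'D_v f x) (hf v)).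
Qed.

Lemma smoothnW n f : smoothn n.+1 f -> smoothn n f.
Proof.
elim: n f => // n IH f [df hf]; split=> // v; exact: (IH (fun x => 'D_v f x) (hf v)).
Qed.

Lemma smoothn_cst n (c : R) : smoothn n (fun _ : E => c).
Proof.
elim: n c => // n IH c; split=> [x|v]; first exact: differentiable_cst.
have -> : (fun x => 'D_v (fun _ : E => c) x) = (fun _ : E => 0 : R).
  by apply/funext => x; exact: derive_cst.
exact: IH.
Qed.

Lemma smoothnD n f g : smoothn n f -> smoothn n g -> smoothn n (fun x => f x + g x).
Proof.
elim: n f g => // n IH f g [df hf] [dg hg]; split=> [x|v].
  exact: differentiableD.
rewrite (_ : (fun x => _) = fun x => 'D_v f x + 'D_v g x).
  by apply: IH; [exact: hf|exact: hg].
by apply/funext => x; rewrite deriveD//; exact: diff_derivable.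
Qed.

Lemma smoothnM n f g : smoothn n f -> smoothn n g -> smoothn n (fun x => f x * g x).
Proof.
elim: n f g => // n IH f g /[dup] /smoothnW f' [df hf] /[dup] /smoothnW g' [dg hg].
split=> [x|v]; first exact: differentiableM.
rewrite (_ : (fun x => _) = fun x => f x * 'D_v g x + g x * 'D_v f x).
  by apply: smoothnD; apply: IH => //; [exact: hg|exact: hf].
by apply/funext => x; rewrite deriveM//; exact: diff_derivable.
Qed.

Lemma smoothnV n f : (forall x, f x != 0) -> smoothn n f -> smoothn n (fun x => (f x)^-1).
Proof.
move=> f0; elim: n => // n IH /[dup] /smoothnW f' [df hf]; split=> [x|v].
  exact: differentiableV.
rewrite (_ : (fun x => _) = fun x => (-1 * ((f x)^-1 * (f x)^-1)) * 'D_v f x).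
  apply: smoothnM; last exact: hf.
  by apply: smoothnM; [exact: smoothn_cst|apply: smoothnM; exact: IH].
apply/funext => x; rewrite deriveV//; last exact: diff_derivable.
by rewrite expr2 invfM mulN1r.
Qed.

Lemma derive_comp1 (h : R -> R) (l : E -> R) v x :
  differentiable (h : R^o -> R) (l x) -> differentiable l x ->
  'D_v (h \o l) x = 'D_1 (h : R^o -> R) (l x) * 'D_v l x.
Proof.
move=> dh dl; rewrite deriveE; last exact: (@differentiable_comp _ _ R^o).
rewrite (@diff_comp _ E R^o)// /= -(deriveE v dl); set t := 'D_v l x.
have {1}-> : t = t *: (1 : R^o) by rewrite -[_ *: 1]/(_ * 1) mulr1.
by rewrite linearZ/= -deriveE// mulrC.
Qed.

End smoothn.

Section smoothn_comp.
Context (R : realType) (E : normedModType R).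

(** The directional derivatives [L v] of [l] do not depend on the point, so a derivative of
    [h (l x)] is again a function of [l x] times a constant and the induction closes. *)
Lemma smoothn_comp_affine n (h : R -> R) (l : E -> R) (L : E -> R) :
  (forall x, differentiable l x) -> (forall v x, 'D_v l x = L v) ->
  @smoothn R R^o n h -> smoothn n (fun x => h (l x)).
Proof.
move=> dl hl; elim: n h => // n IH h [dh hh]; split=> [x|v].
  exact: (@differentiable_comp _ _ R^o).
rewrite (_ : (fun x => _) = fun x => 'D_1 (h : R^o -> R) (l x) * L v).
  by apply: smoothnM; [exact: (IH (fun y : R^o => 'D_1 (h : R^o -> R) y) (hh 1))|exact: smoothn_cst].
by apply/funext => x; rewrite -(hl v x); exact: (derive_comp1 v (dh (l x)) (dl x)).
Qed.

Lemma smoothn_derive1 n (h h' : R -> R) :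
  (forall x : R, is_derive (x : R^o) 1 h (h' x)) ->
  @smoothn R R^o n h' -> @smoothn R R^o n.+1 h.
Proof.
move=> hh sh; have dh (x : R^o) : differentiable (h : R^o -> R) x.
  by apply/derivable1_diffP; case: (hh x).
split=> // v; rewrite (_ : (fun x => _) = fun x => v * h' x).
  by apply: smoothnM => //; exact: smoothn_cst.
apply/funext => x; rewrite deriveE//.
have {1}-> : v = v *: (1 : R^o) by rewrite -[_ *: 1]/(_ * 1) mulr1.
by rewrite linearZ/= -deriveE//; case: (hh x) => _ ->.
Qed.

Lemma smoothn_comp_affine1 n (h : R -> R) (a b : R) :
  @smoothn R R^o n h -> @smoothn R R^o n (fun x => h (a * x + b)).
Proof.
have d (x : R) v : is_derive (x : R^o) v (fun y : R^o => a * y + b : R) (a * v).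
  have := is_deriveD (is_deriveZ a (is_derive_id (x : R^o) v)) (is_derive_cst (b : R^o) x v).
  by rewrite addr0.
elim: n h => // n IH h [dh hh].
have dl (x : R^o) : differentiable (fun y : R^o => a * y + b : R) x.
  by apply/derivable1_diffP; case: (d x 1).
split=> [x|v]; first exact: (@differentiable_comp _ _ R^o).
rewrite (_ : (fun x => _) = fun x => 'D_1 (h : R^o -> R) (a * x + b) * (a * v)).
  apply: smoothnM; last exact: smoothn_cst.
  exact: (IH (fun y : R^o => 'D_1 (h : R^o -> R) y) (hh 1)).
apply/funext => x; have [_ <-] := d x v.
exact: (@derive_comp1 _ R^o h (fun y : R^o => a * y + b) v x).
Qed.

End smoothn_comp.

(** * A smooth step built from exp (- 1 / x) *)

Section smooth_step.
Context (R : realType).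
Implicit Types (x : R) (k n : nat).

(** The power [k] is carried along because differentiation raises it: the family is closed under
    differentiation up to linear combinations. *)
Definition flat k x : R := if 0 < x then x^-1 ^+ k * expR (- x^-1) else 0.

(** The exponential of [x^-1] dominates the term of order [k.+2] of its series. The two powers
    gained over [k] make the bound quadratic in [x], which gives the derivative 0 at the origin. *)
Lemma flat_le k x : `|flat k x| <= (k.+2)`!%:R * x ^+ 2.
Proof.
rewrite /flat; case: ifPn => [x0|_]; last by rewrite normr0 mulr_ge0// sqr_ge0.
have xV : 0 < x^-1 by rewrite invr_gt0.
rewrite ger0_norm ?mulr_ge0 ?exprn_ge0 ?expR_ge0 ?(ltW xV)//.
have f0 : 0 < (k.+2)`!%:R :> R by rewrite ltr0n fact_gt0.
have : x^-1 ^+ k.+2 / (k.+2)`!%:R <= expR (x^-1).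
  by have := expR_ge1Dxn k.+1 (ltW xV); apply: le_trans; rewrite lerDr.
rewrite ler_pdivrMr// expRN ler_pdivrMr ?expR_gt0// => h.
rewrite (_ : x^-1 ^+ k = x^-1 ^+ k.+2 * x ^+ 2); last first.
  by rewrite !exprS expr0 mulr1; field; rewrite gt_eqF.
by rewrite [leRHS]mulrAC ler_wpM2r ?sqr_ge0// mulrC.
Qed.

Lemma is_derive_flat k x :
  is_derive (x : R^o) 1 (flat k) (- k%:R * flat k.+1 x + flat k.+2 x).
Proof.
have [x0|x0|->] := ltgtP x 0.
- rewrite /flat ltNge (ltW x0)/= mulr0 addr0.
  apply: (@near_eq_is_derive _ _ _ (cst 0)) => //.
  near=> y; rewrite /= ltNge; suff /ltW -> : y < 0 by [].
  by near: y; exact: lt_nbhsl.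
- apply: (@near_eq_is_derive _ _ _ (fun y : R^o => y^-1 ^+ k * expR (- y^-1))).
    near=> y; rewrite /flat; suff -> : 0 < y by [].
    by near: y; exact: lt_nbhsr.
  have xn0 : x != 0 by rewrite gt_eqF.
  have dV : is_derive (x : R^o) 1 (fun y : R^o => y^-1) (- x ^- 2).
    have := @is_deriveV R id x 1 1 xn0 (is_derive_id _ _).
    by rewrite -[_ *: 1]/(_ * 1) mulr1.
  have dN : is_derive (x : R^o) 1 (fun y : R^o => - y^-1) (x ^- 2).
    by have := is_deriveN dV; rewrite opprK.
  have dE : is_derive (x : R^o) 1 (fun y : R^o => expR (- y^-1)) (expR (- x^-1) * x ^- 2).
    exact: (@is_derive1_comp R expR (fun y => - y^-1) x _ _ (is_derive_expR _) dN).
  have dX : is_derive (x : R^o) 1 (fun y : R^o => y^-1 ^+ k)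
      (k%:R * x^-1 ^+ k.-1 * - x ^- 2).
    by have := is_deriveX k dV; rewrite exprfctE.
  have := is_deriveM dX dE; rewrite mulrfctE.
  move=> /is_derive_eq; apply; rewrite /flat x0 -![_ *: _]/(_ * _) -!exprVn.
  case: k {dX} => [|k]; first by rewrite !expr0 /=; ring.
  by rewrite /= !exprS; ring.
rewrite /flat ltxx mulr0 addr0.
(* By [flat_le] the difference quotient at 0 is at most a constant times [|h|]. *)
have lim : h^-1 *: ((flat k \o shift (0 : R^o)) (h *: (1 : R^o)) - flat k 0) @[h --> 0^'] --> (0 : R).
  apply/cvgr0Pnorm_lt => e e0; near=> h.
  rewrite /= /flat ltxx subr0 addr0 -/(flat k _) -[h *: 1]/(h * 1) mulr1.
  rewrite -[_ *: _]/(_ * _) normrM normfV.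
  have h0 : 0 < `|h| by rewrite normr_gt0; near: h; exact: nbhs_dnbhs_neq.
  rewrite mulrC ltr_pdivrMr//; apply: le_lt_trans (flat_le _ _) _.
  rewrite -(real_normK (num_real h)) expr2 mulrA ltr_pM2r//.
  have f0 : 0 < (k.+2)`!%:R :> R by rewrite ltr0n fact_gt0.
  rewrite mulrC -ltr_pdivlMr//; near: h; apply: dnbhs0_lt; exact: divr_gt0.
apply: DeriveDef.
  by apply/cvg_ex; exists (0 : R); exact: lim.
exact: (cvg_lim (@norm_hausdorff _ _) lim).
Unshelve. all: by end_near. Qed.

Lemma smoothn_flat n k : @smoothn R R^o n (flat k).
Proof.
elim: n k => // n IH k; apply: (smoothn_derive1 (is_derive_flat k)).
by apply: smoothnD => //; apply: smoothnM => //; exact: smoothn_cst.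
Qed.

Definition step x : R := flat 0 x / (flat 0 x + flat 0 (1 - x)).

Lemma flat_ge0 x : 0 <= flat 0 x.
Proof. by rewrite /flat; case: ifP => //; rewrite expr0 mul1r expR_ge0. Qed.

Lemma flat_gt0 x : 0 < x -> 0 < flat 0 x.
Proof. by move=> x0; rewrite /flat x0 expr0 mul1r expR_gt0. Qed.

Lemma flat0 x : x <= 0 -> flat 0 x = 0.
Proof. by rewrite /flat ltNge => ->. Qed.

(** [x] and [1 - x] are never both nonpositive. *)
Lemma step_den_gt0 x : 0 < flat 0 x + flat 0 (1 - x).
Proof.
have [x0|x0] := ltP 0 x; first by rewrite ltr_wpDr ?flat_ge0 ?flat_gt0.
by rewrite ltr_wpDl ?flat_ge0 ?flat_gt0//; lra.
Qed.

Lemma step_ge0 x : 0 <= step x.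
Proof. by rewrite divr_ge0 ?flat_ge0// ltW ?step_den_gt0. Qed.

Lemma step_le1 x : step x <= 1.
Proof. by rewrite ler_pdivrMr ?step_den_gt0// mul1r lerDl flat_ge0. Qed.

Lemma step0 x : x <= 0 -> step x = 0.
Proof. by move=> x0; rewrite /step flat0// mul0r. Qed.

Lemma step1 x : 1 <= x -> step x = 1.
Proof.
move=> x1; have := step_den_gt0 x; rewrite /step (@flat0 (1 - x)); last lra.
by rewrite addr0 => h; rewrite divff// gt_eqF.
Qed.

Lemma smoothn_step n : @smoothn R R^o n step.
Proof.
apply: smoothnM; first exact: smoothn_flat.
apply: smoothnV => [x|]; first by rewrite gt_eqF// step_den_gt0.
apply: smoothnD; first exact: smoothn_flat.
rewrite (_ : (fun x => _) = fun x : R^o => flat 0 (-1 * x + 1)).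
  by apply: smoothn_comp_affine1; exact: smoothn_flat.
by apply/funext => x; congr flat; ring.
Qed.

End smooth_step.

(** * Integration *)

Section integrable.
Context d (T : measurableType d) (R : realType) (mu : {measure set T -> \bar R}).
Context (D : set T) (mD : measurable D).
Implicit Types f g h : T -> R.
Local Notation "'Int' f" := (mu.-integrable D (EFin \o f)) (at level 10).

Lemma integrable_measurable f : Int f -> measurable_fun D f.
Proof. by move=> /integrableP[mf _]; apply/measurable_EFinP. Qed.

Lemma integrable_le f g : measurable_fun D f -> Int g ->
  (forall x, D x -> `|f x| <= g x) -> Int f.
Proof.
move=> mf ig fg; apply: (le_integrable mD _ _ ig); first exact/measurable_EFinP.
move=> x Dx; rewrite /= lee_fin; apply: (le_trans (fg x Dx)); exact: ler_norm.
Qed.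

Lemma integrable_lin a f g : Int f -> Int g -> Int (fun x => a * f x + g x).
Proof.
move=> fi gi; rewrite (_ : _ \o _ = (fun x => a%:E * (EFin \o f) x)%E \+ (EFin \o g)).
  by apply: integrableD => //; exact: integrableZl.
by apply/funext => x /=; rewrite EFinD EFinM.
Qed.

Lemma integrable_cst0 : Int (fun=> 0).
Proof. by rewrite (_ : _ \o _ = cst 0%E)//; exact: integrable0. Qed.

Lemma integrableZ a f : Int f -> Int (fun x => a * f x).
Proof.
move=> fi; rewrite (_ : (fun x => _) = (fun x => a * f x + 0)).
  exact: (integrable_lin _ _ integrable_cst0).
by apply/funext => x; rewrite addr0.
Qed.

Lemma integrable_add f g : Int f -> Int g -> Int (fun x => f x + g x).
Proof.
move=> fi gi; rewrite (_ : (fun x => _) = (fun x => 1 * f x + g x)).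
  exact: integrable_lin.
by apply/funext => x; rewrite mul1r.
Qed.

Lemma Rintegral_lin a f g : Int f -> Int g ->
  \int[mu]_(x in D) (a * f x + g x) =
  a * \int[mu]_(x in D) f x + \int[mu]_(x in D) g x.
Proof.
by move=> fi gi; rewrite RintegralD// ?RintegralZl//; exact: integrableZ.
Qed.

Lemma integrable_lty f : (forall x, D x -> 0 <= f x) ->
  Int f <-> measurable_fun D f /\ (\int[mu]_(x in D) (f x)%:E < +oo)%E.
Proof.
move=> f0; have E : (\int[mu]_(x in D) `|(EFin \o f) x| = \int[mu]_(x in D) (f x)%:E)%E.
  by apply: eq_integral => x /set_mem Dx; rewrite /= ger0_norm// f0.
split=> [/integrableP[mf]|[mf i]].
  by rewrite E; split=> //; exact/measurable_EFinP.
by apply/integrableP; split; [exact/measurable_EFinP|rewrite E].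
Qed.

Lemma EFin_Rintegral f : Int f ->
  ((\int[mu]_(x in D) f x)%:E = \int[mu]_(x in D) (f x)%:E)%E.
Proof. by move=> fi; rewrite /Rintegral fineK//; exact: integrable_fin_num. Qed.

Lemma ae_eq_Rintegral f g : measurable_fun D f -> measurable_fun D g ->
  {ae mu, forall x, D x -> f x = g x} ->
  \int[mu]_(x in D) f x = \int[mu]_(x in D) g x.
Proof.
move=> mf mg fg; congr fine; apply: ae_eq_integral => //; try exact/measurable_EFinP.
by apply: filterS fg => x h Dx /=; rewrite h.
Qed.

Lemma ae_eq_integrable f g : measurable_fun D g ->
  {ae mu, forall x, D x -> f x = g x} -> Int f -> Int g.
Proof.
move=> mg fg fi; apply/integrableP; split; first exact/measurable_EFinP.
have /integrableP[mf] := fi; rewrite (@ae_eq_integral _ _ _ mu D (abse \o (EFin \o g)))//.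
- exact: measurableT_comp.
- by apply: measurableT_comp => //; exact/measurable_EFinP.
- by apply: filterS fg => x h Dx /=; rewrite h.
Qed.

Lemma Rintegral_eq0_ae f : Int f -> (forall x, D x -> 0 <= f x) ->
  \int[mu]_(x in D) f x = 0 -> {ae mu, forall x, D x -> f x = 0}.
Proof.
move=> fi f0 int0; have /integrableP[mf _] := fi.
have /(ae_eq_integral_abs mu mD mf) : (\int[mu]_(x in D) `|(EFin \o f) x|)%E = 0%E.
  rewrite -[RHS](congr1 EFin int0) EFin_Rintegral//.
  by apply: eq_integral => x /set_mem Dx; rewrite /= ger0_norm// f0.
by apply: filterS => x h Dx; have [] := h Dx.
Qed.

Lemma Rintegral_dct (f_ : nat -> T -> R) f g :
  (forall n, measurable_fun D (f_ n)) -> measurable_fun D f ->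
  {ae mu, forall x, D x -> (fun n => f_ n x) @ \oo --> f x} ->
  Int g -> (forall n x, D x -> `|f_ n x| <= g x) ->
  Int f /\ (fun n => \int[mu]_(x in D) f_ n x) @ \oo --> \int[mu]_(x in D) f x.
Proof.
move=> mf_ mf cf gi bf.
have cf' : {ae mu, forall x, D x -> (fun n => (EFin \o f_ n) x) @ \oo --> (EFin \o f) x}.
  apply: filterS cf => x cx Dx; apply: cvg_EFin; last exact: cx.
  by apply: nearW.
have bf' : {ae mu, forall x n, D x -> (`|(EFin \o f_ n) x| <= (EFin \o g) x)%E}.
  by apply: aeW => x n Dx; rewrite /= lee_fin bf.
have [fi _ cv] := @dominated_convergence _ _ _ mu D mD (fun n => EFin \o f_ n)
  (EFin \o f) (EFin \o g) (fun n => (measurable_EFinP _ _).2 (mf_ n))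
  ((measurable_EFinP _ _).2 mf) cf' gi bf'.
split=> //; apply: fine_cvg; rewrite -/(Rintegral _ _ _) fineK//.
exact: integrable_fin_num.
Qed.

(* Markov's inequality and Borel-Cantelli in one go: the series of the
   [8 ^+ k * g k] is integrable, hence finite almost everywhere. *)
Lemma ae_geometric_bound (g : nat -> T -> R) :
  (forall k, Int (g k)) -> (forall k x, D x -> 0 <= g k x) ->
  (forall k, \int[mu]_(x in D) g k x <= 8^-1 ^+ k) ->
  {ae mu, forall x, D x -> exists M, forall k, g k x <= M * 4^-1 ^+ k}.
Proof.
(* With the weight [4 ^+ k] the integrals are at most [2 ^- k], so the series has integral at most
   2. *)
move=> gi g0 gle; pose h k x := (4 ^+ k * g k x)%:E.
have h0 k x : D x -> (0 <= h k x)%E.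
  by move=> Dx; rewrite lee_fin mulr_ge0 ?exprn_ge0//; exact: g0.
have mh k : measurable_fun D (h k).
  by apply/measurable_EFinP; apply: integrable_measurable; exact: integrableZ.
have hint k : (\int[mu]_(x in D) h k x <= (2^-1 ^+ k)%:E)%E.
  rewrite -EFin_Rintegral; last exact: integrableZ.
  rewrite RintegralZl// lee_fin.
  have -> : 2^-1 ^+ k = 4 ^+ k * 8^-1 ^+ k :> R.
    by rewrite -exprMn; congr (_ ^+ k); field.
  by rewrite ler_wpM2l ?exprn_ge0.
have sfin : (\int[mu]_(x in D) \sum_(0 <= k <oo) h k x < +oo)%E.
  rewrite integral_nneseries//.
  apply: (@le_lt_trans _ _ 2%:E); last exact: ltry.
  have geo : (\sum_(0 <= k <oo) (2^-1 ^+ k)%:E = (2 : R)%:E)%E.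
    have /(cvg_lim (@ereal_hausdorff R)) := @cvg_geometric_eseries_half R 2 0.
    rewrite expr0 divr1 => <-; congr (limn _); apply/funext => n.
    apply: eq_bigr => k _; congr EFin; rewrite addn1 natrX exprS exprVn.
    by field; rewrite expf_neq0.
  rewrite -geo; apply: lee_nneseries => k _; last exact: hint.
  by move=> _; apply: integral_ge0 => x; exact: h0.
have si : mu.-integrable D (fun x => \sum_(0 <= k <oo) h k x)%E.
  apply/integrableP; split.
    by apply: ge0_emeasurable_sum => // k x Dx _; exact: h0.
  move: sfin; congr (_ < _)%E; apply: eq_integral => x /set_mem Dx.
  by rewrite gee0_abs//; apply: nneseries_ge0 => k _ _; exact: h0.
have := integrable_ae mD si; apply: filterS => x hx Dx.
(* The constant is the sum of the series at [x], which bounds each of its nonnegative terms. *)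
exists (fine (\sum_(0 <= k <oo) h k x)%E) => k.
rewrite -ler_pdivrMr ?exprn_gt0// -lee_fin fineK; last exact: hx.
rewrite exprVn invrK mulrC -/(h k x).
rewrite (@nneseriesD1 _ (h^~ x) k xpredT)//; last by move=> i _; exact: h0.
by apply: leeDl; apply: nneseries_ge0 => i _ _; exact: h0.
Qed.

(** The measurable sets over whose trace on [D] the integral vanishes form a Dynkin system; it
    contains the pi-system [G], hence every measurable set. The vanishing of the integral over all
    of [D] supplies the whole space and the complements. *)
Lemma integral_pi_system_ae_eq0 (G : set (set T)) f :
  d.-measurable = <<s G >> -> setI_closed G -> Int f ->
  \int[mu]_(x in D) f x = 0 ->
  (forall A, G A -> \int[mu]_(x in D `&` A) f x = 0) ->
  {ae mu, forall x, D x -> f x = 0}.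
Proof.
move=> mG GI fi intD intG.
have sub A : measurable A -> mu.-integrable (D `&` A) (EFin \o f).
  by move=> mA; apply: integrableS fi => //; exact: measurableI.
have all0 A : measurable A -> \int[mu]_(x in D `&` A) f x = 0.
  rewrite {1}mG; move: A; apply: (dynkin_induction mG GI) => //.
  - by rewrite setIT.
  - move=> A mA intA; have : \int[mu]_(x in D `&` A `|` D `&` ~` A) f x = 0.
      by rewrite -setIUr setUv setIT.
    rewrite Rintegral_setU//.
    + by rewrite intA add0r.
    + exact: measurableI.
    + by apply: measurableI => //; exact: measurableC.
    + by rewrite -setIUr setUv setIT.
    + by apply/disj_setPS => x [[_ ?] [_ ?]].
  - move=> F mF tF intF; rewrite setI_bigcupr /Rintegral integral_bigcup.
    + rewrite eseries0// => i _ _; have := congr1 EFin (intF i).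
      rewrite /Rintegral fineK//; apply: integrable_fin_num; last exact: sub.
      exact: measurableI.
    + exact: trivIset_setIl.
    + by move=> k; exact: measurableI.
    + by rewrite -setI_bigcupr; apply: sub; exact: bigcup_measurable.
have m0 : measurable_fun D (cst 0%E : T -> \bar R) by exact: measurable_cst.
have : ae_eq mu D (EFin \o f) (cst 0%E).
  apply: integral_ae_eq => // E ED mE; rewrite integral0.
  have := congr1 EFin (all0 E mE); rewrite setIidr// /Rintegral fineK//.
  by apply: integrable_fin_num => //; exact: integrableS fi.
by apply: filterS => x h Dx; have [] := h Dx.
Qed.

End integrable.

(** Each stage increases the index by more than the modulus [N k], which gives growth, monotonicity
    and domination of the moduli at once. *)
Lemma fast_subsequence (R : realType) (D : nat -> nat -> R) (e : nat -> R) :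
  (forall k, 0 < e k) ->
  (forall e, 0 < e -> exists N, forall n p, (N <= n)%N -> (N <= p)%N -> D n p < e) ->
  exists f : nat -> nat, [/\ forall k, (k <= f k)%N,
    forall k j, (k <= j)%N -> (f k <= f j)%N &
    forall k n p, (f k <= n)%N -> (f k <= p)%N -> D n p < e k].
Proof.
move=> e0 hD; have /choice[N hN] := fun k => hD (e k) (e0 k).
pose f := fix f k := if k is k'.+1 then ((f k').+1 + N k'.+1)%N else N 0%N.
have fS k : (f k < f k.+1)%N by rewrite /= addSn ltnS leq_addr.
have fN k : (N k <= f k)%N by case: k => //= k; rewrite leq_addl.
exists f; split.
- by elim=> // k IH; exact: leq_ltn_trans IH (fS k).
- move=> k j /subnK <-; elim: (j - k)%N => // i IH; rewrite addSn.
  exact: leq_trans IH (ltnW (fS _)).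
- by move=> k n p h1 h2; apply: hN; exact: leq_trans (fN k) _.
Qed.

Lemma geometric_dist (R : realType) (D : nat -> nat -> R) (C : R) : 0 <= C ->
  (forall k, D k k = 0) -> (forall i j k, D i k <= D i j + D j k) ->
  (forall k, D k.+1 k <= C * 2^-1 ^+ k) ->
  forall k j, (k <= j)%N -> D j k <= 2 * C * 2^-1 ^+ k.
Proof.
move=> C0 D0 Dt DS k j /subnK <-; set i := (j - k)%N.
(* The induction on [i] goes through with the exact partial sum of the geometric series; the last
   term is dropped only at the end. *)
have : D (i + k)%N k <= 2 * C * (2^-1 ^+ k - 2^-1 ^+ (i + k)).
  elim: i => [|i IH]; first by rewrite add0n D0 subrr mulr0.
  rewrite addSn; apply: (le_trans (Dt _ (i + k)%N _)).
  apply: (le_trans (lerD (DS _) IH)); rewrite exprS.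
  by set x := 2^-1 ^+ (i + k); set y := 2^-1 ^+ k; lra.
move=> h; apply: (le_trans h); rewrite ler_wpM2l ?mulr_ge0//.
by rewrite gerBl exprn_ge0.
Qed.

Lemma pow_half_small (R : realType) (C e : R) : 0 <= C -> 0 < e ->
  exists N, forall k, (N <= k)%N -> C * 2^-1 ^+ k < e.
Proof.
move=> C0 e0.
have : (fun k => C * 2^-1 ^+ k) @ \oo --> C * (0 : R).
  by apply: cvgM; [exact: cvg_cst|apply: cvg_expr; rewrite ger0_norm; lra].
rewrite mulr0 => /cvgr0Pnorm_lt/(_ e e0)[N _ hN]; exists N => k /hN.
by rewrite ger0_norm// mulr_ge0// exprn_ge0.
Qed.

Lemma geometric_cvg (R : realType) (a : nat -> R) (C : R) : 0 <= C ->
  (forall k, `|a k.+1 - a k| <= C * 2^-1 ^+ k) -> cvgn a.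
Proof.
move=> C0 ha; apply: cauchy_cvg; apply/cauchy_ballP => e e0.
have hD k j : (k <= j)%N -> `|a j - a k| <= 2 * C * 2^-1 ^+ k.
  apply: (@geometric_dist _ (fun i j => `|a i - a j|)) => //.
    by move=> i; rewrite subrr normr0.
  by move=> p q r; exact: ler_distD.
have [||N hN] := @pow_half_small R (2 * C) (e / 2); [by rewrite mulr_ge0|by rewrite divr_gt0|].
near_simpl; exists ([set n | (N <= n)%N], [set n | (N <= n)%N]).
  by split; exists N.
move=> [n p] /= [Nn Np]; rewrite /ball/=.
have -> : a n - a p = (a n - a N) - (a p - a N) by ring.
apply: le_lt_trans (ler_normB _ _) _.
have := le_lt_trans (hD _ _ Nn) (hN _ (leqnn _)).
have := le_lt_trans (hD _ _ Np) (hN _ (leqnn _)); lra.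
Qed.

Section Rfatou.
Context d (T : measurableType d) (R : realType) (mu : {measure set T -> \bar R}).
Context (D : set T) (mD : measurable D).

(** Fatou in the form used for completeness: the bound is known only from the index [J] on, and the
    integrability of the limit is part of the conclusion. *)
Lemma Rintegral_fatou (f_ : nat -> T -> R) (f : T -> R) (C : R) (J : nat) :
  (forall n, mu.-integrable D (EFin \o f_ n)) -> measurable_fun D f ->
  (forall n x, D x -> 0 <= f_ n x) -> (forall x, D x -> 0 <= f x) ->
  {ae mu, forall x, D x -> (fun n => f_ n x) @ \oo --> f x} ->
  (forall n, (J <= n)%N -> \int[mu]_(x in D) f_ n x <= C) ->
  mu.-integrable D (EFin \o f) /\ \int[mu]_(x in D) f x <= C.
Proof.
move=> fi mf f_0 f0 fcv fC.
have mf_ n := (measurable_EFinP D _).2 (integrable_measurable (fi n)).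
have h : (\int[mu]_(x in D) (f x)%:E <= C%:E)%E.
  have -> : (\int[mu]_(x in D) (f x)%:E = \int[mu]_(x in D) limn_einf (fun n => (f_ n x)%:E))%E.
    apply: ae_eq_integral => //.
    - exact/measurable_EFinP.
    - apply: measurableT_comp => //; apply: measurable_fun_limn_esup => n.
      by apply: measurableT_comp => //; exact: mf_.
    - apply: filterS fcv => x cx Dx; apply/esym.
      by apply: (cvg_limn_einf_sup _).1; apply: cvg_EFin; [exact: nearW|exact: cx].
  have F := @fatou _ _ _ mu D mD (fun n => EFin \o f_ n) mf_ (fun n x Dx => f_0 n x Dx).
  apply: (le_trans F); rewrite limn_einf_lim; apply: lime_le; first exact: is_cvg_einfs.
  near=> n; apply: (@le_trans _ _ (\int[mu]_(x in D) (f_ n x)%:E)%E).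
    by apply: ereal_inf_lbound; exists n => /=.
  rewrite -EFin_Rintegral// lee_fin; apply: fC; near: n; exact: nbhs_infty_ge.
have fi' : mu.-integrable D (EFin \o f).
  by apply/integrable_lty => //; split=> //; apply: le_lt_trans h _; exact: ltry.
by split=> //; rewrite -lee_fin EFin_Rintegral.
Unshelve. all: by end_near. Qed.
End Rfatou.

(** * The du Bois-Reymond lemma *)

Section fubini_kernel.
Context d1 d2 (T1 : measurableType d1) (T2 : measurableType d2) (R : realType).
Context (m1 : {sigma_finite_measure set T1 -> \bar R}).
Context (m2 : {sigma_finite_measure set T2 -> \bar R}).

(** The kernel is bounded by 1, so the product of [|h|] and [|k|] dominates the integrand and Fubini
    applies. Restricted domains are treated afterwards through extension by zero. *)
Let fubini_kernelT (b : T1 * T2 -> R) (k : T1 -> R) (h : T2 -> R) :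
  measurable_fun setT b -> (forall p, `|b p| <= 1) ->
  m1.-integrable setT (EFin \o k) -> m2.-integrable setT (EFin \o h) ->
  \int[m1]_t ((\int[m2]_s (b (t, s) * h s)) * k t) =
  \int[m2]_s (h s * (\int[m1]_t (b (t, s) * k t))).
Proof.
move=> mb b1 ki hi.
have mh := integrable_measurable hi; have mk := integrable_measurable ki.
pose F (p : T1 * T2) := (b p * (h p.2 * k p.1))%:E.
have mhk : measurable_fun setT (fun p : T1 * T2 => h p.2 * k p.1).
  by apply: measurable_funM; apply: measurableT_comp => //.
have mF : measurable_fun setT F by apply/measurable_EFinP; exact: measurable_funM.
pose G (p : T1 * T2) := (`|h p.2| * `|k p.1|)%:E.
have mG : measurable_fun setT G.
  by apply/measurable_EFinP; apply: measurable_funM;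
    apply: measurableT_comp => //; apply: measurableT_comp.
have absi d (T : measurableType d) (m : {measure set T -> \bar R}) f :
    m.-integrable setT (EFin \o f) -> (\int[m]_t `|f t|%:E < +oo)%E.
  by move=> /integrableP[].
have IG : (m1 \x m2)%E.-integrable setT G.
  apply/integrable12ltyP => //.
  have absE t : (\int[m2]_s `|G (t, s)| = `|k t|%:E * \int[m2]_s `|h s|%:E)%E.
    rewrite -ge0_integralZl//=; last by apply/measurable_EFinP; exact: measurableT_comp.
    by apply: eq_integral => s _; rewrite -EFinM ger0_norm ?mulr_ge0// mulrC.
  under eq_integral do rewrite absE.
  rewrite ge0_integralZr//=.
  - by rewrite lte_mul_pinfty ?integral_ge0 ?absi// ge0_fin_numE ?absi ?integral_ge0.
  - by apply/measurable_EFinP; exact: measurableT_comp.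
  - by apply: integral_ge0.
have IF : (m1 \x m2)%E.-integrable setT F.
  apply: le_integrable IG => // p _; rewrite /= lee_fin !normrM !normr_id.
  by rewrite ler_piMl// mulr_ge0.
have := etrans (integral12_prod_meas1 IF) (esym (integral21_prod_meas1 IF)).
move=> E; rewrite /Rintegral; transitivity (fine (\int[m1]_x fubini_F m2 F x)).
  congr fine; apply: eq_integral => t _; rewrite /fubini_F/= /F/=.
  have ii : m2.-integrable setT (EFin \o (fun s => b (t, s) * h s)).
    apply: (integrable_le measurableT _ (integrable_abse hi)) => [|s _].
      by apply: measurable_funM => //; apply: (measurableT_comp mb).
    by rewrite normrM ler_piMl.
  rewrite EFinM [X in (X * _)%E]EFin_Rintegral// muleC -integralZl//.
  by apply: eq_integral => s _; rewrite /= -EFinM; congr EFin; ring.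
rewrite E; congr fine; apply: eq_integral => s _; rewrite /fubini_G/= /F/=.
have ii : m1.-integrable setT (EFin \o (fun t => b (t, s) * k t)).
  apply: (integrable_le measurableT _ (integrable_abse ki)) => [|t _].
    by apply: measurable_funM => //; apply: (measurableT_comp mb).
  by rewrite normrM ler_piMl.
rewrite EFinM [X in (_ * X)%E]EFin_Rintegral// -integralZl//.
by apply: eq_integral => t _; rewrite /= -EFinM; congr EFin; ring.
Qed.

Lemma fubini_kernel (D1 : set T1) (D2 : set T2) (b : T1 * T2 -> R)
    (k : T1 -> R) (h : T2 -> R) : measurable D1 -> measurable D2 ->
  measurable_fun setT b -> (forall p, `|b p| <= 1) ->
  m1.-integrable D1 (EFin \o k) -> m2.-integrable D2 (EFin \o h) ->
  \int[m1]_(t in D1) ((\int[m2]_(s in D2) (b (t, s) * h s)) * k t) =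
  \int[m2]_(s in D2) (h s * (\int[m1]_(t in D1) (b (t, s) * k t))).
Proof.
move=> mD1 mD2 mb b1 ki hi.
have patchi d (T : measurableType d) (m : {measure set T -> \bar R}) D f :
    measurable D -> m.-integrable D (EFin \o f) -> m.-integrable setT (EFin \o (f \_ D)).
  move=> mD fi; rewrite (_ : _ \o _ = (EFin \o f) \_ D).
    exact/(integrable_mkcond _ mD).
  by apply/funext => x; rewrite /patch /=; case: ifP.
have pM T D (c : T -> R) f : (fun x => c x * f x) \_ D = (fun x => c x * (f \_ D) x).
  by apply/funext => x; rewrite /patch; case: ifP => //; rewrite mulr0.
have E := fubini_kernelT mb b1 (patchi _ _ _ _ _ mD1 ki) (patchi _ _ _ _ _ mD2 hi).
rewrite [in LHS]Rintegral_mkcond [in RHS]Rintegral_mkcond.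
transitivity (\int[m1]_t ((\int[m2]_s (b (t, s) * (h \_ D2) s)) * (k \_ D1) t)).
  apply: eq_Rintegral => t _; rewrite /patch; case: ifP => // tD; last by rewrite mulr0.
  by congr (_ * _); rewrite Rintegral_mkcond pM.
rewrite E; apply: eq_Rintegral => s _; rewrite /patch; case: ifP => // sD; last by rewrite mul0r.
by congr (_ * _); rewrite [RHS]Rintegral_mkcond pM.
Qed.

End fubini_kernel.

Lemma measurable_triangle (R : realType) :
  measurable_fun setT (fun p : R * R => (p.2 < p.1)%R%:R : R).
Proof.
rewrite (_ : (fun p => _) = \1_[set p : R * R | p.2 < p.1]); last first.
  by apply/funext => p; rewrite indicE; congr (_%:R); congr nat_of_bool; apply/idP/idP; rewrite inE.
apply: measurable_indic.
rewrite (_ : [set p : R * R | _] = (fun p : R * R => p.2 < p.1) @^-1` [set true]); last first.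
  by apply/seteqP; split=> p /=.
rewrite -[X in measurable X]setTI.
by apply: (measurable_fun_ltr measurable_snd measurable_fst) => //.
Qed.

Lemma fubini_triangle (R : realType) (D : set (measurableTypeR R))
    (h k : measurableTypeR R -> R) : measurable D ->
  (leb R).-integrable D (EFin \o h) -> (leb R).-integrable D (EFin \o k) ->
  \int[leb R]_(t in D) ((\int[leb R]_(s in D) ((s < t)%R%:R * h s)) * k t) =
  \int[leb R]_(s in D) (h s * (\int[leb R]_(t in D) ((s < t)%R%:R * k t))).
Proof.
move=> mD hi ki.
apply: (@fubini_kernel _ _ _ _ R lebesgue_measure lebesgue_measure D D
  (fun p => (p.2 < p.1)%R%:R)) => //; first exact: measurable_triangle.
by move=> p; case: (_ < _)%R; rewrite ?normr1 ?normr0.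
Qed.

Lemma Rintegral_derive1 (R : realType) (F : R -> R) (a b : R) : a < b ->
  (forall x : R, derivable (F : R^o -> R) x 1) -> continuous (derive1 F) ->
  \int[leb R]_(x in `]a, b[) derive1 F x = F b - F a.
Proof.
move=> ab dF cF.
have cF' x : {for x, continuous F}.
  by apply: differentiable_continuous; exact/derivable1_diffP.
have E : (\int[lebesgue_measure]_(x in `[a, b]) (derive1 F x)%:E = (F b)%:E - (F a)%:E)%E.
  apply: (continuous_FTC2 ab); first exact: continuous_subspaceT.
  - split; first by move=> x _; exact: dF.
      by apply: cvg_at_right_filter; exact: cF'.
    by apply: cvg_at_left_filter; exact: cF'.
  - by move=> x _.
have m1 : measurable_fun `]a, b[ (derive1 F).
  by apply: measurable_funTS; exact: continuous_measurable_fun.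
rewrite /Rintegral.
rewrite integral_itv_bndo_bndc; last exact/measurable_EFinP.
rewrite integral_itv_obnd_cbnd; last first.
  by apply/measurable_EFinP; apply: measurable_funTS; exact: continuous_measurable_fun.
by rewrite E.
Qed.

Section smooth1.
Context (R : realType).
Implicit Types f eta : R -> R.

Lemma smooth_derivable f : smooth (f : R^o -> R) -> forall x, derivable (f : R^o -> R) x 1.
Proof. by move=> sf x; apply/derivable1_diffP; exact: (sf [::] x). Qed.

Lemma smooth_derive1 f : smooth (f : R^o -> R) -> smooth (derive1 f : R^o -> R).
Proof.
move=> sf vs x; have := sf (rcons vs 1) x; rewrite foldr_rcons.
rewrite (_ : (derive1 f : R^o -> R) = 'D_1 (f : R^o -> R))//.
by apply/funext => y; rewrite derive1E.
Qed.

Lemma smooth_continuous f : smooth (f : R^o -> R) -> continuous f.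
Proof. by move=> sf x; apply: differentiable_continuous; exact: (sf [::] x). Qed.

Lemma test_fun_out (T : R) eta t : test_fun (`]0, T[%classic : set R^o) eta ->
  ~ (0 < t < T) -> eta t = 0.
Proof.
by move=> [_ [K [_ KT eta0]]] t0T; apply: eta0 => /KT /=; rewrite in_itv.
Qed.

Lemma continuous_integrable_oo f a b : {within `[a, b], continuous f} ->
  (leb R).-integrable `]a, b[ (EFin \o f).
Proof.
move=> cf; have := continuous_compact_integrable (@segment_compact _ a b) cf.
apply: integrableS => //; exact: subset_itv_oo_cc.
Qed.

Lemma integrable_mul_bounded d (X : measurableType d)
    (mu : {measure set X -> \bar R}) D (f h : X -> R) : measurable D ->
  measurable_fun D h -> (exists M, forall x, D x -> `|h x| <= M) ->
  mu.-integrable D (EFin \o f) ->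
  mu.-integrable D (EFin \o (fun x => h x * f x)).
Proof.
move=> mD mh [M hM] fi; have fa : mu.-integrable D (EFin \o (fun x => M * `|f x|)).
  by apply: integrableZ => //; exact: integrable_abse fi.
apply: (integrable_le mD _ fa) => [|x Dx].
  by apply: measurable_funM => //; exact: (integrable_measurable fi).
by rewrite normrM ler_wpM2r// hM.
Qed.

Lemma continuous_bounded_oo f a b : {within `[a, b], continuous f} ->
  exists M, forall x, `]a, b[%classic x -> `|f x| <= M.
Proof.
move=> cf; have [ab|ba] := leP a b; last first.
  by exists 0 => x; rewrite /= in_itv/= => /andP[ax xb]; have := lt_trans ax xb; rewrite ltNge (ltW ba).
have [|c _ hc] := @EVT_max R (fun x => `|f x|) a b ab.
  by move=> x; apply: continuous_comp; [exact: cf|exact: norm_continuous].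
exists `|f c| => x xab; apply: hc; exact: (subset_itv_oo_cc xab).
Qed.

(** As [h] is only integrable, integration by parts is replaced by Fubini on the triangle [s < t]:
    the inner integral of the derivative of [eta] over []s, T[] is [- eta s], because [eta] vanishes
    at [T]. *)
Lemma integral_primitive_parts (T : R) (h eta : R -> R) :
  (leb R).-integrable `]0, T[ (EFin \o h) ->
  test_fun (`]0, T[%classic : set R^o) eta ->
  \int[leb R]_(t in `]0, T[)
    ((\int[leb R]_(s in `]0, T[) ((s < t)%R%:R * h s)) * derive1 eta t) =
  - \int[leb R]_(s in `]0, T[) (h s * eta s).
Proof.
move=> hi teta; have [seta _] := teta.
have cd := smooth_continuous (smooth_derive1 seta).
have di : (leb R).-integrable `]0, T[ (EFin \o derive1 eta).
  by apply: continuous_integrable_oo; exact: continuous_subspaceT.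
have mD : measurable (`]0, T[%classic : set (measurableTypeR R)) by exact: measurable_itv.
rewrite (fubini_triangle mD hi di) -mulN1r -RintegralZl//; last first.
  rewrite (_ : (fun x => h x * _) = (fun x => eta x * h x)); last first.
    by apply/funext => x; rewrite mulrC.
  have ce := continuous_subspaceT (A := `[0, T]) (smooth_continuous seta).
  apply: (integrable_mul_bounded mD _ _ hi); last exact: (continuous_bounded_oo ce).
  apply: measurable_funTS; apply: continuous_measurable_fun.
  exact: smooth_continuous seta.
apply: eq_Rintegral => s /set_mem; rewrite /= in_itv/= => /andP[s0 sT].
rewrite mulN1r -mulrN; congr (_ * _).
have etaT : eta T = 0 by apply: (test_fun_out teta); rewrite ltxx andbF.
rewrite -[RHS]add0r -[X in X - _]etaT.
rewrite -(Rintegral_derive1 sT (smooth_derivable seta) cd).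
rewrite (_ : `]s, T[%classic = `]0, T[ `&` `]s, T[%classic); last first.
  rewrite setIidr// => x /=; rewrite !in_itv/= => /andP[sx ->].
  by rewrite (lt_trans s0 sx).
rewrite Rintegral_mkcondr; apply: eq_Rintegral => t /set_mem.
rewrite /= in_itv/= => /andP[t0 tT]; rewrite patchE; case: ifPn => [/set_mem|/negP tn].
  by rewrite /= in_itv/= => /andP[-> _]; rewrite mul1r.
case: ltP => st; last by rewrite mul0r.
by exfalso; apply: tn; rewrite inE /= in_itv/= st.
Qed.

End smooth1.

(** * Steep ramps and their derivatives *)

Section ramp.
Context (R : realType).

(** Rises from 0 to 1 on the window [[p, p + a^-1]]. *)
Definition ramp (a p s : R) : R := step (a * s + - (a * p)).

Lemma smooth_ramp a p : smooth (ramp a p : R^o -> R).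
Proof. by apply/smoothP => n; apply: smoothn_comp_affine1; exact: smoothn_step. Qed.

Lemma ramp_ge0 a p s : 0 <= ramp a p s. Proof. exact: step_ge0. Qed.

Lemma ramp_le1 a p s : ramp a p s <= 1. Proof. exact: step_le1. Qed.

Lemma ramp0 a p s : 0 < a -> s <= p -> ramp a p s = 0.
Proof. by move=> a0 sp; rewrite /ramp step0// subr_le0 ler_pM2l. Qed.

Lemma ramp1 a p s : 0 < a -> p + a^-1 <= s -> ramp a p s = 1.
Proof.
move=> a0 sp; rewrite /ramp step1// -mulrBr -ler_pdivrMl// mulr1; lra.
Qed.

Lemma smooth_step : smooth (@step R : R^o -> R).
Proof. by apply/smoothP => n; exact: smoothn_step. Qed.

Lemma derive1_ramp a p s : derive1 (ramp a p) s = a * derive1 (@step R) (a * s + - (a * p)).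
Proof.
have d : is_derive (s : R^o) 1 (fun y : R^o => a * y + - (a * p) : R) (a * 1).
  have := is_deriveD (is_deriveZ a (is_derive_id (s : R^o) 1)) (is_derive_cst (- (a * p) : R^o) s 1).
  by rewrite addr0.
have dl : derivable (fun y : R^o => a * y + - (a * p) : R) s 1 by case: d.
rewrite (_ : ramp a p = (@step R) \o (fun y => a * y + - (a * p)))//.
rewrite (derive1_comp dl (@smooth_derivable R _ smooth_step _)) mulrC; congr (_ * _).
by rewrite derive1E; case: d => _ ->; rewrite mulr1.
Qed.

Lemma derive1_step_out y : y < 0 \/ 1 < y -> derive1 (@step R) y = 0.
Proof.
move=> y01; rewrite derive1E.
have [c hc] : exists c, \forall x \near y, step x = c.
  case: y01 => y0.
    by exists 0; near=> x; rewrite step0// ltW//; near: x; exact: lt_nbhsl.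
  by exists 1; near=> x; rewrite step1// ltW//; near: x; exact: lt_nbhsr.
rewrite (@near_eq_derive _ _ _ _ (cst c : R^o -> R))//; exact: derive_cst.
Unshelve. all: by end_near. Qed.

Lemma derive1_ramp_out a p s : 0 < a -> ~ (p <= s <= p + a^-1) ->
  derive1 (ramp a p) s = 0.
Proof.
move=> a0 ps; rewrite derive1_ramp derive1_step_out ?mulr0// -mulrBr.
have [sp|sp] := ltP s p.
  by left; rewrite pmulr_rlt0// subr_lt0.
right; rewrite -ltr_pdivrMl// mulr1 ltrBrDl ltNge; apply/negP => h.
by apply: ps; rewrite sp h.
Qed.

(** By scaling, one constant serves all ramps: the maximum over [[0, 1]] of the derivative of
    [step], which vanishes elsewhere. *)
Lemma derive1_ramp_bound : exists M, 0 <= M /\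
  forall a p s, 0 < a -> `|derive1 (ramp a p) s| <= M * a.
Proof.
have c1 := smooth_continuous (smooth_derive1 smooth_step).
have [|c _ hc] := @EVT_max R (fun x => `|derive1 (@step R) x|) 0 1 ler01.
  by apply: continuous_subspaceT => x; apply: continuous_comp; [exact: c1|exact: norm_continuous].
exists `|derive1 (@step R) c|; split=> // a p s a0.
rewrite derive1_ramp normrM gtr0_norm// mulrC ler_pM2r//.
set y := _ + _; have [y0|y0] := ltP y 0; first by rewrite derive1_step_out ?normr0//; left.
have [y1|y1] := ltP 1 y; first by rewrite derive1_step_out ?normr0//; right.
by apply: hc; rewrite in_itv/= y0.
Qed.

(* The derivative of a steep ramp is an approximate identity. *)
Lemma integral_derive1_ramp : exists M, 0 <= M /\
  forall (T a p c e : R) (g : R -> R), 0 < T -> 0 < a -> 0 <= p -> p + a^-1 <= T ->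
    {within `[0, T], continuous g} ->
    (forall s, p <= s <= p + a^-1 -> `|g s - c| <= e) ->
    `|\int[leb R]_(s in `]0, T[) (g s * derive1 (ramp a p) s) - c| <= M * e.
Proof.
have [M [M0 hM]] := derive1_ramp_bound; exists M; split=> // T a p c e g T0 a0 p0 pT cg gc.
pose mu : {measure set (measurableTypeR R) -> \bar R} := leb R.
pose D : set (measurableTypeR R) := `]0, T[%classic.
pose k := derive1 (ramp a p).
have mD : measurable D by exact: measurable_itv.
have ck : continuous k by exact: smooth_continuous (smooth_derive1 (smooth_ramp a p)).
have mk : measurable_fun D k by apply: measurable_funTS; exact: continuous_measurable_fun.
have ki : mu.-integrable D (EFin \o k).
  by apply: continuous_integrable_oo; exact: continuous_subspaceT.
have gi : mu.-integrable D (EFin \o g) by exact: continuous_integrable_oo.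
have kb : exists N, forall x, D x -> `|k x| <= N.
  by exists (M * a) => x _; exact: hM.
have gki := integrable_mul_bounded mD mk kb gi.
have k1 : \int[mu]_(s in D) k s = 1.
  rewrite (Rintegral_derive1 T0 (@smooth_derivable R _ (smooth_ramp a p)) ck).
  by rewrite ramp1// ramp0// subr0.
(* The kernel has integral 1, so [c] can be moved under the integral. What remains is at most
   [M * a * e] on a window of length [a^-1]. *)
have -> : \int[mu]_(s in D) (g s * k s) - c = \int[mu]_(s in D) (k s * (g s - c)).
  have -> : \int[mu]_(s in D) (k s * (g s - c)) = \int[mu]_(s in D) (- c * k s + k s * g s).
    by apply: eq_Rintegral => s _; ring.
  rewrite Rintegral_lin// k1 mulr1 addrC; congr (_ + _).
  by apply: eq_Rintegral => s _; rewrite mulrC.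
have gci : mu.-integrable D (EFin \o (fun s => g s - c)).
  rewrite (_ : (fun s => g s - c) = (fun s => 1 * g s + - c)); last first.
    by apply/funext => s; rewrite mul1r.
  apply: integrable_lin => //; apply: continuous_integrable_oo.
  by apply: continuous_subspaceT; exact: cst_continuous.
have kgci := integrable_mul_bounded mD mk kb gci.
pose J : set (measurableTypeR R) := `[p, p + a^-1]%classic.
have mJ : measurable J by exact: measurable_itv.
have mDJ : measurable (D `&` J) by exact: measurableI.
have -> : \int[mu]_(s in D) (k s * (g s - c)) = \int[mu]_(s in D `&` J) (k s * (g s - c)).
  rewrite Rintegral_mkcondr; apply: eq_Rintegral => s _; rewrite patchE.
  case: ifPn => // /negP sJ; rewrite /k derive1_ramp_out ?mul0r//.
  by move=> h; apply: sJ; rewrite inE /J /= in_itv.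
have lJ : (mu (D `&` J) <= (a^-1)%:E)%E.
  apply: (@le_trans _ _ (mu J)).
    by apply: le_measure; rewrite ?inE//; exact: subIsetr.
  have := lebesgue_measure_itv `[p, p + a^-1]; rewrite /= lte_fin ltrDl invr_gt0 a0.
  by rewrite -EFinB addrAC subrr add0r => h; rewrite /mu /leb h.
have DJi : mu.-integrable (D `&` J) (EFin \o (fun s => k s * (g s - c))).
  by apply: integrableS kgci => //; exact: subIsetl.
have ci : mu.-integrable (D `&` J) (EFin \o cst (M * a * e)).
  have : mu.-integrable D (EFin \o cst (M * a * e)).
    by apply: continuous_integrable_oo; apply: continuous_subspaceT; exact: cst_continuous.
  by apply: integrableS => //; exact: subIsetl.
apply: (le_trans (le_normr_Rintegral mDJ DJi)).
apply: (@le_trans _ _ (\int[mu]_(s in D `&` J) cst (M * a * e) s)).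
  apply: le_Rintegral => //; first exact: integrable_abse DJi.
  move=> s [_]; rewrite /J /= in_itv/= => sJ.
  by rewrite normrM ler_pM// ?hM// gc.
rewrite Rintegral_cst// -mulrA.
have e0 : 0 <= e by apply: le_trans (gc p _) => //; rewrite lexx lerDl invr_ge0 ltW.
have lf : fine (mu (D `&` J)) <= a^-1.
  by rewrite -lee_fin fineK// ge0_fin_numE//; apply: le_lt_trans lJ _; exact: ltry.
apply: (@le_trans _ _ (M * (a * e) * a^-1)).
  by apply: ler_wpM2l => //; rewrite !mulr_ge0// ltW.
by rewrite -mulrA mulrAC mulfV ?mul1r// gt_eqF.
Qed.

End ramp.

Section du_bois_reymond.
Context (R : realType).

Lemma within_continuousP (T : R) (g : R -> R) :
  {within `[0, T], continuous g} <->
  forall t0, 0 <= t0 <= T -> forall e, 0 < e -> exists2 d, 0 < d &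
    forall s, 0 <= s <= T -> `|s - t0| < d -> `|g s - g t0| < e.
Proof.
split=> [/subspace_continuousP cg t0 t0T e e0|h].
  have t0T' : `[0, T]%classic t0 by rewrite /= in_itv.
  have /cvgrPdist_lt /(_ e e0) := cg t0 t0T'.
  rewrite near_withinE => /nbhs_ballP[d /= d0 hd]; exists d => // s sT sd.
  by rewrite distrC; apply: hd; rewrite ?/ball/= ?in_itv//= distrC.
apply/subspace_continuousP => t0; rewrite /= in_itv/= => t0T.
apply/cvgrPdist_lt => e e0; have [d d0 hd] := h t0 t0T e e0.
rewrite near_withinE; apply/nbhs_ballP; exists d => // s; rewrite /ball/= => sd.
by rewrite in_itv/= => sT; rewrite distrC; apply: hd => //; rewrite distrC.
Qed.

(** The ascent starts at [a^-1] and not at 0, so that the support [[a^-1, b + a^-1]] is a compact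
    part of the open interval. *)
Lemma bump_test (T a b : R) : 0 < a -> a^-1 <= b -> b + a^-1 < T ->
  test_fun (`]0, T[%classic : set R^o) (fun s => ramp a a^-1 s - ramp a b s).
Proof.
move=> a0 ab bT; have a10 : 0 < a^-1 by rewrite invr_gt0.
split.
  apply/smoothP => n; rewrite (_ : (fun s => _) = (fun s => ramp a a^-1 s + (-1) * ramp a b s)).
    apply: smoothnD; first by move: n; apply/smoothP; exact: smooth_ramp.
    by apply: smoothnM; [exact: smoothn_cst|move: n; apply/smoothP; exact: smooth_ramp].
  by apply/funext => s; rewrite mulN1r.
exists `[a^-1, b + a^-1]%classic; split; first exact: segment_compact.
  move=> s /=; rewrite !in_itv/= => /andP[h1 h2].
  by rewrite (lt_le_trans a10 h1) (le_lt_trans h2 bT).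
move=> s /=; rewrite in_itv/= => sn.
have [s1|s1] := leP s a^-1; first by rewrite !ramp0 ?subrr// (le_trans s1).
have s2 : b + a^-1 <= s.
  rewrite leNgt; apply/negP => s2; apply: sn; rewrite (ltW s1)/= ltW//.
by rewrite !ramp1 ?subrr//; lra.
Qed.

Lemma dist_subB (x y a b e1 e2 : R) :
  `|x - a| <= e1 -> `|y - b| <= e2 -> `|a - b - (x - y)| <= e1 + e2.
Proof.
rewrite !ler_norml => /andP[? ?] /andP[? ?]; apply/andP; split; lra.
Qed.

(** The test functions [eta n] climb just after 0 and descend just after [b]. They tend to the
    indicator of []0, b[] while their derivatives act on [g] like the difference of the point masses
    at 0 and at [b]. *)
Lemma du_bois_reymond (T : R) (g h : R -> R) : {within `[0, T], continuous g} ->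
  (leb R).-integrable `]0, T[ (EFin \o h) ->
  (forall eta, test_fun (`]0, T[%classic : set R^o) eta ->
    \int[leb R]_(t in `]0, T[) (g t * derive1 eta t) =
    - \int[leb R]_(t in `]0, T[) (h t * eta t)) ->
  forall b, 0 < b < T ->
    g b = g 0 + \int[leb R]_(s in `]0, T[) ((s < b)%R%:R * h s).
Proof.
move=> cg hi gh b /andP[b0 bT]; have T0 := lt_trans b0 bT.
pose mu : {measure set (measurableTypeR R) -> \bar R} := leb R.
pose D : set (measurableTypeR R) := `]0, T[%classic.
have mD : measurable D by exact: measurable_itv.
pose a n : R := n.+1%:R.
have a0 n : 0 < a n by rewrite ltr0n.
have av n : 0 < (a n)^-1 by rewrite invr_gt0.
pose eta n s := ramp (a n) (a n)^-1 s - ramp (a n) b s.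
have small e : 0 < e -> \forall n \near \oo, (a n)^-1 < e.
  move=> e0; have [N hN] := ltr_add_invr e0; rewrite add0r in hN.
  exists N => // n /= Nn; apply: le_lt_trans hN.
  by rewrite lef_pV2 ?posrE ?ltr0n// ler_nat.
have near_test : \forall n \near \oo, test_fun (`]0, T[%classic : set R^o) (eta n).
  near=> n; apply: bump_test => //.
  - by apply: ltW; near: n; exact: small.
  - by rewrite addrC -ltrBrDr; near: n; apply: small; rewrite subr_gt0.
have ram_c p n : continuous (ramp (a n) p) by exact: smooth_continuous (smooth_ramp _ _).
have mram p n : measurable_fun D (ramp (a n) p).
  by apply: measurable_funTS; exact: continuous_measurable_fun.
have v_cvg : (fun n => \int[mu]_(t in D) (h t * eta n t)) @ \oo -->
    \int[mu]_(s in D) ((s < b)%R%:R * h s).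
  have habs : mu.-integrable D (EFin \o (fun s => `|h s|)) by exact: integrable_abse hi.
  have mh : measurable_fun D h by exact: integrable_measurable hi.
  apply: (Rintegral_dct mD _ _ _ habs _).2.
  - by move=> n; apply: measurable_funM => //; exact: measurable_funB.
  - apply: measurable_funM => //; apply: measurable_funTS.
    have := @measurableT_comp _ _ _ _ _ _ (fun p : measurableTypeR R * measurableTypeR R => (p.2 < p.1)%R%:R : R)
       _ (fun s => (b, s)) (@measurable_triangle R).
    by apply; exact: measurable_fun_pair.
  (* At [s = b] the bumps equal 1 for large [n] while the indicator is 0; this single point is
     discarded as a null set. *)
  - have : {ae mu, forall s : measurableTypeR R, s != b}.
      exists [set b]; split; first exact: measurable_set1.
        exact: lebesgue_measure_set1.
      by move=> s /= /negP; rewrite negbK => /eqP.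
    apply: filterS => s sb; rewrite /D/= in_itv/= => /andP[s0 sT].
    rewrite mulrC; apply: cvgM; first exact: cvg_cst.
    apply: cvg_near_cst; have [ltsb|] := ltP s b.
      near=> n; rewrite /eta ramp1//; last first.
        have : (a n)^-1 < s / 2 by near: n; apply: small; rewrite divr_gt0.
        by move: ((a n)^-1) => x; lra.
      by rewrite ramp0 ?subr0// ltW.
    rewrite le_eqVlt eq_sym (negbTE sb)/= => ltbs.
    near=> n; rewrite /eta !ramp1 ?subrr//.
    + by rewrite addrC -lerBrDr ltW//; near: n; apply: small; rewrite subr_gt0.
    + have : (a n)^-1 < s / 2 by near: n; apply: small; rewrite divr_gt0.
      by move: ((a n)^-1) => x; lra.
  - move=> n s _; rewrite normrM ler_piMr// /eta.
    have := ramp_ge0 (a n) (a n)^-1 s; have := ramp_ge0 (a n) b s.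
    have := ramp_le1 (a n) (a n)^-1 s; have := ramp_le1 (a n) b s.
    by rewrite ler_norml; move=> *; apply/andP; split; lra.
have u_cvg : (fun n => \int[mu]_(t in D) (g t * derive1 (eta n) t)) @ \oo --> g 0 - g b.
  have [M [M0 hM]] := integral_derive1_ramp R.
  apply/cvgrPdist_le => e e0; pose e' := e / (2 * (M + 1)).
  have e'0 : 0 < e' by rewrite divr_gt0// mulr_gt0//; lra.
  have e'M : M * e' + M * e' <= e.
    rewrite /e'; have -> : M * (e / (2 * (M + 1))) + M * (e / (2 * (M + 1))) = (M / (M + 1)) * e.
      by field; lra.
    by apply: ler_piMl; [exact: ltW|rewrite ler_pdivrMr//; lra].
  have /within_continuousP cg' := cg.
  have [d1 d10 hd1] := cg' 0 (ltac:(by rewrite lexx ltW)) e' e'0.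
  have [d2 d20 hd2] := cg' b (ltac:(by rewrite !ltW)) e' e'0.
  near=> n.
  (* The window of the ascending ramp is [[a^-1, 2 * a^-1]], so it is twice the reciprocal slope
     that has to stay below [d1]. *)
  have n1 : (a n)^-1 < d1 / 2 by near: n; apply: small; rewrite divr_gt0.
  have n2 : (a n)^-1 < d2 by near: n; apply: small.
  have n3 : (a n)^-1 < T - b by near: n; apply: small; rewrite subr_gt0.
  have n4 : (a n)^-1 < T / 2 by near: n; apply: small; rewrite divr_gt0.
  have avn := av n.
  have pT : (a n)^-1 + (a n)^-1 <= T by move: n4; move: ((a n)^-1) => x; clear; lra.
  have bT' : b + (a n)^-1 <= T by move: n3; move: ((a n)^-1) => x; clear; lra.
  have A1 : `|\int[mu]_(s in D) (g s * derive1 (ramp (a n) (a n)^-1) s) - g 0| <= M * e'.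
    apply: (hM T) => // [|s]; first exact: ltW.
    move: n1 avn pT; move: ((a n)^-1) => x n1 x0 pT /andP[s1 s2].
    by apply/ltW/hd1; [|rewrite subr0 ger0_norm]; clear -n1 x0 pT s1 s2 T0; lra.
  have A2 : `|\int[mu]_(s in D) (g s * derive1 (ramp (a n) b) s) - g b| <= M * e'.
    apply: (hM T) => // [|s]; first exact: ltW.
    move: n2 avn bT'; move: ((a n)^-1) => x n2 x0 bT' /andP[s1 s2].
    by apply/ltW/hd2; [|rewrite ger0_norm]; clear -n2 x0 bT' s1 s2 b0; lra.
  have gm p : mu.-integrable D (EFin \o (fun s => g s * derive1 (ramp (a n) p) s)).
    rewrite (_ : (fun s => _) = (fun s => derive1 (ramp (a n) p) s * g s)); last first.
      by apply/funext => s; rewrite mulrC.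
    have ck : continuous (derive1 (ramp (a n) p)).
      exact: smooth_continuous (smooth_derive1 (smooth_ramp (a n) p)).
    apply: integrable_mul_bounded => //.
    - by apply: measurable_funTS; exact: continuous_measurable_fun.
    - by have [M' [_ hM']] := derive1_ramp_bound R; exists (M' * a n) => x _; exact: hM'.
    - exact: continuous_integrable_oo.
  apply: le_trans e'M; apply: le_trans (dist_subB A1 A2).
  rewrite -RintegralB//; rewrite le_eqVlt; apply/orP; left; apply/eqP; congr (`| _ - _ |).
  apply: eq_Rintegral => s _; rewrite -mulrBr; congr (_ * _).
  rewrite !derive1E /eta; apply: deriveB; exact: (@smooth_derivable R _ (smooth_ramp _ _)).
have u_cvg' : (fun n => \int[mu]_(t in D) (g t * derive1 (eta n) t)) @ \oo -->
    - \int[mu]_(s in D) ((s < b)%R%:R * h s).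
  apply: cvg_trans (cvgN v_cvg); apply: near_eq_cvg; near=> n.
  by rewrite /=; apply/esym/gh; near: n.
have E := cvg_unique (@norm_hausdorff _ R) u_cvg u_cvg'.
by rewrite -[LHS](subKr (g 0)) E opprK.
Unshelve. all: by end_near. Qed.

End du_bois_reymond.

(** * Test functions separate integrable functions *)

Lemma sigma_preimage T T1 (f : T -> T1) (G : set (set T)) (C : set (set T1)) :
  (forall A, C A -> <<s G >> (f @^-1` A)) ->
  forall A, <<s C >> A -> <<s G >> (f @^-1` A).
Proof.
move=> CG; apply: smallest_sub => //.
have [s0 sC sU] := @smallest_sigma_algebra _ setT G.
split => /=.
- by rewrite preimage_set0.
- by move=> A /sC; rewrite !setTD.
- by move=> F hF; rewrite preimage_bigcup; apply: sU.
Qed.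

(** The whole spaces must be among the generators: only then is a cylinder over a generator itself a
    product of generators. *)
Lemma measurable_prod_generators d1 d2 (T1 : measurableType d1) (T2 : measurableType d2)
    (C1 : set (set T1)) (C2 : set (set T2)) :
  d1.-measurable = <<s C1 >> -> d2.-measurable = <<s C2 >> -> C1 setT -> C2 setT ->
  @measurable _ (T1 * T2)%type = <<s [set A `*` B | A in C1 & B in C2] >>.
Proof.
move=> M1 M2 C1T C2T; set G := [set _ | _ in _ & _ in _].
rewrite measurable_prod_measurableType eqEsubset; split.
  apply: smallest_sub; first exact: smallest_sigma_algebra.
  move=> _ [A mA] [B mB] <-.
  have -> : A `*` B = (fst @^-1` A) `&` (snd @^-1` B) by [].
  apply: (@measurableI _ (g_sigma_algebraType G)).
  - apply: (sigma_preimage (C := C1)); last by rewrite -M1.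
    move=> A' CA'; apply: sub_sigma_algebra; exists A' => //; exists setT => //.
    by rewrite setXT.
  - apply: (sigma_preimage (C := C2)); last by rewrite -M2.
    move=> A' CA'; apply: sub_sigma_algebra; exists setT => //; exists A' => //.
    by rewrite setTX.
apply: smallest_sub; first exact: smallest_sigma_algebra.
move=> _ [A CA] [B CB] <-; apply: sub_sigma_algebra; exists A.
  by rewrite M1; exact: sub_sigma_algebra.
by exists B => //; rewrite M2; exact: sub_sigma_algebra.
Qed.

(** * Boxes and Borel sets in R^3 *)

Section point3.
Context (R : realType).
Local Notation P3 := (point3 (measurableTypeR R)).

(** Upper rays generate the Borel sets and are stable under intersection; the whole line is added
    for the sake of [measurable_prod_generators]. *)
Definition rays : set (set (measurableTypeR R)) :=
  [set setT] `|` [set A | exists x : R, A = `]x, +oo[%classic].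

Lemma measurable_rays : @measurable _ (measurableTypeR R) = <<s rays >>.
Proof.
rewrite eqEsubset; split.
  move=> A; rewrite -[measurable A]/((@ocitv R).-sigma.-measurable A).
  rewrite RGenOInfty.measurableE; apply: smallest_sub.
    exact: smallest_sigma_algebra.
  by move=> _ [x ->]; apply: sub_sigma_algebra; right; exists x.
apply: smallest_sub.
  by split; [exact: measurable0|move=> A; rewrite setTD; exact: measurableC|exact: bigcupT_measurable].
by move=> _ [->|[x ->]]; [exact: measurableT|exact: measurable_itv].
Qed.

Definition box (a b : point3 R) : set (point3 R) :=
  (`]a.1.1, b.1.1[ `*` `]a.1.2, b.1.2[) `*` `]a.2, b.2[.

Definition cbox (a b : point3 R) : set (point3 R) :=
  (`[a.1.1, b.1.1] `*` `[a.1.2, b.1.2]) `*` `[a.2, b.2].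

Lemma box_mem a b (x : point3 R) : box a b x <->
  [/\ a.1.1 < x.1.1 < b.1.1, a.1.2 < x.1.2 < b.1.2 & a.2 < x.2 < b.2].
Proof. by rewrite /box/=; split=> [[[]]|[]]; rewrite !in_itv/=. Qed.

Lemma cbox_mem a b (x : point3 R) : cbox a b x <->
  [/\ a.1.1 <= x.1.1 <= b.1.1, a.1.2 <= x.1.2 <= b.1.2 & a.2 <= x.2 <= b.2].
Proof. by rewrite /cbox/=; split=> [[[]]|[]]; rewrite !in_itv/=. Qed.

Lemma measurable_box a b : measurable (box a b : set P3).
Proof. by apply: measurableX; [apply: measurableX|]; exact: measurable_itv. Qed.

Lemma compact_cbox a b : compact (cbox a b).
Proof. by apply: compact_setX; [apply: compact_setX|]; exact: segment_compact. Qed.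

Definition boxes : set (set P3) :=
  [set A `*` B | A in [set A `*` B | A in rays & B in rays] & B in rays].

Lemma measurable_boxes : @measurable _ P3 = <<s boxes >>.
Proof.
apply: measurable_prod_generators => //; [|exact: measurable_rays| |by left].
- by apply: measurable_prod_generators; rewrite -?measurable_rays//; left.
- by exists setT; [by left|exists setT; [by left|rewrite setXTT]].
Qed.

Lemma setI_closed_boxes : setI_closed boxes.
Proof.
have hr : setI_closed rays.
  move=> _ _ [->|[x ->]] [->|[y ->]]; rewrite ?setIT ?setTI; [by left|by right; exists y|by right; exists x|].
  right; exists (Num.max x y); apply/seteqP; split=> z /=; rewrite !in_itv/= !andbT gt_max.
    by move=> [-> ->].
  by move=> /andP[].
move=> _ _ [_ [A1 r1 [B1 s1 <-]] [C1 t1 <-]] [_ [A2 r2 [B2 s2 <-]] [C2 t2 <-]].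
rewrite -!setXI; exists ((A1 `&` A2) `*` (B1 `&` B2)).
  by exists (A1 `&` A2); [exact: hr|exists (B1 `&` B2) => //; exact: hr].
by exists (C1 `&` C2) => //; exact: hr.
Qed.

(** Cutting a box by upper rays only raises its lower corner. The closed box around the result
    therefore lies in the old one, and so does not leave any open set that contains the latter. *)
Lemma box_setI_boxes a b A : boxes A -> exists a', 
  (forall x : point3 R, cbox a' b x -> cbox a b x) /\ box a b `&` A = box a' b.
Proof.
have hr (r : R) (B : set R) : rays B -> exists2 r' : R, r <= r' & forall s, r < s /\ B s <-> r' < s.
  move=> [->|[x ->]]; first by exists r => // s; split=> [[]|].
  exists (Num.max r x); first by rewrite le_max lexx.
  move=> s; rewrite gt_max /= in_itv/= andbT; split=> [[-> ->]//|/andP[-> ->]//].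
move=> [_ [A1 r1 [A2 r2 <-]] [A3 r3 <-]].
have [x1 ax1 h1] := hr a.1.1 _ r1; have [x2 ax2 h2] := hr a.1.2 _ r2.
have [x3 ax3 h3] := hr a.2 _ r3; exists ((x1, x2), x3); split.
  move=> x /cbox_mem/=[/andP[y1 z1] /andP[y2 z2] /andP[y3 z3]]; apply/cbox_mem.
  by rewrite z1 z2 z3 !andbT; split; [exact: le_trans ax1 _|exact: le_trans ax2 _|exact: le_trans ax3 _].
apply/seteqP; split=> x.
  move=> [/box_mem[/andP[? ?] /andP[? ?] /andP[? ?]] [[? ?] ?]]; apply/box_mem => /=.
  by split; apply/andP; split=> //; [apply/h1|apply/h2|apply/h3].
move=> /box_mem/=[/andP[/h1[? ?] ?] /andP[/h2[? ?] ?] /andP[/h3[? ?] ?]].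
by split; [apply/box_mem; split; apply/andP|].
Qed.

(** Rational corners give a countable family, so that open sets are countable unions of boxes and
    exceptional null sets can be united. *)
Definition rbox_lo (q : (rat * rat) * (rat * rat) * (rat * rat)) : point3 R :=
  (ratr q.1.1.1, ratr q.1.2.1, ratr q.2.1).
Definition rbox_hi (q : (rat * rat) * (rat * rat) * (rat * rat)) : point3 R :=
  (ratr q.1.1.2, ratr q.1.2.2, ratr q.2.2).

Lemma open_rbox (U : set (point3 R)) x : open U -> U x ->
  exists q, box (rbox_lo q) (rbox_hi q) x /\ cbox (rbox_lo q) (rbox_hi q) `<=` U.
Proof.
move=> oU Ux; have /nbhs_ballP[e /= e0 he] : nbhs x U by exact: open_nbhs_nbhs.
have hq (r : R) : exists q : rat * rat,
    [/\ r - e < ratr q.1, ratr q.1 < r < ratr q.2 & ratr q.2 < r + e].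
  have [q1] := @rat_in_itvoo R (r - e) r (ltac:(by rewrite ltrBlDr ltrDl)).
  have [q2] := @rat_in_itvoo R r (r + e) (ltac:(by rewrite ltrDl)).
  rewrite !in_itv/= => /andP[h1 h2] /andP[h3 h4].
  by exists (q1, q2); split => //=; rewrite h4 h1.
have [q1 [? ? ?]] := hq x.1.1; have [q2 [? ? ?]] := hq x.1.2.
have [q3 [? ? ?]] := hq x.2; exists (q1, q2, q3); split.
  exact/box_mem.
move=> y /cbox_mem/=[/andP[? ?] /andP[? ?] /andP[? ?]]; apply: he.
by split; [split|]; rewrite /ball/= ltr_distlC; apply/andP; split; lra.
Qed.

(** This reconciles the two structures on triples: an open set of the product topology is a
    countable union of rational boxes, hence belongs to the product sigma-algebra. *)
Lemma open_measurable3 (U : set (point3 R)) : open U -> measurable (U : set P3).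
Proof.
move=> oU.
pose F q : set P3 := if `[< cbox (rbox_lo q) (rbox_hi q) `<=` U >] then box (rbox_lo q) (rbox_hi q) else set0.
have -> : U = \bigcup_q F q.
  apply/seteqP; split=> x.
    by move=> /(open_rbox oU)[q [qx qU]]; exists q => //; rewrite /F asboolT.
  move=> [q _]; rewrite /F; case: asboolP => // qU /box_mem[/andP[? ?] /andP[? ?] /andP[? ?]].
  by apply: qU; apply/cbox_mem; split; apply/andP; split; exact: ltW.
apply: countable_bigcupT_measurable; first exact: countableP.
by move=> q; rewrite /F; case: asboolP => _; [exact: measurable_box|exact: measurable0].
Qed.

Lemma continuous_measurable3 (f : point3 R -> R) : continuous f ->
  measurable_fun setT (f : P3 -> measurableTypeR R).
Proof.
move=> cf; apply: (measurability _ (RGenOInfty.measurableE R)) => //.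
move=> _ [_ [x ->] <-]; rewrite setTI; apply: open_measurable3.
by apply: open_comp => //; exact: interval_open.
Qed.

End point3.

(** * Smooth bumps on boxes *)

Section coordinates.
Context (R : realType).

Definition coord3 (i : 'I_3) (x : point3 R) : R := nth 0 [:: x.1.1; x.1.2; x.2] i.

Lemma coord3_continuous i : continuous (coord3 i).
Proof.
move=> x; case: i => [[|[|[|//]]]] ?; rewrite /coord3 /=.
- exact: (@cvg_comp _ _ _ fst fst _ _ _ cvg_fst cvg_fst).
- exact: (@cvg_comp _ _ _ fst snd _ _ _ cvg_fst cvg_snd).
- exact: cvg_snd.
Qed.

Lemma coord3_linear i : linear (coord3 i).
Proof. by move=> a x y; case: i => [[|[|[|//]]]] ?. Qed.

HB.instance Definition _ i := GRing.isLinear.Build R (point3 R) R _ (coord3 i) (coord3_linear i).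

Lemma coord3_differentiable i x : differentiable (coord3 i) x.
Proof. by apply: linear_differentiable; exact: coord3_continuous. Qed.

Lemma coord3_derive i v x : 'D_v (coord3 i) x = coord3 i v.
Proof.
rewrite deriveE; last exact: coord3_differentiable.
by rewrite diff_lin//; exact: coord3_continuous.
Qed.

Lemma smoothn_coord3 n (h : R -> R) i : @smoothn R R^o n h -> smoothn n (fun x => h (coord3 i x)).
Proof.
apply: (@smoothn_comp_affine _ _ n h (coord3 i) (coord3 i)).
- exact: coord3_differentiable.
- exact: coord3_derive.
Qed.

(** The second factor is a ramp run backwards from [q]. The product vanishes outside []p, q[] for
    every slope and is 1 on [[p + a^-1, q - a^-1]]. *)
Definition bump1 (a p q s : R) : R := ramp a p s * ramp a (- q) (- s).

Lemma smoothn_bump1 n a p q : @smoothn R R^o n (bump1 a p q).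
Proof.
apply: smoothnM; first by move: n; apply/smoothP; exact: smooth_ramp.
rewrite (_ : (fun s => _) = (fun s : R^o => ramp a (- q) (-1 * s + 0))).
  by apply: smoothn_comp_affine1; move: n; apply/smoothP; exact: smooth_ramp.
by apply/funext => s; rewrite addr0 mulN1r.
Qed.

Lemma bump1_itv a p q s : 0 <= bump1 a p q s <= 1.
Proof.
by rewrite mulr_ge0 ?ramp_ge0//= mulr_ile1 ?ramp_ge0 ?ramp_le1.
Qed.

Lemma bump1_out a p q s : 0 < a -> ~ (p < s < q) -> bump1 a p q s = 0.
Proof.
move=> a0 psq; rewrite /bump1; have [sp|ps] := leP s p; first by rewrite ramp0// mul0r.
have [qs|sq] := leP q s; first by rewrite [X in _ * X]ramp0 ?mulr0// lerN2.
by exfalso; apply: psq; rewrite ps sq.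
Qed.

Lemma bump1_cvg p q s : p < s < q -> \forall n \near \oo, bump1 n.+1%:R p q s = 1.
Proof.
move=> /andP[ps sq].
have small e : 0 < e -> \forall n \near \oo, (n.+1%:R^-1 : R) < e.
  move=> e0; have [N hN] := ltr_add_invr e0; rewrite add0r in hN.
  exists N => // n /= Nn; apply: le_lt_trans hN.
  by rewrite lef_pV2 ?posrE ?ltr0n// ler_nat.
near=> n; rewrite /bump1 !ramp1 ?mulr1//.
  have : (n.+1%:R^-1 : R) < q - s by near: n; apply: small; rewrite subr_gt0.
  move: (n.+1%:R^-1) => x; lra.
have : (n.+1%:R^-1 : R) < s - p by near: n; apply: small; rewrite subr_gt0.
move: (n.+1%:R^-1) => x; lra.
Unshelve. all: by end_near. Qed.

Definition bump3 (k : R) (a b : point3 R) (x : point3 R) : R :=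
  bump1 k a.1.1 b.1.1 x.1.1 * bump1 k a.1.2 b.1.2 x.1.2 * bump1 k a.2 b.2 x.2.

Lemma smooth_bump3 k a b : smooth (bump3 k a b).
Proof.
apply/smoothP => n; apply: smoothnM; first apply: smoothnM.
- exact: (@smoothn_coord3 n (bump1 k a.1.1 b.1.1) (@Ordinal 3 0 isT) (smoothn_bump1 _ _ _ _)).
- exact: (@smoothn_coord3 n (bump1 k a.1.2 b.1.2) (@Ordinal 3 1 isT) (smoothn_bump1 _ _ _ _)).
- exact: (@smoothn_coord3 n (bump1 k a.2 b.2) (@Ordinal 3 2 isT) (smoothn_bump1 _ _ _ _)).
Qed.

Lemma bump3_out k a b x : 0 < k -> ~ box a b x -> bump3 k a b x = 0.
Proof.
move=> k0 nb; have [h1|h1] := pselect (a.1.1 < x.1.1 < b.1.1); last first.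
  by rewrite /bump3 bump1_out// !mul0r.
have [h2|h2] := pselect (a.1.2 < x.1.2 < b.1.2); last first.
  by rewrite /bump3 [X in _ * X * _]bump1_out// mulr0 mul0r.
have [h3|h3] := pselect (a.2 < x.2 < b.2); last first.
  by rewrite /bump3 [X in _ * X]bump1_out// mulr0.
by exfalso; apply: nb; exact/box_mem.
Qed.

Lemma test_bump3 k a b (U : set (point3 R)) : 0 < k -> cbox a b `<=` U ->
  test_fun U (bump3 k a b).
Proof.
move=> k0 abU; split; first exact: smooth_bump3.
exists (cbox a b); split=> // [|x nx]; first exact: compact_cbox.
apply: bump3_out => // /box_mem[/andP[? ?] /andP[? ?] /andP[? ?]]; apply: nx.
by apply/cbox_mem; split; apply/andP; split; exact: ltW.
Qed.

Lemma bump3_norm k a b x : `|bump3 k a b x| <= 1.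
Proof.
rewrite /bump3; move: (bump1 _ _ _ _) (bump1_itv k a.1.1 b.1.1 x.1.1) => u /andP[? ?].
move: (bump1 _ _ _ _) (bump1_itv k a.1.2 b.1.2 x.1.2) => v /andP[? ?].
move: (bump1 _ _ _ _) (bump1_itv k a.2 b.2 x.2) => w /andP[? ?].
by rewrite ger0_norm ?mulr_ge0// !mulr_ile1 ?mulr_ge0.
Qed.

(* The bumps increase to the indicator functions of boxes, which form a
   generating pi-system. *)
Lemma test_fun_separation (Omega : set (point3 R)) (c : point3 R -> R) :
  open Omega -> (leb3 R).-integrable Omega (EFin \o c) ->
  (forall phi, test_fun Omega phi -> \int[leb3 R]_(x in Omega) (c x * phi x) = 0) ->
  {ae leb3 R, forall x, Omega x -> c x = 0}.
Proof.
move=> oO ci c0.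
pose P3 := point3 (measurableTypeR R); pose mu : {measure set P3 -> \bar R} := leb3 R.
have mO : measurable (Omega : set P3) by exact: open_measurable3.
have mc : measurable_fun (Omega : set P3) c by exact: integrable_measurable ci.
have box0 a b : cbox a b `<=` Omega -> \int[mu]_(x in box a b) c x = 0.
  move=> abO.
  have bO : box a b `<=` Omega.
    move=> x /box_mem[/andP[? ?] /andP[? ?] /andP[? ?]]; apply: abO.
    by apply/cbox_mem; split; apply/andP; split; exact: ltW.
  have -> : \int[mu]_(x in box a b) c x = \int[mu]_(x in Omega) (c \_ (box a b)) x.
    by rewrite -Rintegral_mkcondr setIidr.
  have mb n : measurable_fun (Omega : set P3) (bump3 n.+1%:R a b).
    apply: measurable_funTS; apply: continuous_measurable3 => x.
    by apply: differentiable_continuous; exact: (smooth_bump3 n.+1%:R a b [::] x).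
  have ca : mu.-integrable (Omega : set P3) (EFin \o (fun x => `|c x|)).
    exact: integrable_abse ci.
  have := @Rintegral_dct _ P3 R mu Omega mO (fun n x => c x * bump3 n.+1%:R a b x)
    (c \_ (box a b)) (fun x => `|c x|) _ _ _ ca _.
  move=> /(_ _ _ _ _)/proj2 cv; apply: (cvg_unique (@norm_hausdorff _ R)) (cv _ _ _ _) _.
  - by move=> n; exact: measurable_funM.
  - apply/(measurable_restrict _ (measurable_box a b) mO).
    by apply: measurable_funS mc => //; exact: subIsetr.
  - apply: aeW => x Ox; rewrite patchE; case: ifPn => [/set_mem/box_mem[h1 h2 h3]|/negP nx].
      rewrite -[X in _ --> X]mulr1; apply: cvgM; first exact: cvg_cst.
      apply: cvg_near_cst; near=> n; rewrite /bump3.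
      rewrite (near (bump1_cvg h1) n)// (near (bump1_cvg h2) n)// (near (bump1_cvg h3) n)//.
      by rewrite !mulr1.
    apply: cvg_near_cst; near=> n; rewrite bump3_out ?mulr0//.
    by move=> bx; apply: nx; rewrite inE.
  - by move=> n x _; rewrite normrM ler_piMr// bump3_norm.
  rewrite (_ : (fun n => _) = fun=> 0); first exact: cvg_cst.
  by apply/funext => n; apply: c0; exact: test_bump3.
(* Finite boxes do not exhaust [Omega] one at a time, so the conclusion is drawn on each of the
   countably many rational boxes inside [Omega], which cover it. *)
have ae_box q : {ae mu, forall x : P3, cbox (rbox_lo R q) (rbox_hi R q) `<=` Omega ->
    box (rbox_lo R q) (rbox_hi R q) x -> c x = 0}.
  have [qO|nqO] := pselect (cbox (rbox_lo R q) (rbox_hi R q) `<=` Omega); last first.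
    by apply: aeW => x /nqO.
  have bO : box (rbox_lo R q) (rbox_hi R q) `<=` Omega.
    move=> x /box_mem[/andP[? ?] /andP[? ?] /andP[? ?]]; apply: qO.
    by apply/cbox_mem; split; apply/andP; split; exact: ltW.
  have := @integral_pi_system_ae_eq0 _ P3 R mu (box (rbox_lo R q) (rbox_hi R q))
    (measurable_box _ _) (@boxes R) c (measurable_boxes R) (@setI_closed_boxes R) _ (box0 _ _ qO).
  move=> H; have {H} : {ae mu, forall x : P3, box (rbox_lo R q) (rbox_hi R q) x -> c x = 0}.
    apply: H => [|A bA].
      by apply: integrableS ci => //; exact: measurable_box.
    have [a' [sub ->]] := box_setI_boxes (rbox_lo R q) (rbox_hi R q) bA.
    by apply: box0 => x /sub; exact: qO.
  by apply: filterS => x h _.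
have [f finj] : exists f : nat -> (rat * rat) * (rat * rat) * (rat * rat), forall q, exists n, f n = q.
  exists (fun n => odflt ((0,0),(0,0),(0,0)) (unpickle n)) => q; exists (pickle q).
  by rewrite pickleK.
have : {ae mu, forall x : P3, forall n, cbox (rbox_lo R (f n)) (rbox_hi R (f n)) `<=` Omega ->
    box (rbox_lo R (f n)) (rbox_hi R (f n)) x -> c x = 0}.
  by apply: ae_foralln => n; exact: ae_box.
apply: filterS => x h Ox; have [q [qx qO]] := open_rbox oO Ox.
by have [n fn] := finj q; apply: (h n); rewrite fn.
Unshelve. all: by end_near. Qed.

End coordinates.

(** * The spaces L2 and H(curl) *)

Section dot.
Context (R : realType).
Implicit Types u v w : 'cV[R]_3.

Lemma dotC u v : dot u v = dot v u.
Proof. by apply: eq_bigr => i _; rewrite mulrC. Qed.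

Lemma dot_linear a u v w : dot (a *: u + v) w = a * dot u w + dot v w.
Proof.
rewrite /dot mulr_sumr -big_split; apply: eq_bigr => i _ /=.
by rewrite !mxE mulrDl mulrA.
Qed.

Lemma dot_ge0 u : 0 <= dot u u.
Proof. by apply: sumr_ge0 => i _; rewrite -expr2 sqr_ge0. Qed.

Lemma dot_entry u i : u i ord0 ^+ 2 <= dot u u.
Proof.
rewrite /dot (bigD1 i)//= -expr2 lerDl; apply: sumr_ge0 => j _.
by rewrite -expr2 sqr_ge0.
Qed.

Lemma dot_eq0 u : dot u u = 0 -> u = 0.
Proof.
move=> u0; apply/matrixP => i j; rewrite (ord1 j) mxE.
by apply/eqP; rewrite -sqrf_eq0 eq_le sqr_ge0 andbT -u0 dot_entry.
Qed.

Lemma dot_sip : semi_ip [set: 'cV[R]_3] (@dot R).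
Proof.
split=> [|a u v w _ _ _|u v _ _|u _]; first by split.
- exact: dot_linear.
- exact: dotC.
- exact: dot_ge0.
Qed.

Lemma dot_norm_le u v : `|dot u v| <= dot u u + dot v v.
Proof.
have h1 : 0 <= dot (u + v) (u + v) by exact: dot_ge0.
have h2 : 0 <= dot (u - v) (u - v) by exact: dot_ge0.
move: h1 h2; rewrite (sip_sqB dot_sip)// -[u in u + v]scale1r (sip_sqD dot_sip)//.
by have := dot_ge0 u; have := dot_ge0 v; rewrite ler_norml => *; apply/andP; split; lra.
Qed.

End dot.

Lemma ae_imp d (T : measurableType d) (R : realType)
    (mu : {measure set T -> \bar R}) (P Q : T -> Prop) :
  {ae mu, forall x, P x} -> (forall x, P x -> Q x) -> {ae mu, forall x, Q x}.
Proof. by move=> h PQ; apply: filterS h. Qed.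

Lemma ae_imp2 d (T : measurableType d) (R : realType)
    (mu : {measure set T -> \bar R}) (P P' Q : T -> Prop) :
  {ae mu, forall x, P x} -> {ae mu, forall x, P' x} ->
  (forall x, P x -> P' x -> Q x) -> {ae mu, forall x, Q x}.
Proof. by move=> h h' PQ; apply: filterS2 h h'. Qed.

Section L2.
Context (R : realType) (Omega : set (point3 R)).
Local Notation P3 := (point3 (measurableTypeR R)).
Hypothesis mO : measurable (Omega : set P3).
Let mu : {measure set P3 -> \bar R} := leb3 R.
Implicit Types u v w : vfield R.

Definition mfield u := forall i, measurable_fun (Omega : set P3) (comp3 u i).

Lemma measurable_dot u v : mfield u -> mfield v ->
  measurable_fun (Omega : set P3) (fun x => dot (u x) (v x)).
Proof.
by move=> mu_ mv; apply: measurable_sum => i; apply: measurable_funM; [exact: mu_|exact: mv].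
Qed.

Lemma inL2P u : inL2 Omega u <->
  mfield u /\ mu.-integrable Omega (EFin \o (fun x => dot (u x) (u x))).
Proof.
have h := @integrable_lty _ P3 R mu Omega (fun x => dot (u x) (u x)) (fun x _ => dot_ge0 _).
split=> [[mu_ ui]|[mu_ /h[_ ui]]]; split=> //.
by apply/h; split=> //; exact: measurable_dot.
Qed.

Lemma inL2_mfield u : inL2 Omega u -> mfield u. Proof. by case. Qed.

Lemma dot_integrable u v : inL2 Omega u -> inL2 Omega v ->
  mu.-integrable Omega (EFin \o (fun x => dot (u x) (v x))).
Proof.
move=> /inL2P[mu_ ui] /inL2P[mv vi].
apply: (integrable_le mO (measurable_dot mu_ mv) (integrable_add mO ui vi)) => x _.
exact: dot_norm_le.
Qed.

Lemma mfield_lin a u v : mfield u -> mfield v -> mfield (a *: u + v).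
Proof.
move=> mu_ mv i; rewrite (_ : comp3 _ _ = (fun x => a * comp3 u i x + comp3 v i x)).
  by apply: measurable_funD => //; exact: measurable_funM.
by apply/funext => x; rewrite /comp3 !mxE.
Qed.

Lemma inL2_closed : lin_closed (inL2 Omega).
Proof.
have m0 : mfield 0.
  move=> i; rewrite (_ : comp3 _ _ = cst 0); first exact: measurable_cst.
  by apply/funext => x; rewrite /comp3 mxE.
split.
  apply/inL2P; split=> //; rewrite (_ : (fun x => _) = (fun=> 0)); first exact: integrable_cst0.
  by apply/funext => x; rewrite /dot big1// => i _; rewrite mxE mul0r.
move=> a u v /inL2P[mu_ ui] /inL2P[mv vi]; apply/inL2P; split; first exact: mfield_lin.
have b : mu.-integrable Omega (EFin \o (fun x => 2 * a ^+ 2 * dot (u x) (u x) + 2 * dot (v x) (v x))).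
  by apply: integrable_add => //; apply: integrableZ.
have md := measurable_dot (mfield_lin a mu_ mv) (mfield_lin a mu_ mv).
apply: (integrable_le mO md b) => x _; rewrite ger0_norm ?dot_ge0//.
apply: (le_trans (sip_sq_quasi (dot_sip R) I I)).
have -> : dot ((a *: u) x) ((a *: u) x) = a ^+ 2 * dot (u x) (u x).
  by rewrite -[(a *: u) x]/(a *: u x) (sipZl (dot_sip R))// (sipZr (dot_sip R))//; ring.
by rewrite mulrA.
Qed.

Lemma ip_sip : semi_ip (inL2 Omega) (ip Omega).
Proof.
split.
- exact: inL2_closed.
- move=> a u v w hu hv hw; rewrite /ip -Rintegral_lin; [|exact: mO|exact: dot_integrable..].
  by apply: eq_Rintegral => x _; rewrite -dot_linear.
- by move=> u v _ _; apply: eq_Rintegral => x _; rewrite dotC.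
- by move=> u _; apply: Rintegral_ge0 => x _; exact: dot_ge0.
Qed.

Lemma eq_aeL2_ip u v w : inL2 Omega u -> inL2 Omega v -> inL2 Omega w ->
  eq_aeL2 Omega u v -> ip Omega u w = ip Omega v w.
Proof.
move=> /inL2P[mu_ _] /inL2P[mv _] /inL2P[mw _] uv.
apply: (@ae_eq_Rintegral _ P3 R mu Omega mO); try exact: measurable_dot.
by apply: (@ae_imp _ P3 R mu _ _ uv) => x h Ox; rewrite h.
Qed.

Lemma ip_eq0_ae u : inL2 Omega u -> ip Omega u u = 0 -> eq_aeL2 Omega u 0.
Proof.
move=> hu u0; have := Rintegral_eq0_ae mO (dot_integrable hu hu) (fun x _ => dot_ge0 _) u0.
by move=> h0; apply: (@ae_imp _ P3 R mu _ _ h0) => x h Ox; apply: dot_eq0; exact: h.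
Qed.

Lemma eq_aeL2_refl u : eq_aeL2 Omega u u.
Proof. exact: aeW. Qed.

Lemma eq_aeL2_sym u v : eq_aeL2 Omega u v -> eq_aeL2 Omega v u.
Proof. by move=> h0; apply: (@ae_imp _ P3 R mu _ _ h0) => x h Ox; rewrite h. Qed.

Lemma eq_aeL2_trans u v w : eq_aeL2 Omega u v -> eq_aeL2 Omega v w -> eq_aeL2 Omega u w.
Proof. by move=> h h'; apply: (@ae_imp2 _ P3 R mu _ _ _ h h') => x h1 h2 Ox; rewrite h1// h2. Qed.

Lemma eq_aeL2_lin a u v u' v' : eq_aeL2 Omega u u' -> eq_aeL2 Omega v v' ->
  eq_aeL2 Omega (a *: u + v) (a *: u' + v').
Proof.
move=> h h'; apply: (@ae_imp2 _ P3 R mu _ _ _ h h') => x h1 h2 Ox.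
by rewrite -[(_ + _) x]/(a *: u x + v x) -[(_ + _) x]/(a *: u' x + v' x) h1// h2.
Qed.

Lemma eq_aeL2B u v u' v' : eq_aeL2 Omega u u' -> eq_aeL2 Omega v v' ->
  eq_aeL2 Omega (u - v) (u' - v').
Proof.
move=> h h'; apply: (@ae_imp2 _ P3 R mu _ _ _ h h') => x h1 h2 Ox.
by rewrite -[(_ - v) x]/(u x - v x) -[(_ - _) x]/(u' x - v' x) h1// h2.
Qed.

(** Riesz-Fischer: a fast subsequence converges pointwise off a null set, and Fatou bounds the
    distance to the pointwise limit. *)
Lemma L2_complete : complete_space (L2 Omega).
Proof.
move=> u hu /= hC.
have hb := ip_sip.
pose D n p := ip Omega (u n - u p) (u n - u p).
have hB n p : inL2 Omega (u n - u p) by exact: (lin_closedB inL2_closed (hu n) (hu p)).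
have DC e : 0 < e -> exists N, forall n p, (N <= n)%N -> (N <= p)%N -> D n p < e.
  move=> e0; have se : 0 < Num.sqrt e by rewrite sqrtr_gt0.
  have [N hN] := hC _ se.
  exists N => n p Nn Np; have := hN n p Nn Np.
  by rewrite ltr_sqrt.
(* Squared distances below [8 ^- k] leave pointwise squared increments of order [4 ^- k], that is
   increments of order [2 ^- k], which are summable. *)
have e8 k : 0 < (8^-1 : R) ^+ k by apply: exprn_gt0; rewrite invr_gt0.
have [f [fk fmono hf]] := fast_subsequence e8 DC.
pose v k := u (f k).
have vB k j : inL2 Omega (v k - v j) by exact: hB.
have [N0 [mN0 N00 hN0]] : exists N : set P3, [/\ measurable N, mu N = 0%E &
    forall x, Omega x -> ~ N x -> exists M, forall k,
      dot (v k.+1 x - v k x) (v k.+1 x - v k x) <= M * 4^-1 ^+ k].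
  have [|||N [mN N0 hN]] := @ae_geometric_bound _ P3 R mu Omega mO
      (fun k x => dot ((v k.+1 - v k) x) ((v k.+1 - v k) x)).
  - by move=> k; exact: dot_integrable.
  - by move=> k x _; exact: dot_ge0.
  - by move=> k; apply: ltW; apply: (hf k) => //; exact: fmono.
  exists N; split=> // x Ox nNx; apply: contrapT => h; apply: nNx; apply: hN => /= h'.
  by apply: h; exact: h'.
(* With the value 0 on [N0], [w] is the limit at every point of [Omega] of the fields [v k] cut off
   on [N0], which makes it measurable. *)
pose w : vfield R := fun x => if `[< N0 x >] then 0 else \col_i limn (fun k => v k x i ord0).
have vw x : Omega x -> ~ N0 x -> forall i, (fun k => v k x i ord0) @ \oo --> w x i ord0.
  move=> Ox nx i; rewrite /w asboolF// mxE.
  have [M hM] := hN0 x Ox nx.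
  have M0 : 0 <= M by have := le_trans (dot_ge0 _) (hM 0%N); rewrite expr0 mulr1.
  apply: (@geometric_cvg _ _ (Num.sqrt M)) => // k.
  rewrite -(@ler_pXn2r _ 2)// ?nnegrE ?mulr_ge0 ?sqrtr_ge0 ?exprn_ge0//.
  rewrite exprMn sqr_sqrtr// real_normK ?num_real//.
  apply: le_trans (_ : _ <= M * 4^-1 ^+ k) _.
    by apply: le_trans (hM k); have := dot_entry (v k.+1 x - v k x) i; rewrite !mxE.
  by rewrite -exprM mulnC exprM; have -> : (2^-1 : R) ^+ 2 = 4^-1 by field.
have mw : mfield w.
  move=> i.
  apply: (@measurable_fun_cvg _ P3 R Omega
    (fun k => (comp3 (v k) i) \_ (~` N0))) => [k|x Ox].
    apply/(measurable_restrict _ (measurableC mN0) mO).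
    apply: measurable_funS mO _ (inL2_mfield (hu (f k)) i); exact: subIsetl.
  under eq_fun do rewrite patchE.
  have [nx|nx] := pselect (N0 x).
    have -> : (x \in ~` N0) = false by apply/negP => /set_mem.
    by rewrite /comp3 /w asboolT// mxE; exact: cvg_cst.
  have -> : (x \in ~` N0) = true by apply/mem_set.
  exact: vw.
have mdiff k : mfield (v k - w).
  rewrite -scaleN1r addrC; apply: mfield_lin => //; exact: inL2_mfield (hu _).
(* Fatou in [j] for fixed [k]: all later [v j] are within [8 ^- k] of [v k], in squared distance. *)
have key k : inL2 Omega (v k - w) /\ ip Omega (v k - w) (v k - w) <= 8^-1 ^+ k.
  have [||||||i le] := @Rintegral_fatou _ P3 R mu Omega mO
     (fun j x => dot ((v k - v j) x) ((v k - v j) x)) (fun x => dot ((v k - w) x) ((v k - w) x)) (8^-1 ^+ k) k.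
  - by move=> j; exact: dot_integrable.
  - exact: measurable_dot.
  - by move=> n x _; exact: dot_ge0.
  - by move=> x _; exact: dot_ge0.
  - exists N0; split=> // x /= /not_implyP[Ox nc]; apply: contrapT => nx; apply: nc.
    apply: cvg_big => [|i _]; first exact: add_continuous.
    have c : (fun j => (v k - v j) x i ord0) @ \oo --> (v k - w) x i ord0.
      rewrite -[(v k - w) x]/(v k x - w x) !mxE.
      rewrite (_ : (fun j => _) = (fun j => v k x i ord0 - v j x i ord0)); last first.
        by apply/funext => j; rewrite -[(v k - v j) x]/(v k x - v j x) !mxE.
      by apply: cvgB; [exact: cvg_cst|exact: vw].
    by apply: cvgM; exact: c.
  - by move=> j kj; apply: ltW; apply: (hf k) => //; exact: fmono.
  by split => //; apply/inL2P.
have Lw : inL2 Omega w.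
  have := lin_closedB inL2_closed (hu (f 0%N)) (key 0%N).1.
  by rewrite /v opprB addrCA subrr addr0.
exists w => //; apply/cvgr0Pnorm_lt => e e0.
have e2 : 0 < e / 2 by rewrite divr_gt0.
have [N hN] := hC _ e2; have [K hK] := pow_half_small ler01 e2.
exists N => // n /= Nn; rewrite ger0_norm ?sqrtr_ge0//.
pose k := maxn N K.
have -> : u n - w = (u n - v k) + (v k - w) by rewrite addrA subrK.
apply: (le_lt_trans (sip_normD hb (hB _ _) (key k).1)).
have h1 : Num.sqrt (ip Omega (u n - v k) (u n - v k)) < e / 2.
  by apply: hN => //; apply: leq_trans (fk k); rewrite leq_maxl.
have h2 : Num.sqrt (ip Omega (v k - w) (v k - w)) < e / 2.
  have h := hK k (leq_maxr _ _); rewrite mul1r in h.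
  apply: le_lt_trans h; rewrite -(@ler_pXn2r _ 2)// ?nnegrE ?sqrtr_ge0 ?exprn_ge0//.
  rewrite sqr_sqrtr; last exact: (sip_ge0 hb (key k).1).
  apply: (le_trans (key k).2); rewrite -exprM mulnC exprM.
  by apply: lerXn2r; rewrite ?nnegrE; lra.
lra.
Qed.

End L2.

(** * Weak curls and completeness of H(curl) *)

Section Hcurl.
Context (R : realType) (Omega : set (point3 R)).
Local Notation P3 := (point3 (measurableTypeR R)).
Hypothesis oO : open Omega.
Hypothesis bO : bounded_set Omega.
Let mO : measurable (Omega : set P3) := open_measurable3 oO.
Let mu : {measure set P3 -> \bar R} := leb3 R.
Implicit Types u v w c phi : vfield R.
Let L2c := inL2_closed mO.
Let ips := ip_sip mO.

Lemma bounded_cbox : exists a b, Omega `<=` cbox a b.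
Proof.
have [M [_ hM]] := bO; have {hM}hM : forall x, Omega x -> `|x| <= M + 1.
  by move=> x Ox; apply: (hM (M + 1)) => //; rewrite ltrDl.
exists (- (M + 1), - (M + 1), - (M + 1)), (M + 1, M + 1, M + 1).
move=> x Ox; have := hM x Ox; rewrite /Num.norm/= !ge_max => /andP[/andP[h1 h2] h3].
by apply/cbox_mem; rewrite /= -!ler_norml.
Qed.

Lemma continuous_bounded3 (f : point3 R -> R) : continuous f ->
  exists M, forall x, Omega x -> `|f x| <= M.
Proof.
move=> cf; have [a [b Oab]] := bounded_cbox.
have : compact (f @` cbox a b).
  by apply: continuous_compact; [exact: continuous_subspaceT|exact: compact_cbox].
move=> /compact_bounded[M [_ hM]]; exists (M + 1) => x Ox.
by apply: (hM (M + 1)); [rewrite ltrDl|exists x => //; exact: Oab].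
Qed.

Lemma measure_Omega_lty : (mu Omega < +oo)%E.
Proof.
have [a [b Oab]] := bounded_cbox.
have mc : measurable (cbox a b : set P3).
  by apply: measurableX; [apply: measurableX|]; exact: measurable_itv.
apply: (@le_lt_trans _ _ (mu (cbox a b))).
  by apply: le_measure; rewrite ?inE.
pose l : {measure set (measurableTypeR R) -> \bar R} := @lebesgue_measure R.
pose A1 : set (measurableTypeR R) := `[a.1.1, b.1.1]%classic.
pose A2 : set (measurableTypeR R) := `[a.1.2, b.1.2]%classic.
pose A3 : set (measurableTypeR R) := `[a.2, b.2]%classic.
have mA1 : measurable A1 by exact: measurable_itv.
have mA2 : measurable A2 by exact: measurable_itv.
have mA3 : measurable A3 by exact: measurable_itv.
have fin p q : exists r : R, l `[p, q]%classic = r%:E.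
  have := lebesgue_measure_itv `[p, q]; rewrite /= => ->.
  by case: ifP => _; [exists (q - p)|exists 0].
have -> : mu (cbox a b) = (l A1 * l A2 * l A3)%E.
  transitivity (((@lebesgue_measure R \x @lebesgue_measure R) (A1 `*` A2) * l A3)%E).
    by apply: product_measure1E => //; exact: measurableX.
  by congr (_ * _)%E; exact: product_measure1E.
have [r1 ->] := fin a.1.1 b.1.1; have [r2 ->] := fin a.1.2 b.1.2.
by have [r3 ->] := fin a.2 b.2; rewrite -!EFinM ltry.
Qed.

Lemma integrable_cst3 (r : R) : mu.-integrable Omega (EFin \o cst r).
Proof.
apply: measurable_bounded_integrable => //; first exact: measure_Omega_lty.
by exists `|r|; split => // M hM x _; exact: ltW.
Qed.

Lemma bounded_inL2 u : mfield Omega u ->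
  (forall i, exists M, forall x, Omega x -> `|comp3 u i x| <= M) -> inL2 Omega u.
Proof.
move=> mu_ /choice[M hM]; apply: (inL2P Omega u).2; split => //.
apply: (integrable_le mO (measurable_dot mu_ mu_) (integrable_cst3 (\sum_(i < 3) M i ^+ 2))).
move=> x Ox; rewrite ger0_norm ?dot_ge0//; apply: ler_sum => i _.
rewrite -expr2 -(real_normK (num_real _)) lerXn2r ?nnegrE//; last exact: hM.
exact: le_trans (hM i x Ox).
Qed.

Lemma smooth_cont3 (f : point3 R -> R) : smooth f -> continuous f.
Proof. by move=> sf x; apply: differentiable_continuous; exact: (sf [::] x). Qed.

Lemma continuous_inL2 u : (forall i, continuous (comp3 u i)) -> inL2 Omega u.
Proof.
move=> cu; apply: bounded_inL2 => i; last exact: continuous_bounded3.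
by apply: measurable_funTS; exact: continuous_measurable3.
Qed.

Lemma smooth_derive3 (f : point3 R -> R) (v : point3 R) : smooth f -> smooth (fun x => 'D_v f x).
Proof. by move=> sf vs x; have := sf (rcons vs v) x; rewrite foldr_rcons. Qed.

Lemma smooth_field_inL2 phi : smooth_field phi -> inL2 Omega phi.
Proof. by move=> sp; apply: continuous_inL2 => i; apply: smooth_cont3; exact: sp. Qed.

Lemma smooth_curl_inL2 phi : smooth_field phi -> inL2 Omega (curl phi).
Proof.
move=> sp; apply: continuous_inL2 => i x.
rewrite (_ : comp3 _ _ = (fun x => 'D_(basis3 R (i + 1)) (comp3 phi (i + 2%:R)) x
     - 'D_(basis3 R (i + 2%:R)) (comp3 phi (i + 1)) x)); last first.
  by apply/funext => y; rewrite /comp3 mxE.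
have c j k : continuous (fun x => 'D_(basis3 R j) (comp3 phi k) x).
  by apply: smooth_cont3; apply: smooth_derive3; exact: sp.
by apply: cvgB; exact: c.
Qed.

Lemma test_field_smooth phi : test_field Omega phi -> smooth_field phi.
Proof. by move=> tp i; case: (tp i). Qed.

Lemma test_fun0 : test_fun Omega (fun=> 0 : R).
Proof.
split; first by apply/smoothP => n; exact: smoothn_cst.
by exists set0; split=> //; exact: compact0.
Qed.

Lemma inL2_comp_integrable u i : inL2 Omega u -> mu.-integrable Omega (EFin \o comp3 u i).
Proof.
move=> hu; have [mu_ ui] := (inL2P Omega u).1 hu.
have b : mu.-integrable Omega (EFin \o (fun x => 1 + dot (u x) (u x))).
  by apply: integrable_add => //; exact: integrable_cst3.
apply: (integrable_le mO (mu_ i) b) => x _.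
have := dot_entry (u x) i; have := sqr_ge0 (`|comp3 u i x| - 1).
have := normr_ge0 (comp3 u i x).
rewrite sqrrB real_normK ?num_real// /comp3; lra.
Qed.

Lemma inL2_test_separation u : inL2 Omega u ->
  (forall phi, test_field Omega phi -> ip Omega u phi = 0) -> eq_aeL2 Omega u 0.
Proof.
move=> hu h0.
have hi i : {ae mu, forall x : P3, Omega x -> u x i ord0 = 0}.
  apply: test_fun_separation => //; first exact: inL2_comp_integrable hu.
  move=> f tf; pose phi : vfield R := fun x => \col_j (if j == i then f x else 0).
  rewrite -(h0 phi).
    apply: eq_Rintegral => x _; rewrite /dot (bigD1 i)//= big1 ?addr0 ?mxE ?eqxx//.
    by move=> j ji; rewrite mxE (negbTE ji) mulr0.
  move=> j; have [->|ji] := eqVneq j i.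
    by rewrite (_ : comp3 _ _ = f)//; apply/funext => x; rewrite /comp3 mxE eqxx.
  rewrite (_ : comp3 _ _ = fun=> 0); first exact: test_fun0.
  by apply/funext => x; rewrite /comp3 mxE (negbTE ji).
(* The quantifier over [nat] is what [ae_foralln] asks for; the three components are reached through
   [inord]. *)
have : {ae mu, forall x : P3, forall n, Omega x -> u x (inord n) ord0 = 0}.
  by apply: ae_foralln => n; exact: hi.
move=> h; apply: (@ae_imp _ P3 R mu _ _ h) => x hx Ox; apply/matrixP => i j.
by rewrite (ord1 j) mxE -(inord_val i) hx.
Qed.

Lemma is_wcurl_unique u c c' : is_wcurl Omega u c -> is_wcurl Omega u c' ->
  eq_aeL2 Omega c c'.
Proof.
move=> [hc ec] [hc' ec'].
have : eq_aeL2 Omega (c - c') 0.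
  apply: inL2_test_separation; first exact: (lin_closedB L2c).
  move=> phi tphi; have hphi := smooth_field_inL2 (test_field_smooth tphi).
  rewrite -scaleN1r addrC (sip_linear ips)// -ec'// -ec// mulN1r addNr//.
move=> h; apply: (@ae_imp _ P3 R mu _ _ h) => x hx Ox.
by apply/eqP; rewrite -subr_eq0; apply/eqP; exact: hx.
Qed.

Lemma wcurlP u : inHcurl Omega u -> is_wcurl Omega u (wcurl Omega u).
Proof. by move=> [_ hc]; rewrite /wcurl; exact: (xgetPex 0 hc). Qed.

Local Opaque ip inL2 wcurl.

Lemma wcurl_inL2 u : inHcurl Omega u -> inL2 Omega (wcurl Omega u).
Proof. by move=> /wcurlP[]. Qed.

Lemma wcurl_unique u c : inHcurl Omega u -> is_wcurl Omega u c ->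
  eq_aeL2 Omega (wcurl Omega u) c.
Proof. by move=> /wcurlP; exact: is_wcurl_unique. Qed.

Lemma is_wcurl_lin a u v c d : inL2 Omega u -> inL2 Omega v ->
  is_wcurl Omega u c -> is_wcurl Omega v d -> is_wcurl Omega (a *: u + v) (a *: c + d).
Proof.
move=> hu hv [hc ec] [hd ed]; split; first exact: (lin_closedP L2c).
move=> phi tphi; have sp := test_field_smooth tphi.
have hphi := smooth_field_inL2 sp; have hcphi := smooth_curl_inL2 sp.
by rewrite !(sip_linear ips)// ec// ed.
Qed.

Lemma inHcurl_closed : lin_closed (inHcurl Omega).
Proof.
split.
  have h0 := lin_closed0 L2c; split=> //; exists 0; split=> // phi tphi.
  have sp := test_field_smooth tphi.
  by rewrite !(sip0l ips)//; [exact: smooth_field_inL2|exact: smooth_curl_inL2].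
move=> a u v [hu [c hc]] [hv [d hd]]; split; first exact: (lin_closedP L2c).
by exists (a *: c + d); exact: is_wcurl_lin.
Qed.

(** Only almost everywhere: [wcurl] picks a representative for each field separately, so test
    functions have to identify the two sides. *)
Lemma wcurl_lin a u v : inHcurl Omega u -> inHcurl Omega v ->
  eq_aeL2 Omega (wcurl Omega (a *: u + v)) (a *: wcurl Omega u + wcurl Omega v).
Proof.
move=> hu hv; apply: wcurl_unique; first exact: (lin_closedP inHcurl_closed).
by apply: is_wcurl_lin; [exact: hu.1|exact: hv.1|exact: wcurlP|exact: wcurlP].
Qed.

Lemma ip_wcurl_lin a u v w : inHcurl Omega u -> inHcurl Omega v -> inL2 Omega w ->
  ip Omega (wcurl Omega (a *: u + v)) w =
  a * ip Omega (wcurl Omega u) w + ip Omega (wcurl Omega v) w.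
Proof.
move=> hu hv hw; have cu := wcurl_inL2 hu; have cv := wcurl_inL2 hv.
rewrite -(sip_linear ips a cu cv hw).
exact: (eq_aeL2_ip mO (wcurl_inL2 (lin_closedP inHcurl_closed a hu hv))
  (lin_closedP L2c a cu cv) hw (wcurl_lin a hu hv)).
Qed.

Definition ip_curl u v : R := ip Omega u v + ip Omega (wcurl Omega u) (wcurl Omega v).

Lemma ip_curl_sip : semi_ip (inHcurl Omega) ip_curl.
Proof.
split.
- exact: inHcurl_closed.
- move=> a u v w hu hv hw.
  rewrite /ip_curl (ip_wcurl_lin a hu hv (wcurl_inL2 hw)).
  by rewrite (sip_linear ips a hu.1 hv.1 hw.1) mulrDr addrACA.
- move=> u v hu hv; rewrite /ip_curl (sip_sym ips hu.1 hv.1).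
  by rewrite (sip_sym ips (wcurl_inL2 hu) (wcurl_inL2 hv)).
- by move=> u hu; apply: addr_ge0; apply: (sip_ge0 ips); [exact: hu.1|exact: wcurl_inL2].
Qed.

Lemma ip_wcurl_sqB u v : inHcurl Omega u -> inHcurl Omega v ->
  ip Omega (wcurl Omega (u - v)) (wcurl Omega (u - v)) =
  ip Omega (wcurl Omega u - wcurl Omega v) (wcurl Omega u - wcurl Omega v).
Proof.
move=> hu hv; have cu := wcurl_inL2 hu; have cv := wcurl_inL2 hv.
have h : eq_aeL2 Omega (wcurl Omega (u - v)) (wcurl Omega u - wcurl Omega v).
  by have := wcurl_lin (-1) hv hu; rewrite !scaleN1r ![- _ + _]addrC.
have huv := lin_closedB inHcurl_closed hu hv.
have cuv := wcurl_inL2 huv; have cB := lin_closedB L2c cu cv.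
rewrite (eq_aeL2_ip mO cuv cB cuv h) (sip_sym ips cB cuv).
by rewrite (eq_aeL2_ip mO cuv cB cB h).
Qed.

Lemma cvg_ipl (u : nat -> vfield R) l w : (forall n, inL2 Omega (u n)) ->
  inL2 Omega l -> inL2 Omega w ->
  (fun n => Num.sqrt (ip Omega (u n - l) (u n - l))) @ \oo --> (0 : R) ->
  (fun n => ip Omega (u n) w) @ \oo --> ip Omega l w.
Proof.
move=> hu hl hw ul.
have lim : (fun n => Num.sqrt (ip Omega (u n - l) (u n - l)) * Num.sqrt (ip Omega w w)) @ \oo
    --> (0 : R) * Num.sqrt (ip Omega w w) by apply: cvgM => //; exact: cvg_cst.
rewrite mul0r in lim; apply/cvgrPdist_lt => e e0.
move: lim => /cvgr0Pnorm_lt/(_ e e0); apply: filterS => n.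
have hB : inL2 Omega (u n - l) by exact: (lin_closedB L2c).
rewrite distrC => h; apply: le_lt_trans h; apply: le_trans (ler_norm _).
have -> : ip Omega (u n) w - ip Omega l w = ip Omega (u n - l) w.
  by rewrite -{1}(subrK l (u n)) (sipDl ips)// addrK.
exact: (sip_cauchy_schwarz ips).
Qed.

(** The curl is a closed operator: both sides of its defining identity pass to the limit when the
    fields and their curls converge in L2. *)
Lemma Hcurl_complete : complete_space (Hcurl Omega).
Proof.
move=> u hu /= hC.
have hB n p : inHcurl Omega (u n - u p) by exact: (lin_closedB inHcurl_closed (hu n) (hu p)).
have [w hw uw] : exists2 w, inL2 Omega w &
    (fun n => Num.sqrt (ip Omega (u n - w) (u n - w))) @ \oo --> (0 : R).
  apply: (L2_complete mO) => [n|e e0]; first exact: (hu n).1.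
  have [N hN] := hC e e0; exists N => n p Nn Np /=; apply: le_lt_trans (hN n p Nn Np).
  rewrite ler_sqrt ?addr_ge0 ?(sip_ge0 ips)//; [|exact: (hB n p).1|exact: wcurl_inL2].
  by rewrite lerDl (sip_ge0 ips)//; exact: wcurl_inL2.
have cn n : inL2 Omega (wcurl Omega (u n)) by exact: wcurl_inL2 (hu n).
have [c hc uc] : exists2 c, inL2 Omega c &
    (fun n => Num.sqrt (ip Omega (wcurl Omega (u n) - c) (wcurl Omega (u n) - c))) @ \oo --> (0 : R).
  apply: (L2_complete mO (u := fun n => wcurl Omega (u n))) => [n|e e0]; first exact: cn.
  have [N hN] := hC e e0; exists N => n p Nn Np /=; apply: le_lt_trans (hN n p Nn Np).
  rewrite ler_sqrt ?addr_ge0 ?(sip_ge0 ips)//; [|exact: (hB n p).1|exact: wcurl_inL2].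
  by rewrite (ip_wcurl_sqB (hu n) (hu p)) lerDr (sip_ge0 ips)//; exact: (hB n p).1.
have wc : is_wcurl Omega w c.
  split=> // phi tphi; have sp := test_field_smooth tphi.
  have l1 := cvg_ipl (fun n => (hu n).1) hw (smooth_curl_inL2 sp) uw.
  have l2 := cvg_ipl cn hc (smooth_field_inL2 sp) uc.
  apply: (cvg_unique (@norm_hausdorff _ R) l1).
  rewrite (_ : (fun n => _) = (fun n => ip Omega (wcurl Omega (u n)) phi))//.
  by apply/funext => n; have [_] := wcurlP (hu n); exact.
have hwc : inHcurl Omega w by split=> //; exists c.
exists w => //; rewrite /Hcurl_norm.
have lim : (fun n => Num.sqrt (ip Omega (u n - w) (u n - w)) +
    Num.sqrt (ip Omega (wcurl Omega (u n) - c) (wcurl Omega (u n) - c))) @ \oo --> (0 + 0 : R).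
  exact: (cvgD uw uc).
rewrite addr0 in lim; apply: (squeeze_cvgr _ (cvg_cst 0) lim).
near=> n; rewrite sqrtr_ge0/=.
have eqc : ip Omega (wcurl Omega (u n - w)) (wcurl Omega (u n - w)) =
    ip Omega (wcurl Omega (u n) - c) (wcurl Omega (u n) - c).
  rewrite (ip_wcurl_sqB (hu n) hwc).
  have h : eq_aeL2 Omega (wcurl Omega (u n) - wcurl Omega w) (wcurl Omega (u n) - c).
    exact: (eq_aeL2B (eq_aeL2_refl _ _) (wcurl_unique hwc wc)).
  have B1 := lin_closedB L2c (cn n) (wcurl_inL2 hwc).
  have B2 := lin_closedB L2c (cn n) hc.
  by rewrite (eq_aeL2_ip mO B1 B2 B1 h) (sip_sym ips B2 B1) (eq_aeL2_ip mO B1 B2 B2 h).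
rewrite eqc -(@ler_pXn2r _ 2)// ?nnegrE ?sqrtr_ge0 ?addr_ge0 ?sqrtr_ge0//.
have p1 := sip_ge0 ips (lin_closedB L2c (hu n).1 hw).
have p2 := sip_ge0 ips (lin_closedB L2c (cn n) hc).
rewrite sqr_sqrtr ?addr_ge0// sqrrD !sqr_sqrtr// -addrA lerD2l lerDr.
by rewrite mulrn_wge0// mulr_ge0// sqrtr_ge0.
Unshelve. all: by end_near. Qed.

Lemma inH0curl_closed : lin_closed (inH0curl Omega).
Proof.
split.
  split; first exact: (lin_closed0 inHcurl_closed).
  move=> phi sp; rewrite /tangential_trace (sip0l ips); last exact: smooth_curl_inL2.
  have h0 := lin_closed0 inHcurl_closed; have hp := smooth_field_inL2 sp.
  have := ip_wcurl_lin 1 h0 h0 hp; rewrite scaler0 addr0 mul1r sub0r => h.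
  by apply/eqP; rewrite oppr_eq0; apply/eqP; apply: (addrI (ip Omega (wcurl Omega 0) phi)); rewrite -h addr0.
move=> a u v [hu tu] [hv tv]; split; first exact: (lin_closedP inHcurl_closed).
move=> phi sp; have := tu phi sp; have := tv phi sp; rewrite /tangential_trace.
have hcp := smooth_curl_inL2 sp; have hp := smooth_field_inL2 sp.
rewrite (sip_linear ips a hu.1 hv.1 hcp).
by rewrite (ip_wcurl_lin a hu hv hp) => h1 h2; rewrite opprD addrACA h1 addr0 -mulrBr h2 mulr0.
Qed.

End Hcurl.

(** * Tensor fields *)

Section integrable_ae.
Context d (T : measurableType d) (R : realType) (mu : {measure set T -> \bar R}).
Context (D : set T) (mD : measurable D).
Implicit Types f g : T -> R.

(** Replacing [g] by the maximum of [f] and [g], which agrees with [g] almost everywhere, turns the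
    inequality into one that holds everywhere. *)
Lemma le_Rintegral_ae f g : mu.-integrable D (EFin \o f) -> mu.-integrable D (EFin \o g) ->
  {ae mu, forall x, D x -> f x <= g x} ->
  \int[mu]_(x in D) f x <= \int[mu]_(x in D) g x.
Proof.
move=> fi gi fg.
have mf := integrable_measurable fi; have mg := integrable_measurable gi.
have mh : measurable_fun D (fun x => Num.max (f x) (g x)) by exact: measurable_maxr.
have eh : {ae mu, forall x, D x -> g x = Num.max (f x) (g x)}.
  by apply: (ae_imp fg) => x h Dx; rewrite max_r// h.
rewrite (ae_eq_Rintegral mD mg mh eh); apply: le_Rintegral => //.
- exact: (ae_eq_integrable mD mh eh gi).
- by move=> x _; rewrite le_max lexx.
Qed.

Lemma integrable_le_ae f g : measurable_fun D f -> mu.-integrable D (EFin \o g) ->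
  {ae mu, forall x, D x -> `|f x| <= g x} -> mu.-integrable D (EFin \o f).
Proof.
move=> mf gi fg; have mg := integrable_measurable gi.
have mh : measurable_fun D (fun x => Num.max `|f x| (g x)).
  by apply: measurable_maxr => //; exact: measurableT_comp.
have eh : {ae mu, forall x, D x -> g x = Num.max `|f x| (g x)}.
  by apply: (ae_imp fg) => x h Dx; rewrite max_r// h.
apply: (integrable_le mD mf (ae_eq_integrable mD mh eh gi)) => x _.
by rewrite le_max lexx.
Qed.

End integrable_ae.

Section tensor_pointwise.
Context (R : realType).
Implicit Types (A : 'M[R]_3) (u v : 'cV[R]_3).

Lemma dot_tr A u v : dot (A *m u) v = dot u (A^T *m v).
Proof.
rewrite /dot; under eq_bigr do rewrite mxE mulr_suml.
rewrite exchange_big/=; apply: eq_bigr => j _; rewrite mxE mulr_sumr.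
by apply: eq_bigr => i _; rewrite !mxE; ring.
Qed.

(** 27 is a crude [3 * 3 ^+ 2]: three components, each at most [3 * M] times the length of [u]. *)
Lemma dot_mulmx_le A u (M : R) : (forall i j, `|A i j| <= M) ->
  dot (A *m u) (A *m u) <= 27 * M ^+ 2 * dot u u.
Proof.
move=> hM; have M0 : 0 <= M by apply: le_trans (hM ord0 ord0).
have s i : `|u i ord0| <= Num.sqrt (dot u u).
  by rewrite -sqrtr_sqr ler_sqrt ?dot_ge0// dot_entry.
have h i : (A *m u) i ord0 * (A *m u) i ord0 <= 9 * M ^+ 2 * dot u u.
  rewrite -expr2 -(real_normK (num_real _)).
  have -> : 9 * M ^+ 2 * dot u u = (3 * (M * Num.sqrt (dot u u))) ^+ 2.
    by rewrite !exprMn sqr_sqrtr ?dot_ge0//; ring.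
  rewrite lerXn2r ?nnegrE ?mulr_ge0 ?sqrtr_ge0//.
  rewrite mxE; apply: (le_trans (ler_norm_sum _ _ _)).
  apply: (@le_trans _ _ (\sum_(j < 3) M * Num.sqrt (dot u u))).
    by apply: ler_sum => j _; rewrite normrM ler_pM.
  by rewrite sumr_const card_ord mulr_natl.
apply: (@le_trans _ _ (\sum_(i < 3) 9 * M ^+ 2 * dot u u)).
  by apply: ler_sum => i _.
rewrite sumr_const card_ord -mulr_natl; lra.
Qed.

Lemma coercive_unit A a : 0 < a -> (forall xi, a * dot xi xi <= dot xi (A *m xi)) ->
  A \in unitmx.
Proof.
move=> a0 hA; rewrite -unitmx_tr -row_free_unit -kermx_eq0.
apply/negPn/negP => /rowV0Pn[v /sub_kermxP vA vn0].
have := hA v^T; have -> : A *m v^T = 0.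
  by apply: trmx_inj; rewrite trmx_mul trmxK vA trmx0.
rewrite dotC [dot 0 _](sip0l (dot_sip R))// pmulr_rle0// => h.
have : dot v^T v^T = 0 by apply/eqP; rewrite eq_le h dot_ge0.
by move/dot_eq0/eqP; rewrite trmx_eq0 (negbTE vn0).
Qed.

Lemma invmx_bound A a u : 0 < a -> (forall xi, a * dot xi xi <= dot xi (A *m xi)) ->
  dot (invmx A *m u) (invmx A *m u) <= a^-1 ^+ 2 * dot u u.
Proof.
move=> a0 hA; have uA := coercive_unit a0 hA; set xi := invmx A *m u.
have e : A *m xi = u by rewrite /xi mulKVmx.
have := hA xi; rewrite e => h1.
(* Young's inequality: [2 xi.u <= a |xi|^2 + |u|^2 / a] *)
have := dot_ge0 (a *: xi + - u).
rewrite (sip_sqB (dot_sip R))// (sipZl (dot_sip R))// (sipZr (dot_sip R))// (sipZl (dot_sip R))//.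
move: h1; move: (dot xi xi) (dot xi u) (dot u u) => x y z h1 h2.
have h3 : 2 * a * y <= a ^+ 2 * x + z by nra.
rewrite exprVn -ler_pdivrMl ?invr_gt0 ?exprn_gt0// invrK.
by nra.
Qed.

(** For [xi] the inverse image of [u], coercivity bounds [dot u xi] below by [a] times the square of
    [xi], and the entry bound on [A] compares the squares of [xi] and [u]. *)
Lemma invmx_coercive A a M : 0 < a -> 0 < M -> (forall i j, `|A i j| <= M) ->
  (forall xi, a * dot xi xi <= dot xi (A *m xi)) ->
  forall u, a / (27 * M ^+ 2) * dot u u <= dot u (invmx A *m u).
Proof.
move=> a0 M0 hM hA u; have uA := coercive_unit a0 hA; set xi := invmx A *m u.
have e : A *m xi = u by rewrite /xi mulKVmx.
have := hA xi; have := dot_mulmx_le xi hM; rewrite e dotC => h1 h2.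
rewrite mulrAC ler_pdivrMr; last by rewrite mulr_gt0// exprn_gt0.
apply: (@le_trans _ _ (a * (27 * M ^+ 2 * dot xi xi))); first by rewrite ler_wpM2l// ltW.
have -> : a * (27 * M ^+ 2 * dot xi xi) = (27 * M ^+ 2) * (a * dot xi xi) by ring.
by rewrite [leRHS]mulrC ler_pM2l// mulr_gt0// exprn_gt0.
Qed.

End tensor_pointwise.

Section measurable_inverse.
Context d (T : measurableType d) (R : realType) (D : set T).

Lemma measurable_funV (f : T -> R) : measurable_fun D f ->
  measurable_fun D (fun x => (f x)^-1).
Proof.
(* [powR] agrees with the inverse on nonnegative numbers, hence the square; at 0 both sides
   vanish. *)
move=> mf; rewrite (_ : (fun x => _) = (fun x => f x * (f x * f x) `^ (-1))).
  apply: measurable_funM => //; apply: (measurableT_comp (@measurable_powR R (-1))).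
  exact: measurable_funM.
apply/funext => x; rewrite powR_inv1 -?expr2 ?sqr_ge0//.
by have [->|n0] := eqVneq (f x) 0; [rewrite invr0 mul0r|field].
Qed.

Lemma measurable_det n (A : T -> 'M[R]_n) :
  (forall i j, measurable_fun D (fun x => A x i j)) ->
  measurable_fun D (fun x => \det (A x)).
Proof.
move=> mA; apply: measurable_sum => s; apply: measurable_funM; first exact: measurable_cst.
by apply: measurable_prod => i _; exact: mA.
Qed.

Lemma measurable_invmx n (A : T -> 'M[R]_n) :
  (forall i j, measurable_fun D (fun x => A x i j)) ->
  forall i j, measurable_fun D (fun x => invmx (A x) i j).
Proof.
case: n A => [|n] A mA i j; first by case: i.
have mdet := measurable_det mA.
(* Cramer's formula where the determinant is nonzero; on singular matrices [invmx] returns its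
   argument, which is the second term. *)
rewrite (_ : (fun x => _) = (fun x => (\det (A x))^-1 * cofactor (A x) j i +
    (\det (A x) == 0)%:R * A x i j)).
  apply: measurable_funD; apply: measurable_funM => //.
  - exact: measurable_funV.
  - apply: measurable_funM; first exact: measurable_cst.
    by apply: measurable_det => k l; under eq_fun do rewrite !mxE; exact: mA.
  - apply: (measurableT_comp (f := fun b : bool => b%:R : R)); first by [].
    by apply: measurable_fun_eqr => //; exact: measurable_cst.
apply/funext => x; rewrite /invmx unitmxE unitfE.
by have [->|_] := eqVneq; rewrite ?invr0 ?mul0r ?add0r ?mul1r// !mxE addr0.
Qed.

End measurable_inverse.

Section tensors.
Context (R : realType) (Omega : set (point3 R)).
Local Notation P3 := (point3 (measurableTypeR R)).
Hypothesis mO : measurable (Omega : set P3).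
Let mu : {measure set P3 -> \bar R} := leb3 R.
Implicit Types (A : tensor3 R) (u v : vfield R).

Lemma Linfty_bound A : Linfty Omega A ->
  (forall i j, measurable_fun (Omega : set P3) (fun x => A x i j)) /\
  exists M, 0 < M /\ {ae mu, forall x : P3, Omega x -> forall i j, `|A x i j| <= M}.
Proof.
move=> hA; split; first by move=> i j; exact: (hA i j).1.
have /choice[M hM] : forall ij : 'I_3 * 'I_3, exists M, {ae mu, forall x : P3, Omega x -> `|A x ij.1 ij.2| <= M}.
  by move=> ij; exact: (hA ij.1 ij.2).2.
(* The leading 1 makes the bound strictly positive, as needed when the inverse tensor is shown
   coercive. *)
exists (1 + \sum_ij `|M ij|); split.
  by rewrite ltr_pwDl// sumr_ge0.
have h : {ae mu, forall x : P3, forall n : nat, Omega x -> forall ij, unpickle n = Some ij -> `|A x ij.1 ij.2| <= M ij}.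
  apply: ae_foralln => n; case E : (unpickle n) => [ij|]; last exact: aeW.
  by apply: (ae_imp (hM ij)) => x hx Ox ij' [<-]; exact: hx.
apply: (ae_imp h) => x hx Ox i j.
apply: le_trans (hx (pickle (i, j)) Ox (i, j) (pickleK _)) _.
apply: (le_trans (ler_norm _)); rewrite (bigD1 (i, j))//= addrCA lerDl.
by rewrite addr_ge0// sumr_ge0.
Qed.

Lemma app_mfield A u : (forall i j, measurable_fun (Omega : set P3) (fun x => A x i j)) ->
  mfield Omega u -> mfield Omega (app A u).
Proof.
move=> mA mu_ i; rewrite (_ : comp3 _ _ = (fun x => \sum_j A x i j * u x j ord0)).
  by apply: measurable_sum => j; apply: measurable_funM; [exact: mA|exact: mu_].
by apply/funext => x; rewrite /comp3 /app mxE.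
Qed.

Lemma app_inL2 A : Linfty Omega A -> exists C, 0 <= C /\ forall u, inL2 Omega u ->
  inL2 Omega (app A u) /\ ip Omega (app A u) (app A u) <= C * ip Omega u u.
Proof.
move=> /Linfty_bound[mA [M [M0 hM]]]; exists (27 * M ^+ 2).
split; first by rewrite mulr_ge0// sqr_ge0.
move=> u hu; have [mu_ ui] := (inL2P Omega u).1 hu.
have mAu := app_mfield mA mu_.
have b : {ae mu, forall x : P3, Omega x -> dot (app A u x) (app A u x) <= 27 * M ^+ 2 * dot (u x) (u x)}.
  by apply: (ae_imp hM) => x hx Ox; apply: dot_mulmx_le; exact: hx.
have i1 : mu.-integrable Omega (EFin \o (fun x => 27 * M ^+ 2 * dot (u x) (u x))).
  exact: integrableZ.
have i2 : mu.-integrable Omega (EFin \o (fun x => dot (app A u x) (app A u x))).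
  apply: (integrable_le_ae mO (measurable_dot mAu mAu) i1).
  by apply: (ae_imp b) => x hx Ox; rewrite ger0_norm ?dot_ge0// hx.
split; first by apply: (inL2P Omega (app A u)).2.
have := le_Rintegral_ae mO i2 i1 b; rewrite RintegralZl//.
Qed.

Lemma ip_tr A u v : ip Omega (app A u) v = ip Omega u (app (fun x => (A x)^T) v).
Proof. by apply: eq_Rintegral => x _; exact: dot_tr. Qed.

Lemma Linfty_tr A : Linfty Omega A -> Linfty Omega (fun x => (A x)^T).
Proof.
move=> hA i j; have [m [M hM]] := hA j i; split.
  by under eq_fun do rewrite mxE.
by exists M; apply: (@ae_imp _ P3 R mu _ _ hM) => x hx Ox; rewrite mxE hx.
Qed.

Lemma app_lin A a u v : app A (a *: u + v) = a *: app A u + app A v.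
Proof.
by apply/funext => x; rewrite /app -[(a *: u + v) x]/(a *: u x + v x) mulmxDr -scalemxAr.
Qed.

Lemma Linfty_tinv A a : 0 < a -> Linfty Omega A -> coercive_ae Omega a A ->
  Linfty Omega (tinv A).
Proof.
move=> a0 hA cA i j; split.
  by apply: measurable_invmx => k l; exact: (hA k l).1.
exists a^-1; apply: (@ae_imp _ P3 R mu _ _ cA) => x hx Ox.
(* An entry of the inverse is a component of the image of a basis vector, which has length 1. *)
have := invmx_bound (delta_mx j ord0) a0 (hx Ox).
have -> : dot (delta_mx j ord0) (delta_mx j ord0) = 1 :> R.
  rewrite /dot (bigD1 j)//= big1 ?addr0 ?mxE ?eqxx ?mulr1// => k kj.
  by rewrite !mxE (negbTE kj) mul0r.
have := dot_entry (invmx (A x) *m delta_mx j ord0) i.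
have -> : (invmx (A x) *m (delta_mx j ord0 : 'cV[R]_3)) i ord0 = tinv A x i j.
  have /matrixP/(_ i ord0) := colE j (invmx (A x)).
  by rewrite [LHS]mxE => e; exact/esym.
rewrite mulr1 => h1 h2; have := le_trans h1 h2.
have ai : 0 <= a^-1 by rewrite invr_ge0 ltW.
by rewrite -(real_normK (num_real (tinv A x i j))) ler_pXn2r// ?nnegrE.
Qed.

Lemma coercive_tinv A a : 0 < a -> Linfty Omega A -> coercive_ae Omega a A ->
  exists2 b, 0 < b & coercive_ae Omega b (tinv A).
Proof.
move=> a0 /Linfty_bound[mA [M [M0 hM]]] cA.
exists (a / (27 * M ^+ 2)); first by rewrite divr_gt0// mulr_gt0// exprn_gt0.
apply: (@ae_imp2 _ P3 R mu _ _ _ hM cA) => x h1 h2 Ox.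
by apply: invmx_coercive => //; [exact: h1|exact: h2].
Qed.

Lemma coercive_ip A a u : 0 < a -> Linfty Omega A -> coercive_ae Omega a A ->
  inL2 Omega u -> a * ip Omega u u <= ip Omega (app A u) u.
Proof.
move=> a0 hA cA hu; have [C [_ /(_ u hu)[hAu _]]] := app_inL2 hA.
have i1 := dot_integrable mO hu hu; have i2 := dot_integrable mO hAu hu.
rewrite /ip -RintegralZl//; apply: le_Rintegral_ae => //; first exact: integrableZ.
by apply: (@ae_imp _ P3 R mu _ _ cA) => x hx Ox; rewrite [leRHS]dotC; exact: hx.
Qed.

End tensors.

(** * Bochner spaces *)

(** A common interface for the L2 and curl spaces and for their duals, whose norm is a supremum and
    not defined from a semi-inner product. *)
Record seminormed (R : realType) (V : lmodType R) (X : Defs.space V) : Prop := Seminormed {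
  sn_closed : lin_closed (carrier X) ;
  sn_ge0 : forall u, carrier X u -> 0 <= snorm X u ;
  snD : forall u v, carrier X u -> carrier X v ->
    snorm X (u + v) <= snorm X u + snorm X v ;
  snZ : forall a u, carrier X u -> snorm X (a *: u) = `|a| * snorm X u }.

Lemma semi_ip_seminormed (R : realType) (V : lmodType R) (C : set V) b :
  semi_ip C b -> seminormed (Defs.Space C (fun u => Num.sqrt (b u u))).
Proof.
move=> hb; split=> /=.
- exact: sip_closed hb.
- by move=> u _; exact: sqrtr_ge0.
- by move=> u v hu hv; exact: (sip_normD hb).
- by move=> a u hu; exact: (sip_normZ hb).
Qed.

Section seminormed.
Context (R : realType) (V : lmodType R) (X : Defs.space V).
Hypothesis hX : seminormed X.
Let hC := sn_closed hX.

Lemma sn0 : snorm X 0 = 0.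
Proof. by rewrite -(scale0r 0) (snZ hX)// ?normr0 ?mul0r//; exact: (lin_closed0 hC). Qed.

Lemma snN u : carrier X u -> snorm X (- u) = snorm X u.
Proof. by move=> hu; rewrite -scaleN1r (snZ hX)// normrN1 mul1r. Qed.

Lemma snB u v : carrier X u -> carrier X v -> snorm X (u - v) = snorm X (v - u).
Proof. by move=> hu hv; rewrite -opprB snN//; exact: (lin_closedB hC). Qed.

Lemma sn_trans w u v : carrier X u -> carrier X v -> carrier X w ->
  snorm X (u - v) <= snorm X (u - w) + snorm X (w - v).
Proof.
move=> hu hv hw; rewrite (_ : u - v = (u - w) + (w - v)); last by rewrite addrA subrK.
by apply: (snD hX); exact: (lin_closedB hC).
Qed.

Lemma sn_dist u v : carrier X u -> carrier X v ->
  `|snorm X u - snorm X v| <= snorm X (u - v).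
Proof.
move=> hu hv; have h0 := lin_closed0 hC.
have h1 := sn_trans hu h0 hv; have h2 := sn_trans hv h0 hu; rewrite !subr0 in h1 h2.
by rewrite (snB hv hu) in h2; rewrite ler_norml; apply/andP; split; lra.
Qed.

Lemma sn_sq_quasi u v : carrier X u -> carrier X v ->
  snorm X (u + v) ^+ 2 <= 2 * snorm X u ^+ 2 + 2 * snorm X v ^+ 2.
Proof.
move=> hu hv; have h1 := sn_ge0 hX hu; have h2 := sn_ge0 hX hv.
have h3 := sn_ge0 hX (lin_closedD hC hu hv); have h := snD hX hu hv.
move: h1 h2 h3 h; move: (snorm X u) (snorm X v) (snorm X (u + v)) => x y z x0 y0 z0 zxy.
apply: (@le_trans _ _ ((x + y) ^+ 2)); first by rewrite lerXn2r ?nnegrE ?addr_ge0//.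
by have := sqr_ge0 (x - y); rewrite sqrrB sqrrD; lra.
Qed.

End seminormed.

(** * The dual seminorm *)

Section dual.
Context (R : realType) (V : lmodType R) (X : Defs.space V).
Hypothesis hX : seminormed X.
Let hC := sn_closed hX.
Let values (G : V -> R^o) := [set `|G u| | u in [set u | carrier X u /\ snorm X u <= 1]].

Let values_sup G : carrier (dual X) G -> has_sup (values G).
Proof.
move=> [_ [C hG]]; split.
  by exists `|G 0|, 0 => //; split; [exact: (lin_closed0 hC)|rewrite (sn0 hX)].
exists (Num.max C 0) => _ [u [hu u1] <-]; apply: (le_trans (hG u hu)).
have u0 := sn_ge0 hX hu.
apply: (@le_trans _ _ (Num.max C 0 * snorm X u)); first by rewrite ler_wpM2r// le_max lexx.
by rewrite ler_piMr// le_max lexx orbT.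
Qed.

Lemma dual_norm_le G u : carrier (dual X) G -> carrier X u ->
  `|G u| <= snorm (dual X) G * snorm X u.
Proof.
move=> hG hu; have hs := values_sup hG; have [Glin [C hGC]] := hG.
have u0 := sn_ge0 hX hu.
have GZ a : G (a *: u) = a * G u.
  have h0 := lin_closed0 hC; have := Glin a u 0 hu h0.
  have := Glin 1 0 0 h0 h0; rewrite scaler0 !addr0 mul1r.
  by move=> /esym/eqP; rewrite addrC -subr_eq0 addrK => /eqP ->; rewrite addr0.
(* A vector of seminorm 0 cannot be normalized, but boundedness of [G] forces [G u = 0] there. *)
have [un0|] := ltP 0 (snorm X u); last first.
  move=> u0'; have e : snorm X u = 0 by apply/eqP; rewrite eq_le u0 u0'.
  by have := hGC u hu; rewrite e !mulr0.
rewrite -ler_pdivrMr//.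
apply: (sup_upper_bound hs); exists ((snorm X u)^-1 *: u).
  split; first exact: (lin_closedZ hC).
  by rewrite (snZ hX)// gtr0_norm ?invr_gt0// mulVf// gt_eqF.
by rewrite GZ normrM gtr0_norm ?invr_gt0// mulrC.
Qed.

Lemma dual_norm_ub G c : carrier (dual X) G ->
  (forall u, carrier X u -> snorm X u <= 1 -> `|G u| <= c) -> snorm (dual X) G <= c.
Proof.
move=> hG hc; apply: sup_le_ub; first exact: (values_sup hG).1.
by move=> _ [u [hu u1] <-]; exact: hc.
Qed.

Lemma dual_norm_ge0 G : carrier (dual X) G -> 0 <= snorm (dual X) G.
Proof.
move=> hG; apply: le_trans (_ : 0 <= `|G 0|) _ => //.
apply: (sup_upper_bound (values_sup hG)); exists 0 => //.
by split; [exact: (lin_closed0 hC)|rewrite (sn0 hX)].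
Qed.

Lemma dual_closed : lin_closed (carrier (dual X)).
Proof.
split; first by split=> [a u v _ _|]; rewrite ?mulr0 ?addr0//; exists 0 => u _; rewrite normr0 mul0r.
move=> a G H [Gl [C hC']] [Hl [D hD]]; split.
  move=> b u v hu hv; rewrite -![(_ + _) _]/(a * G _ + H _) Gl// Hl//; ring.
exists (`|a| * C + D) => u hu; rewrite -[(_ + _) _]/(a * G u + H u).
apply: (le_trans (ler_normD _ _)); rewrite normrM mulrDl -mulrA.
by rewrite lerD ?ler_wpM2l ?hC' ?hD.
Qed.

Lemma dual_seminormed : seminormed (dual X).
Proof.
have Zle a G : carrier (dual X) G -> snorm (dual X) (a *: G) <= `|a| * snorm (dual X) G.
  move=> hG; apply: dual_norm_ub; first exact: (lin_closedZ dual_closed).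
  move=> u hu u1; rewrite -[(_ *: G) u]/(a * G u) normrM ler_wpM2l//.
  by apply: (le_trans (dual_norm_le hG hu)); rewrite ler_piMr// dual_norm_ge0.
split.
- exact: dual_closed.
- exact: dual_norm_ge0.
- move=> G H hG hH; apply: dual_norm_ub; first exact: (lin_closedD dual_closed).
  move=> u hu u1; rewrite -[(_ + _) u]/(G u + H u); apply: (le_trans (ler_normD _ _)).
  apply: lerD; apply: (le_trans (dual_norm_le _ hu)) => //; rewrite ler_piMr// dual_norm_ge0//.
- move=> a G hG; apply/eqP; rewrite eq_le Zle//=.
  have [->|a0] := eqVneq a 0.
    by rewrite normr0 mul0r dual_norm_ge0//; exact: (lin_closedZ dual_closed).
  (* The reverse inequality is the first one applied to the inverse scalar. *)
  have := Zle a^-1 (a *: G) (lin_closedZ dual_closed a hG).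
  rewrite scalerA mulVf// scale1r normfV => h.
  by rewrite -ler_pdivlMl ?normr_gt0.
Qed.

End dual.

(** * Simple functions *)

Section finite_valued.
Context (R : realType).

(** Simple functions as measurable functions through a finite type: no linear structure is involved,
    so they can be paired and composed with arbitrary maps. *)
Definition finite_valued (E : Type) (s : R -> E) :=
  exists (I : finType) (k : R -> I) (f : I -> E),
    (forall i, measurable (k @^-1` [set i])) /\ forall t, s t = f (k t).

Lemma finite_valued_map E F (g : E -> F) (s : R -> E) :
  finite_valued s -> finite_valued (fun t => g (s t)).
Proof. by move=> [I [k [f [mk sE]]]]; exists I, k, (fun i => g (f i)); split=> // t; rewrite sE. Qed.

Lemma finite_valued_pair E F (s : R -> E) (r : R -> F) :
  finite_valued s -> finite_valued r -> finite_valued (fun t => (s t, r t)).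
Proof.
move=> [I [k [f [mk sE]]]] [J [l [g [ml rE]]]].
exists (I * J)%type, (fun t => (k t, l t)), (fun ij => (f ij.1, g ij.2)); split.
  move=> [i j]; rewrite (_ : _ @^-1` _ = (k @^-1` [set i]) `&` (l @^-1` [set j])).
    exact: measurableI.
  by apply/seteqP; split=> t /= [-> ->].
by move=> t; rewrite sE rE.
Qed.

Lemma finite_valued_cst E (c : E) : finite_valued (fun=> c).
Proof.
exists unit, (fun=> tt), (fun=> c); split=> // -[].
by rewrite (_ : _ @^-1` _ = setT)//; apply/seteqP; split.
Qed.

Lemma finite_valued_bools n (A : 'I_n -> set R) : (forall i, measurable (A i)) ->
  finite_valued (fun t => [ffun i => t \in A i]).
Proof.
move=> mA; exists {ffun 'I_n -> bool}, (fun t => [ffun i => t \in A i]), id; split=> // c.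
rewrite (_ : _ @^-1` _ = \bigcap_(i in [set: 'I_n]) (if c i then A i else ~` A i)).
  apply: fin_bigcap_measurable => // i _; case: ifP => _ //; exact: measurableC.
apply/seteqP; split=> t /=.
  move=> <- i _; rewrite ffunE; case: ifPn => [/set_mem//|/negP tA At].
  by apply: tA; rewrite inE.
move=> h; apply/ffunP => i; rewrite ffunE; have := h i I.
by case: ifP => ci; [move=> /mem_set ->|move=> tA; apply/negP => /set_mem].
Qed.

Lemma finite_valued_measurable (s : R -> R) : finite_valued s -> measurable_fun setT s.
Proof.
move=> [I [k [f [mk sE]]]].
rewrite (_ : s = fun t => \sum_(i : I) f i * \1_(k @^-1` [set i]) t).
  apply: measurable_sum => i; apply: measurable_funM; first exact: measurable_cst.
  exact: measurable_indic.
apply/funext => t; rewrite (bigD1 (k t))//= big1 ?addr0.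
  by rewrite indicE mem_set// mulr1 sE.
move=> i ik; rewrite indicE memNset ?mulr0//= => h.
by rewrite -h eqxx in ik.
Qed.

Lemma finite_valued_indic A : measurable A -> finite_valued (\1_A : R -> R).
Proof.
move=> mA; have := finite_valued_map (fun c : {ffun 'I_1 -> bool} => (c ord0)%:R : R)
  (finite_valued_bools (fun _ : 'I_1 => mA)).
by congr finite_valued; apply/funext => t; rewrite ffunE indicE.
Qed.

Lemma simple_inP (V : lmodType R) (X : Defs.space V) (s : R -> V) :
  lin_closed (carrier X) ->
  simple_in X s <-> finite_valued s /\ forall t, carrier X (s t).
Proof.
move=> hC; split=> [[n [A [v [hAv sE]]]]|[[I [k [f [mk sE]]]] hs]].
  split; last first.
    by move=> t; rewrite sE; apply: (lin_closed_sum hC) => i; exact: (hAv i).2.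
  have := finite_valued_map (fun c : {ffun 'I_n -> bool} => \sum_(i < n) (c i)%:R *: v i)
    (finite_valued_bools (fun i => (hAv i).1)).
  congr finite_valued; apply/funext => t; rewrite sE; apply: eq_bigr => i _.
  by rewrite ffunE indicE.
(* At indices that [k] never reaches, [f] may leave the carrier; there its value is replaced by
   0. *)
have [g hg] : exists g : I -> V, (forall i, carrier X (g i)) /\ forall t, s t = g (k t).
  exists (fun i => if `[< carrier X (f i) >] then f i else 0); split.
    by move=> i; case: asboolP => // _; exact: (lin_closed0 hC).
  by move=> t; rewrite asboolT ?sE// -sE.
exists #|I|, (fun j => k @^-1` [set enum_val j]), (fun j => g (enum_val j)); split.
  by move=> j; split; [exact: mk|exact: hg.1].
move=> t; rewrite hg.2 (bigD1 (enum_rank (k t)))//= enum_rankK big1 ?addr0.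
  by rewrite indicE mem_set// scale1r.
move=> j jk; rewrite indicE memNset ?scale0r//= => h.
by move: jk; rewrite h enum_valK eqxx.
Qed.

End finite_valued.

Section strongly_measurable.
Context (R : realType) (T : R).
Local Notation D := (`]0%R, T[%classic : set (measurableTypeR R)).

Lemma mD : measurable D. Proof. exact: measurable_itv. Qed.

Lemma D_itv t : D t = (0 < t < T) :> Prop.
Proof. by rewrite /= in_itv. Qed.

(** A Lipschitz bound replaces linearity, so that the lemma applies to [wcurl], which is linear only
    up to null sets. *)
Lemma sm_map (V V' : lmodType R) (X : Defs.space V) (Y : Defs.space V') (L : V -> V') (C : R)
    (u : R -> V) : lin_closed (carrier X) -> lin_closed (carrier Y) ->
  (forall p, carrier X p -> carrier Y (L p)) ->
  (forall p q, carrier X p -> carrier X q -> 0 <= snorm Y (L p - L q) <= C * snorm X (p - q)) ->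
  strongly_measurable T X u -> strongly_measurable T Y (fun t => L (u t)).
Proof.
move=> cX cY LXY LC [hu [s [hs su]]]; split; first by move=> t /hu /LXY.
exists (fun n t => L (s n t)); split.
  move=> n; have /(simple_inP _ cX)[fs cs] := hs n.
  by apply/(simple_inP _ cY); split; [exact: (finite_valued_map L fs)|move=> t; exact: LXY].
move=> t tT; have lim : (fun n => C * snorm X (u t - s n t)) @ \oo --> C * 0.
  by apply: cvgM; [exact: cvg_cst|exact: su].
rewrite mulr0 in lim.
apply: (squeeze_cvgr _ (cvg_cst 0) lim); near=> n.
have /(simple_inP _ cX)[_ cs] := hs n; exact: LC (hu t tT) (cs t).
Unshelve. all: by end_near. Qed.

Lemma sm_cst (V : lmodType R) (X : Defs.space V) (v : V) : seminormed X ->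
  carrier X v -> strongly_measurable T X (fun=> v).
Proof.
move=> hX hv; split=> //; exists (fun _ _ => v); split.
  by move=> n; apply/(simple_inP _ (sn_closed hX)); split=> //; exact: finite_valued_cst.
by move=> t _; rewrite subrr (sn0 hX); exact: cvg_cst.
Qed.

Section seminormed.
Context (V : lmodType R) (X : Defs.space V) (hX : seminormed X).
Let hC := sn_closed hX.

Lemma sm_simple s : simple_in X s -> strongly_measurable T X s.
Proof.
move=> hs; have /(simple_inP _ hC)[_ cs] := hs; split=> //.
exists (fun=> s); split=> // t _; rewrite subrr (sn0 hX); exact: cvg_cst.
Qed.

Lemma sm_lin a (u v : R -> V) : strongly_measurable T X u -> strongly_measurable T X v ->
  strongly_measurable T X (a *: u + v).
Proof.
move=> [hu [s [hs su]]] [hv [r [hr rv]]]; split.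
  by move=> t tT; exact: (lin_closedP hC _ (hu t tT) (hv t tT)).
exists (fun n => a *: s n + r n); split.
  move=> n; have /(simple_inP _ hC)[fs cs] := hs n; have /(simple_inP _ hC)[fr cr] := hr n.
  apply/(simple_inP _ hC); split; last by move=> t; exact: (lin_closedP hC).
  exact: (finite_valued_map (fun p => a *: p.1 + p.2) (finite_valued_pair fs fr)).
move=> t tT; have lim : (fun n => `|a| * snorm X (u t - s n t) + snorm X (v t - r n t)) @ \oo --> `|a| * 0 + 0.
  by apply: cvgD; [apply: cvgM; [exact: cvg_cst|exact: su]|exact: rv].
rewrite mulr0 addr0 in lim; apply: (squeeze_cvgr _ (cvg_cst 0) lim); near=> n.
have /(simple_inP _ hC)[_ cs] := hs n; have /(simple_inP _ hC)[_ cr] := hr n.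
have cd1 := lin_closedB hC (hu t tT) (cs t); have cd2 := lin_closedB hC (hv t tT) (cr t).
rewrite (_ : _ - _ = a *: (u t - s n t) + (v t - r n t)); last first.
  rewrite -[(a *: u + v) t]/(a *: u t + v t) -[(a *: s n + r n) t]/(a *: s n t + r n t).
  by rewrite opprD addrACA scalerBr.
have cl := lin_closedZ hC a cd1.
rewrite (sn_ge0 hX (lin_closedD hC cl cd2))/= -(snZ hX a cd1).
exact: (snD hX).
Unshelve. all: by end_near. Qed.

Lemma sm_indic (B : set R) (u : R -> V) : measurable B -> strongly_measurable T X u ->
  strongly_measurable T X (fun t => (\1_B t : R) *: u t).
Proof.
move=> mB [hu [s [hs su]]]; split.
  by move=> t tT; exact: (lin_closedZ hC _ (hu t tT)).
exists (fun n t => (\1_B t : R) *: s n t); split.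
  move=> n; have /(simple_inP _ hC)[fs cs] := hs n.
  apply/(simple_inP _ hC); split; last by move=> t; exact: (lin_closedZ hC).
  exact: (finite_valued_map (fun p => p.1 *: p.2)
    (finite_valued_pair (finite_valued_indic mB) fs)).
move=> t tT; have lim : (fun n => `|\1_B t : R| * snorm X (u t - s n t)) @ \oo --> `|\1_B t : R| * 0.
  by apply: cvgM; [exact: cvg_cst|exact: su].
rewrite mulr0 in lim; apply: cvg_trans lim; apply: near_eq_cvg; near=> n.
have /(simple_inP _ hC)[_ cs] := hs n.
by rewrite -scalerBr (snZ hX)//; exact: (lin_closedB hC (hu t tT) (cs t)).
Unshelve. all: by end_near. Qed.

End seminormed.

(** Along simple approximants [F] takes finitely many values, so the scalar function is a pointwise
    limit of measurable step functions. This gives the measurability of norms, pairings and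
    evaluations alike. *)
Lemma sm_measurable2 (V V' : lmodType R) (X : Defs.space V) (Y : Defs.space V')
    (F : V -> V' -> R) (u : R -> V) (v : R -> V') :
  lin_closed (carrier X) -> lin_closed (carrier Y) ->
  (forall (p : V) (q : V') (s : nat -> V) (r : nat -> V'),
    carrier X p -> carrier Y q -> (forall n, carrier X (s n)) -> (forall n, carrier Y (r n)) ->
    (fun n => snorm X (p - s n)) @ \oo --> (0 : R) ->
    (fun n => snorm Y (q - r n)) @ \oo --> (0 : R) ->
    (fun n => F (s n) (r n)) @ \oo --> F p q) ->
  strongly_measurable T X u -> strongly_measurable T Y v ->
  measurable_fun D (fun t => F (u t) (v t)).
Proof.
move=> cX cY hF [hu [s [hs su]]] [hv [r [hr rv]]].
apply: (@measurable_fun_cvg _ (measurableTypeR R) R D (fun n t => F (s n t) (r n t))).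
  move=> n; apply: measurable_funTS.
  have /(simple_inP _ cX)[fs cs] := hs n; have /(simple_inP _ cY)[fr cr] := hr n.
  exact: finite_valued_measurable
    (finite_valued_map (fun p => F p.1 p.2) (finite_valued_pair fs fr)).
move=> t; rewrite D_itv => tT; apply: hF => [||n|n||]; [exact: hu|exact: hv| | |exact: su|exact: rv].
- by have /(simple_inP _ cX)[] := hs n.
- by have /(simple_inP _ cY)[] := hr n.
Qed.

Lemma sm_measurable_snorm (V : lmodType R) (X : Defs.space V) (u : R -> V) :
  seminormed X -> strongly_measurable T X u ->
  measurable_fun D (fun t => snorm X (u t)).
Proof.
move=> hX hu; have hC := sn_closed hX.
apply: (sm_measurable2 (Y := X) (F := fun p _ => snorm X p) hC hC _ hu hu).
move=> p q s r hp _ hs _ ps _; apply/cvgrPdist_lt => e e0.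
move: ps => /cvgr0Pnorm_lt/(_ e e0); apply: filterS => n h; apply: le_lt_trans h.
by apply: (le_trans (sn_dist hX hp (hs n))); exact: ler_norm.
Qed.

(* Piecewise constant interpolation on a grid of mesh [T / n]. *)
Lemma sm_continuous (V : lmodType R) (X : Defs.space V) (u : R -> V) : 0 < T ->
  seminormed X -> (forall t, 0 <= t <= T -> carrier X (u t)) ->
  (forall t, 0 <= t <= T -> forall e, 0 < e -> exists2 d, 0 < d &
    forall s, 0 <= s <= T -> `|s - t| < d -> snorm X (u t - u s) < e) ->
  strongly_measurable T X u.
Proof.
move=> T0 hX cu ccu; have hC := sn_closed hX.
split=> [t /andP[t0 tT]|]; first by apply: cu; rewrite !ltW.
pose h n : R := T / n.+1%:R.
have h0 n : 0 < h n by rewrite divr_gt0.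
(* There are [n.+2] cells because [t = T] falls into the cell [n.+1]; [None] stands for the
   complement of [[0, T]]. *)
pose k n t : option 'I_n.+2 := if 0 <= t <= T then Some (inord (Num.truncn (t / h n))) else None.
pose g n (c : option 'I_n.+2) : R := if c is Some i then i%:R * h n else 0.
have thn n t : 0 <= t <= T -> (Num.truncn (t / h n) < n.+2)%N.
  move=> /andP[t0 tT]; rewrite ltnS -(@ler_nat R).
  have /truncn_itv/andP[h1 _] : 0 <= t / h n by rewrite divr_ge0// ltW.
  apply: (le_trans h1).
  by rewrite ler_pdivrMr// /h mulrC divfK// pnatr_eq0.
have gk n t : 0 <= t <= T -> 0 <= g n (k n t) <= T /\ `|g n (k n t) - t| < 2 * h n.
  move=> t0T; have /andP[t0 tT] := t0T; rewrite /k t0T /g inordK ?thn//.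
  have /truncn_itv/andP[h1 h2] : 0 <= t / h n by rewrite divr_ge0// ltW.
  rewrite ler_pdivlMr// in h1; rewrite ltr_pdivrMr// -natr1 mulrDl mul1r in h2.
  split; first by rewrite (le_trans h1 tT) andbT mulr_ge0// ltW.
  by rewrite ler0_norm ?subr_le0//; have := h0 n; lra.
have mk n i : measurable (k n @^-1` [set i]).
  case: i => [i|].
    rewrite (_ : _ @^-1` _ = `[0, T] `&` `[i%:R * h n, i.+1%:R * h n[%classic); last first.
      apply/seteqP; split=> t /=; rewrite /k !in_itv/=.
        case: ifP => // t0T [<-]; split=> //; rewrite inordK ?thn//.
        have /andP[t0 tT] := t0T.
        have /truncn_itv/andP[h1 h2] : 0 <= t / h n by rewrite divr_ge0// ltW.
        by rewrite -ler_pdivlMr// h1/= -ltr_pdivrMr.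
      move=> [t0T /andP[h1 h2]]; rewrite t0T; congr Some; apply/val_inj => /=.
      rewrite inordK ?thn//; apply/eqP; rewrite truncn_eq.
        by rewrite ler_pdivlMr// h1/= ltr_pdivrMr.
      by have /andP[t0 tT] := t0T; rewrite divr_ge0// ltW.
    by apply: measurableI; exact: measurable_itv.
  rewrite (_ : _ @^-1` _ = ~` `[0, T]%classic).
    by apply: measurableC; exact: measurable_itv.
  by apply/seteqP; split=> t /=; rewrite /k in_itv/=; case: ifP.
have gT n c : 0 <= g n c <= T \/ ~ 0 <= g n c <= T by apply: EM.
exists (fun n t => if `[< 0 <= g n (k n t) <= T >] then u (g n (k n t)) else 0); split.
  move=> n; apply/(simple_inP _ hC); split.
    exists (option 'I_n.+2), (k n), (fun c => if `[< 0 <= g n c <= T >] then u (g n c) else 0).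
    by split; [exact: mk|].
  by move=> t; case: asboolP => [/cu//|_]; exact: (lin_closed0 hC).
move=> t /andP[t0 tT]; have t0T : 0 <= t <= T by rewrite !ltW.
apply/cvgr0Pnorm_lt => e e0; have [d d0 hd] := ccu t t0T e e0.
have [N hN] := inv_succ_cvg0 (ltW T0) d0; exists N => // n /= Nn.
have [g1 g2] := gk n t t0T; rewrite asboolT// ger0_norm; last first.
  by apply: (sn_ge0 hX); exact: (lin_closedB hC (cu _ t0T) (cu _ g1)).
apply: hd => //; apply: (lt_trans g2); apply: le_lt_trans (hN n n Nn Nn).
by rewrite /h mulrDr; set x := T / _; rewrite -mulr2n mulr_natl.
Qed.

End strongly_measurable.

Section L2B.
Context (R : realType) (T : R).
Local Notation D := (`]0%R, T[%classic : set (measurableTypeR R)).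
Let mu : {measure set (measurableTypeR R) -> \bar R} := leb R.

(** The square root is left out so that pointwise estimates can be integrated as they are. The
    triangle inequality then becomes [sqnormB_trans], with factors 2. *)
Definition sqnormB (V : lmodType R) (X : Defs.space V) (u : R -> V) : R :=
  \int[leb R]_(t in `]0, T[) snorm X (u t) ^+ 2.

Lemma measure_D_lty : (mu D < +oo)%E.
Proof.
have := lebesgue_measure_itv `]0, T[; rewrite /mu /leb /= => ->.
by case: ifP => _; rewrite -?EFinB ltry.
Qed.

Lemma integrable_cstD (r : R) : mu.-integrable D (EFin \o cst r).
Proof.
apply: measurable_bounded_integrable; [exact: mD|exact: measure_D_lty|exact: measurable_cst|].
by exists `|r|; split => // M hM x _; exact: ltW.
Qed.

Section seminormed.
Context (V : lmodType R) (X : Defs.space V) (hX : seminormed X).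
Let hC := sn_closed hX.
Implicit Types u v : R -> V.

Lemma measurable_sqsnorm u : strongly_measurable T X u ->
  measurable_fun D (fun t => snorm X (u t) ^+ 2).
Proof.
by move=> hu; apply: measurable_funX; exact: sm_measurable_snorm hX hu.
Qed.

Lemma inL2BP u : inL2B T X u <-> strongly_measurable T X u /\
  mu.-integrable D (EFin \o (fun t => snorm X (u t) ^+ 2)).
Proof.
have h := @integrable_lty _ (measurableTypeR R) R mu D (fun t => snorm X (u t) ^+ 2) (fun t _ => sqr_ge0 _).
split=> [[su ui]|[su /h[_ ui]]]; split=> //.
by apply/h; split=> //; exact: measurable_sqsnorm.
Qed.

Lemma inL2B_le u (g : R -> R) : strongly_measurable T X u -> mu.-integrable D (EFin \o g) ->
  (forall t, 0 < t < T -> snorm X (u t) ^+ 2 <= g t) -> inL2B T X u.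
Proof.
move=> su gi ug; apply/inL2BP; split=> //.
apply: (integrable_le (@mD R T) (measurable_sqsnorm su) gi) => t.
by rewrite D_itv => tT; rewrite ger0_norm ?sqr_ge0// ug.
Qed.

Lemma inL2B_carrier u t : inL2B T X u -> 0 < t < T -> carrier X (u t).
Proof. by move=> [[cu _] _]; exact: cu. Qed.

Lemma sqnormB_ge0 u : 0 <= sqnormB X u.
Proof. by apply: Rintegral_ge0 => t _; exact: sqr_ge0. Qed.

Lemma inL2B_lin a u v : inL2B T X u -> inL2B T X v -> inL2B T X (a *: u + v).
Proof.
move=> hu hv; have /inL2BP[su ui] := hu; have /inL2BP[sv vi] := hv.
apply: (inL2B_le (sm_lin hX a su sv)
  (integrable_add (@mD R T) (integrableZ (@mD R T) (2 * `|a| ^+ 2) ui) (integrableZ (@mD R T) 2 vi))).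
move=> t tT; have cu := inL2B_carrier hu tT; have cv := inL2B_carrier hv tT.
apply: (le_trans (sn_sq_quasi hX (lin_closedZ hC a cu) cv)).
by rewrite (snZ hX a cu) exprMn mulrA.
Qed.

Lemma inL2B_cst0 : inL2B T X 0.
Proof.
have s0 := sm_cst T hX (lin_closed0 hC).
apply: (inL2B_le s0 (integrable_cstD 0)) => t _.
by change (snorm X (0 : V) ^+ 2 <= 0); rewrite (sn0 hX) expr0n.
Qed.

Lemma inL2B_closed : lin_closed (inL2B T X).
Proof. by split; [exact: inL2B_cst0|exact: inL2B_lin]. Qed.

Lemma sqnormB_quasi u v : inL2B T X u -> inL2B T X v ->
  sqnormB X (u + v) <= 2 * sqnormB X u + 2 * sqnormB X v.
Proof.
move=> hu hv; have /inL2BP[su ui] := hu; have /inL2BP[sv vi] := hv.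
have /inL2BP[_ uvi] := lin_closedD inL2B_closed hu hv.
have i2 := integrableZ (@mD R T) 2 ui; have j2 := integrableZ (@mD R T) 2 vi.
rewrite /sqnormB -(RintegralZl _ (@mD R T) ui) -(RintegralZl _ (@mD R T) vi).
rewrite -(RintegralD (@mD R T) i2 j2).
apply: (le_Rintegral (@mD R T) uvi (integrable_add (@mD R T) i2 j2)) => t.
rewrite D_itv => tT; exact: (sn_sq_quasi hX (inL2B_carrier hu tT) (inL2B_carrier hv tT)).
Qed.

Lemma sqnormBN u : inL2B T X u -> sqnormB X (- u) = sqnormB X u.
Proof.
move=> hu; apply: eq_Rintegral => t /set_mem; rewrite D_itv => tT.
by rewrite -[(- u) t]/(- u t) (snN hX (inL2B_carrier hu tT)).
Qed.

Lemma sqnormB_trans w u v : inL2B T X u -> inL2B T X v -> inL2B T X w ->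
  sqnormB X (u - v) <= 2 * sqnormB X (u - w) + 2 * sqnormB X (w - v).
Proof.
move=> hu hv hw; rewrite (_ : u - v = (u - w) + (w - v)); last by rewrite addrA subrK.
by apply: sqnormB_quasi; exact: (lin_closedB inL2B_closed).
Qed.

Lemma sqnormBC u v : inL2B T X u -> inL2B T X v ->
  sqnormB X (u - v) = sqnormB X (v - u).
Proof. by move=> hu hv; rewrite -opprB sqnormBN//; exact: (lin_closedB inL2B_closed). Qed.

Lemma inL2B_bounded u M : strongly_measurable T X u ->
  (forall t, 0 < t < T -> snorm X (u t) <= M) -> inL2B T X u.
Proof.
move=> su uM; apply: (inL2B_le su (integrable_cstD (M ^+ 2))) => t tT.
have p0 := sn_ge0 hX (su.1 t tT); rewrite lerXn2r ?nnegrE ?uM//.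
exact: le_trans (uM t tT).
Qed.

Lemma inL2B_simple s : simple_in X s -> inL2B T X s.
Proof.
move=> hs; have /(simple_inP _ hC)[[I [k [f [mk sE]]]] cs] := hs.
apply: (inL2B_bounded (M := \sum_(i : I) `|snorm X (f i)|) (sm_simple T hX hs)) => t tT.
rewrite sE (bigD1 (k t))//=; apply: (le_trans (ler_norm _)).
by rewrite lerDl sumr_ge0.
Qed.

Lemma inL2B_indic (B : set R) u : measurable B -> inL2B T X u ->
  inL2B T X (fun t => (\1_B t : R) *: u t).
Proof.
move=> mB hu; have /inL2BP[su ui] := hu.
apply: (inL2B_le (sm_indic hX mB su) ui) => t tT.
rewrite (snZ hX _ (su.1 t tT)) exprMn ler_piMl ?sqr_ge0// indicE.
by case: (_ \in _); rewrite ?normr1 ?normr0 ?expr1n ?expr0n.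
Qed.

(* The simple approximants are cut off where they exceed [2 snorm X (u t)],
   which gives domination. *)
Lemma simple_dense u e : inL2B T X u -> 0 < e ->
  exists2 s, simple_in X s & sqnormB X (u - s) < e.
Proof.
move=> hu e0; have /inL2BP[su ui] := hu; have [cu [s [hs us]]] := su.
have mu_ := sm_measurable_snorm hX su.
have cs n t : carrier X (s n t) by have /(simple_inP _ hC)[_] := hs n.
pose A n := D `&` [set t | snorm X (s n t) <= 2 * snorm X (u t)].
have mA n : measurable (A n : set R).
  have ms := sm_measurable_snorm hX (sm_simple T hX (hs n)).
  have m2 : measurable_fun D (fun t => 2 * snorm X (u t)) by exact: measurable_funM.
  have := measurable_fun_ler ms m2 (@mD R T) (Y := [set true]) I.
  by congr measurable; apply/seteqP; split=> t [].
pose r n t := (\1_(A n) t : R) *: s n t.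
have hr n : simple_in X (r n).
  have /(simple_inP _ hC)[fs _] := hs n.
  apply/(simple_inP _ hC); split; last by move=> t; exact: (lin_closedZ hC).
  exact: (finite_valued_map (fun p => p.1 *: p.2)
    (finite_valued_pair (finite_valued_indic (mA n)) fs)).
have hur n : inL2B T X (u - r n) by apply: (lin_closedB inL2B_closed hu); exact: inL2B_simple.
have rE n t : 0 < t < T ->
    (r n t = s n t /\ snorm X (s n t) <= 2 * snorm X (u t)) \/
    (r n t = 0 /\ 2 * snorm X (u t) < snorm X (s n t)).
  move=> tT; rewrite /r indicE; have [h|h] := leP (snorm X (s n t)) (2 * snorm X (u t)).
    by left; rewrite mem_set ?scale1r//; split=> //; rewrite D_itv.
  by right; rewrite memNset ?scale0r// => -[_ /=]; rewrite leNgt h.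
have lim : (fun n => sqnormB X (u - r n)) @ \oo --> \int[mu]_(t in D) 0.
  (* 9 is the square of 3: the cut-off approximants satisfy
     [snorm X (r n t) <= 2 * snorm X (u t)]. *)
  have gi := integrableZ (@mD R T) 9 ui.
  apply: (Rintegral_dct (@mD R T) _ _ _ gi _).2.
  - by move=> n; apply: measurable_sqsnorm; have /inL2BP[] := hur n.
  - exact: measurable_cst.
  - apply: aeW => t; rewrite D_itv => tT.
    have ct := cu t tT.
    suff h : (fun n => snorm X (u t - r n t)) @ \oo --> (0 : R).
      rewrite -[X in _ --> X](mulr0 0); under eq_fun do rewrite expr2.
      by apply: cvgM; exact: h.
    (* The cut-off does not spoil convergence: where it acts, the norm of [u t] is smaller than the
       distance from [u t] to [s n t]. *)
    have bnd n : 0 <= snorm X (u t - r n t) <= 2 * snorm X (u t - s n t).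
      have d0 := sn_ge0 hX (lin_closedB hC ct (cs n t)).
      have [[-> _]|[-> h]] := rE n t tT.
        by rewrite d0/=; lra.
      rewrite subr0 (sn_ge0 hX ct)/=.
      have := sn_dist hX (cs n t) ct; rewrite (snB hX (cs n t) ct) ler_norml => /andP[_].
      by have := sn_ge0 hX ct; lra.
    have lim2 : (fun n => 2 * snorm X (u t - s n t)) @ \oo --> (2 * 0 : R).
      by apply: cvgM; [exact: cvg_cst|exact: us].
    rewrite mulr0 in lim2; apply: (squeeze_cvgr _ (cvg_cst 0) lim2).
    by near=> n; exact: bnd.
  - move=> n t; rewrite D_itv => tT; have ct := cu t tT; rewrite ger0_norm ?sqr_ge0//.
    have b : 0 <= snorm X (u t - r n t) <= 3 * snorm X (u t).
      have cr : carrier X (r n t) by have /(simple_inP _ hC)[_] := hr n.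
      rewrite (sn_ge0 hX (lin_closedB hC ct cr))/=.
      apply: (le_trans (snD hX ct (lin_closedN hC cr))); rewrite (snN hX cr).
      have := sn_ge0 hX ct; have [[-> h]|[-> _]] := rE n t tT; rewrite ?(sn0 hX); lra.
    have -> : 9 * snorm X (u t) ^+ 2 = (3 * snorm X (u t)) ^+ 2 by ring.
    have /andP[b1 b2] := b; rewrite lerXn2r ?nnegrE//; exact: le_trans b2.
rewrite Rintegral_cst ?mul0r in lim; last exact: mD.
move: lim => /cvgr0Pnorm_lt/(_ e e0)[N _ hN].
by exists (r N) => //; apply: le_lt_trans (ler_norm _) (hN N _) => /=.
Unshelve. all: by end_near. Qed.

(** The extraction need not be monotone: [k <= f k] already preserves limits. *)
Lemma ae_cvg_subsequence (u : nat -> R -> V) w : (forall n, inL2B T X (u n)) -> inL2B T X w ->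
  (fun n => sqnormB X (u n - w)) @ \oo --> (0 : R) ->
  exists f : nat -> nat, (forall k, (k <= f k)%N) /\
    {ae mu, forall t, D t -> (fun k => snorm X (u (f k) t - w t)) @ \oo --> (0 : R)}.
Proof.
move=> hu hw lim.
have e8 k : 0 < (8^-1 : R) ^+ k by apply: exprn_gt0; rewrite invr_gt0.
have /choice[f hf] : forall k, exists n, (k <= n)%N /\ sqnormB X (u n - w) <= 8^-1 ^+ k.
  move=> k; move: lim => /cvgr0Pnorm_lt/(_ _ (e8 k))[N _ hN].
  exists (maxn k N); rewrite leq_maxl; split=> //.
  by apply: le_trans (ler_norm _) (ltW (hN _ _)) => /=; rewrite leq_maxr.
exists f; split=> [k|]; first exact: (hf k).1.
have hB k : inL2B T X (u (f k) - w) by exact: (lin_closedB inL2B_closed).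
have := @ae_geometric_bound _ (measurableTypeR R) R mu D (@mD R T)
  (fun k t => snorm X ((u (f k) - w) t) ^+ 2)
  (fun k => ((inL2BP _).1 (hB k)).2) (fun k t _ => sqr_ge0 _) (fun k => (hf k).2).
move=> h; apply: (ae_imp h) => t ht Dt; have [M hM] := ht Dt.
have M0 : 0 <= M by have := le_trans (sqr_ge0 _) (hM 0%N); rewrite expr0 mulr1.
apply/cvgr0Pnorm_lt => e e0.
have [N hN] := pow_half_small (sqrtr_ge0 M) e0; exists N => // k /= Nk.
apply: le_lt_trans (hN k Nk).
have ck : carrier X ((u (f k) - w) t) by move: Dt; rewrite D_itv => Dt; exact: inL2B_carrier (hB k) Dt.
rewrite -[u _ t - w t]/((u (f k) - w) t) ger0_norm; last exact: (sn_ge0 hX ck).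
rewrite -(@ler_pXn2r _ 2)// ?nnegrE ?mulr_ge0 ?sqrtr_ge0 ?exprn_ge0//; last exact: (sn_ge0 hX ck).
rewrite exprMn sqr_sqrtr//; apply: (le_trans (hM k)).
by rewrite -exprM mulnC exprM; have -> : (2^-1 : R) ^+ 2 = 4^-1 by field.
Qed.

End seminormed.
End L2B.

Section L2B_complete.
Context (R : realType) (T : R) (V : lmodType R) (X : Defs.space V).
Hypotheses (hX : seminormed X) (cX : complete_space X).
Local Notation D := (`]0%R, T[%classic : set (measurableTypeR R)).
Let mu : {measure set (measurableTypeR R) -> \bar R} := leb R.
Let hC := sn_closed hX.
Let hB := inL2B_closed T hX.

(** The limit must come with simple approximants. Each [u n] is therefore first replaced by a nearby
    simple function, and the pointwise limit is taken along a fast subsequence of these, in the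
    complete space [X]. *)
Lemma L2B_complete (u : nat -> R -> V) : (forall n, inL2B T X (u n)) ->
  (forall e, 0 < e -> exists N, forall n p, (N <= n)%N -> (N <= p)%N ->
     sqnormB T X (u n - u p) < e) ->
  exists2 w, inL2B T X w & (fun n => sqnormB T X (u n - w)) @ \oo --> (0 : R).
Proof.
move=> hu hC0.
have /choice[s hs] : forall n, exists s, simple_in X s /\ sqnormB T X (u n - s) < n.+1%:R^-1.
  move=> n; have n0 : 0 < n.+1%:R^-1 :> R by rewrite invr_gt0.
  by have [s h1 h2] := simple_dense hX (hu n) n0; exists s.
have bs n : inL2B T X (s n) := inL2B_simple T hX (hs n).1.
have cs n t : carrier X (s n t) by have /(simple_inP _ hC)[_] := (hs n).1.
have sC (e : R) : 0 < e -> exists N, forall n p, (N <= n)%N -> (N <= p)%N -> sqnormB T X (s n - s p) < e.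
  (* The two uses of [sqnormB_trans] cost factors of at most 4. *)
  move=> e0; have e8 : 0 < e / 8 by rewrite divr_gt0.
  have [N hN] := hC0 _ e8; have [M hM] := inv_succ_cvg0 (ler01 : 0 <= 1 :> R) e8.
  exists (maxn N M) => n p; rewrite !geq_max => /andP[Nn Mn] /andP[Np Mp].
  have h1 := sqnormB_trans hX (bs n) (bs p) (hu n).
  have h2 := sqnormB_trans hX (hu n) (bs p) (hu p).
  have h3 := hN n p Nn Np; have h4 := hM n p Mn Mp; rewrite mul1r in h4.
  have h5 := (hs n).2; have h6 := (hs p).2; rewrite (sqnormBC hX (hu n) (bs n)) in h5.
  have h7 : 0 < n.+1%:R^-1 :> R by rewrite invr_gt0.
  move: h1 h2 h3 h4 h5 h6 h7; move: (n.+1%:R^-1) (p.+1%:R^-1) (sqnormB _ _ (s n - s p))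
    (sqnormB _ _ (s n - u n)) (sqnormB _ _ (u n - s p)) (sqnormB _ _ (u n - u p)) (sqnormB _ _ (u p - s p)).
  by clear => x1 x2 x3 x4 x5 x6 x7; lra.
have e8 k : 0 < (8^-1 : R) ^+ k by apply: exprn_gt0; rewrite invr_gt0.
have [f [fk fmono hf]] := fast_subsequence e8 sC.
pose v k := s (f k).
have bv k j : inL2B T X (v k - v j) by exact: (lin_closedB hB (bs _) (bs _)).
have [N0 [mN0 N00 hN0]] : exists N : set (measurableTypeR R), [/\ measurable N, mu N = 0%E &
    forall t, D t -> ~ N t -> exists M, forall k, snorm X (v k.+1 t - v k t) ^+ 2 <= M * 4^-1 ^+ k].
  have [|N [mN N0 hN]] := @ae_geometric_bound _ (measurableTypeR R) R mu D (@mD R T)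
    (fun k t => snorm X ((v k.+1 - v k) t) ^+ 2)
    (fun k => ((inL2BP _ hX _).1 (bv k.+1 k)).2) (fun k t _ => sqr_ge0 _).
    by move=> k; apply: ltW; apply: (hf k) => //; exact: fmono.
  exists N; split=> // t Dt nNt; apply: contrapT => h; apply: nNt; apply: hN => /= h'.
  by apply: h; exact: h'.
have /choice[l hl] : forall t, exists l, carrier X l /\ (D t -> ~ N0 t ->
    (fun k => snorm X (v k t - l)) @ \oo --> (0 : R)).
  move=> t; have [[Dt nt]|h] := pselect (D t /\ ~ N0 t); last first.
    by exists 0; split; [exact: (lin_closed0 hC)|move=> Dt nt; exfalso; apply: h].
  have [M hM] := hN0 t Dt nt.
  have M0 : 0 <= M by have := le_trans (sqr_ge0 _) (hM 0%N); rewrite expr0 mulr1.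
  have d0 i j : 0 <= snorm X (v i t - v j t) := sn_ge0 hX (lin_closedB hC (cs _ t) (cs _ t)).
  have geo k j : (k <= j)%N -> snorm X (v j t - v k t) <= 2 * Num.sqrt M * 2^-1 ^+ k.
    apply: (@geometric_dist _ (fun i j => snorm X (v i t - v j t))); rewrite ?sqrtr_ge0//.
    - by move=> i; rewrite subrr (sn0 hX).
    - by move=> i j1 k1; exact: (sn_trans hX (cs _ t) (cs _ t) (cs _ t)).
    - move=> i; rewrite -(@ler_pXn2r _ 2)// ?nnegrE ?mulr_ge0 ?sqrtr_ge0 ?exprn_ge0//.
      rewrite exprMn sqr_sqrtr//; apply: (le_trans (hM i)).
      by rewrite -exprM mulnC exprM; have -> : (2^-1 : R) ^+ 2 = 4^-1 by field.
  have [l cl vl] : exists2 l, carrier X l & (fun n => snorm X (v n t - l)) @ \oo --> (0 : R).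
    apply: (cX (u := fun k => v k t)) => [k|e e0]; first exact: cs.
    have C0 : 0 <= 2 * Num.sqrt M by rewrite mulr_ge0.
    have e2 : 0 < e / 2 by rewrite divr_gt0.
    have [N hN] := pow_half_small C0 e2; exists N => n p Nn Np.
    apply: (le_lt_trans (sn_trans hX (cs _ t) (cs _ t) (cs (f N) t))).
    have h1 := le_lt_trans (geo N n Nn) (hN N (leqnn _)).
    have h2 := le_lt_trans (geo N p Np) (hN N (leqnn _)).
    rewrite (snB hX (cs _ t) (cs _ t)) in h2.
    move: h1 h2; rewrite /v; lra.
  by exists l; split.
pose w t := if `[< N0 t >] then 0 else l t.
have cw t : carrier X (w t).
  by rewrite /w; case: asboolP => _; [exact: (lin_closed0 hC)|exact: (hl t).1].
have vw t : D t -> ~ N0 t -> (fun k => snorm X (v k t - w t)) @ \oo --> (0 : R).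
  by move=> Dt nt; rewrite /w asboolF//; exact: (hl t).2.
have sw : strongly_measurable T X w.
  (* Strong measurability demands convergence at every time, so the approximants are set to 0 on
     [N0], as [w] is. *)
  split=> //; exists (fun k t => (\1_(~` N0) t : R) *: v k t); split.
    move=> k; have /(simple_inP _ hC)[fs _] := (hs (f k)).1.
    apply/(simple_inP _ hC); split; last by move=> t; exact: (lin_closedZ hC _ (cs _ t)).
    exact: (finite_valued_map (fun p => p.1 *: p.2)
      (finite_valued_pair (finite_valued_indic (measurableC mN0)) fs)).
  move=> t tT; have Dt : D t by rewrite D_itv.
  rewrite indicE; have [nt|nt] := pselect (N0 t).
    rewrite memNset; last by move=> h; exact: h.
    under eq_fun do rewrite scale0r subr0.
    by rewrite /w asboolT// (sn0 hX); exact: cvg_cst.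
  rewrite mem_set//; under eq_fun do rewrite scale1r (snB hX (cw t) (cs _ t)).
  exact: vw.
have key k : inL2B T X (v k - w) /\ sqnormB T X (v k - w) <= 8^-1 ^+ k.
  have svw : strongly_measurable T X (v k - w).
    have sv : strongly_measurable T X (v k) := ((inL2BP _ hX _).1 (bs (f k))).1.
    by have := sm_lin hX (-1) sw sv; rewrite scaleN1r addrC.
  have [||||||i le] := @Rintegral_fatou _ (measurableTypeR R) R mu D (@mD R T)
     (fun j t => snorm X ((v k - v j) t) ^+ 2) (fun t => snorm X ((v k - w) t) ^+ 2) (8^-1 ^+ k) k.
  - by move=> j; exact: ((inL2BP _ hX _).1 (bv k j)).2.
  - exact: measurable_sqsnorm.
  - by move=> n t _; exact: sqr_ge0.
  - by move=> t _; exact: sqr_ge0.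
  - exists N0; split=> // t /= /not_implyP[Dt nc]; apply: contrapT => nt; apply: nc.
    have c : (fun j => snorm X ((v k - v j) t)) @ \oo --> snorm X ((v k - w) t).
      apply/cvgrPdist_lt => e e0; have := vw t Dt nt.
      move=> /cvgr0Pnorm_lt/(_ e e0); apply: filterS => j h; apply: le_lt_trans h.
      apply: le_trans (ler_norm _).
      apply: (le_trans (sn_dist hX (lin_closedB hC (cs _ t) (cw t)) (lin_closedB hC (cs _ t) (cs _ t)))).
      have -> : v k t - w t - (v k t - v j t) = v j t - w t by rewrite opprB addrC addrA subrK.
      exact: lexx.
    by apply: cvgM; exact: c.
  - by move=> j kj; apply: ltW; apply: (hf k) => //; exact: fmono.
  by split => //; apply/(inL2BP _ hX).
have Lw : inL2B T X w.
  have := lin_closedB hB (bs (f 0%N)) (key 0%N).1.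
  by rewrite /v opprB addrCA subrr addr0.
exists w => //; apply/cvgr0Pnorm_lt => e e0; have e16 : 0 < e / 16 by rewrite divr_gt0.
have [N hN] := hC0 _ e16; have [M hM] := inv_succ_cvg0 (ler01 : 0 <= 1 :> R) e16.
have [K hK] := pow_half_small (ler01 : 0 <= 1 :> R) e16.
exists N => // n /= Nn; rewrite ger0_norm ?sqnormB_ge0//.
pose k := maxn N (maxn M K).
have kN : (N <= k)%N by rewrite leq_maxl.
have kM : (M <= k)%N by rewrite /k maxnCA leq_maxl.
have kK : (K <= k)%N by rewrite /k maxnA leq_maxr.
have h1 := sqnormB_trans hX (hu n) Lw (hu (f k)).
have h2 := sqnormB_trans hX (hu (f k)) Lw (bs (f k)).
have h3 := hN n (f k) Nn (leq_trans kN (fk k)).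
have h4 := (hs (f k)).2.
have h5 := hM (f k) (f k) (leq_trans kM (fk k)) (leq_trans kM (fk k)).
have h6 : sqnormB T X (s (f k) - w) < e / 16.
  apply: (le_lt_trans (key k).2); apply: le_lt_trans (hK k kK); rewrite mul1r.
  by apply: lerXn2r; rewrite ?nnegrE; lra.
have h7 : 0 < (f k).+1%:R^-1 :> R by rewrite invr_gt0.
move: h1 h2 h3 h4 h5 h6 h7; rewrite mul1r; move: ((f k).+1%:R^-1) (sqnormB _ _ (u n - w))
  (sqnormB _ _ (u n - u (f k))) (sqnormB _ _ (u (f k) - w)) (sqnormB _ _ (u (f k) - s (f k)))
  (sqnormB _ _ (s (f k) - w)).
by clear => x1 x2 x3 x4 x5 x6; lra.
Qed.

End L2B_complete.

Section L2B_map.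
Context (R : realType) (T : R) (V V' : lmodType R) (X : Defs.space V) (Y : Defs.space V').
Hypotheses (hX : seminormed X) (hY : seminormed Y).

Lemma inL2B_map (L : V -> V') (C : R) u :
  (forall p, carrier X p -> carrier Y (L p)) ->
  (forall p, carrier X p -> snorm Y (L p) <= C * snorm X p) ->
  (forall p q, carrier X p -> carrier X q -> snorm Y (L p - L q) <= C * snorm X (p - q)) ->
  inL2B T X u -> inL2B T Y (fun t => L (u t)).
Proof.
move=> cL nL dL hu; have /(inL2BP _ hX)[su ui] := hu.
have sL : strongly_measurable T Y (fun t => L (u t)).
  apply: (sm_map (C := C) (sn_closed hX) (sn_closed hY) cL _ su) => p q hp hq.
  by rewrite dL// andbT (sn_ge0 hY)//; apply: (lin_closedB (sn_closed hY)); exact: cL.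
apply: (inL2B_le hY sL (integrableZ (@mD R T) (C ^+ 2) ui)) => t tT.
have ct := su.1 t tT; have h0 := sn_ge0 hY (cL _ ct); have h := nL _ ct.
by rewrite -exprMn lerXn2r ?nnegrE//; exact: le_trans h.
Qed.

End L2B_map.

(** * The weak formulation integrated in time *)

Lemma mul_le_sq (R : realType) (x y : R) : 0 <= x -> 0 <= y -> x * y <= x ^+ 2 + y ^+ 2.
Proof.
by have := sqr_ge0 (x - y); have := sqr_ge0 x; have := sqr_ge0 y; rewrite sqrrB; lra.
Qed.

Section ipB.
Context (R : realType) (Omega : set (point3 R)) (T : R).
Local Notation P3 := (point3 (measurableTypeR R)).
Local Notation D := (`]0%R, T[%classic : set (measurableTypeR R)).
Hypothesis oO : open Omega.
Hypothesis bO : bounded_set Omega.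
Let mO : measurable (Omega : set P3) := open_measurable3 oO.
Let mu : {measure set (measurableTypeR R) -> \bar R} := leb R.
Let L2c := inL2_closed mO.
Let ips := ip_sip mO.
Implicit Types u v w : R -> vfield R.

Local Opaque ip inL2 wcurl.

Lemma L2_seminormed : seminormed (L2 Omega).
Proof. exact: semi_ip_seminormed ips. Qed.

Lemma Hcurl_seminormed : seminormed (Hcurl Omega).
Proof. exact: (semi_ip_seminormed (ip_curl_sip oO bO)). Qed.

Lemma H0curl_seminormed : seminormed (H0curl Omega).
Proof.
have hH := Hcurl_seminormed; split.
- exact: inH0curl_closed.
- by move=> u hu; exact: (sn_ge0 hH hu.1).
- by move=> u v hu hv; exact: (snD hH hu.1 hv.1).
- by move=> a u hu; exact: (snZ hH a hu.1).
Qed.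

Let hL := L2_seminormed.
Let hB := inL2B_closed T hL.

Lemma snorm_L2_sq (p : vfield R) : inL2 Omega p -> snorm (L2 Omega) p ^+ 2 = ip Omega p p.
Proof. by move=> hp; rewrite sqr_sqrtr//; exact: (sip_ge0 ips hp). Qed.

Lemma L2B_inL2 u t : inL2B T (L2 Omega) u -> 0 < t < T -> inL2 Omega (u t).
Proof. exact: inL2B_carrier. Qed.

Lemma ip_cvg (p q : vfield R) (s r : nat -> vfield R) :
  inL2 Omega p -> inL2 Omega q -> (forall n, inL2 Omega (s n)) -> (forall n, inL2 Omega (r n)) ->
  (fun n => snorm (L2 Omega) (p - s n)) @ \oo --> (0 : R) ->
  (fun n => snorm (L2 Omega) (q - r n)) @ \oo --> (0 : R) ->
  (fun n => ip Omega (s n) (r n)) @ \oo --> ip Omega p q.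
Proof.
move=> hp hq hs hr ps qr; apply/cvgrPdist_lt => e e0.
pose a := snorm (L2 Omega) p; pose b := snorm (L2 Omega) q.
have lim : (fun n => (a + b + snorm (L2 Omega) (q - r n)) * snorm (L2 Omega) (p - s n) +
    a * snorm (L2 Omega) (q - r n)) @ \oo --> (a + b + 0) * 0 + a * 0.
  apply: cvgD; last by apply: cvgM; [exact: cvg_cst|exact: qr].
  by apply: cvgM; [apply: cvgD; [exact: cvg_cst|exact: qr]|exact: ps].
rewrite !mulr0 addr0 in lim.
move: lim => /cvgr0Pnorm_lt/(_ e e0); apply: filterS => n h; apply: le_lt_trans h.
apply: le_trans (ler_norm _).
have d1 := lin_closedB L2c hp (hs n); have d2 := lin_closedB L2c hq (hr n).
have E : ip Omega p q - ip Omega (s n) (r n) = ip Omega (p - s n) (r n) + ip Omega p (q - r n).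
  rewrite (sipBl ips hp (hs n) (hr n)) (sipBr ips hq (hr n) hp).
  by rewrite [RHS]addrC addrA subrK.
rewrite E; apply: (le_trans (ler_normD _ _)).
have c1 := sip_cauchy_schwarz ips d1 (hr n); have c2 := sip_cauchy_schwarz ips hp d2.
have a0 := sn_ge0 hL hp; have b0 := sn_ge0 hL hq; have p0 := sn_ge0 hL d1.
have q0 := sn_ge0 hL d2; have r0 := sn_ge0 hL (hr n).
have rn : snorm (L2 Omega) (r n) <= a + b + snorm (L2 Omega) (q - r n).
  have := sn_dist hL hq (hr n); rewrite ler_norml -/b => /andP[h _]; move: h.
  by rewrite lerNl opprB lerBlDr => h; apply: (le_trans h); rewrite -addrA (addrC b) lerDr.
apply: lerD; last exact: c2.
by apply: (le_trans c1); rewrite mulrC; exact: (ler_wpM2r p0 rn).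
Qed.

Lemma ip_sm_measurable u v : strongly_measurable T (L2 Omega) u ->
  strongly_measurable T (L2 Omega) v -> measurable_fun D (fun t => ip Omega (u t) (v t)).
Proof.
exact: (sm_measurable2 (X := L2 Omega) (Y := L2 Omega) (F := ip Omega) L2c L2c ip_cvg).
Qed.

Lemma ip_L2B_integrable u v : inL2B T (L2 Omega) u -> inL2B T (L2 Omega) v ->
  mu.-integrable D (EFin \o (fun t => ip Omega (u t) (v t))).
Proof.
move=> hu hv; have /(inL2BP _ hL)[su ui] := hu; have /(inL2BP _ hL)[sv vi] := hv.
apply: (integrable_le (@mD R T) (ip_sm_measurable su sv) (integrable_add (@mD R T) ui vi)).
move=> t; rewrite D_itv => tT; have ct := L2B_inL2 hu tT; have dt := L2B_inL2 hv tT.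
apply: (le_trans (sip_cauchy_schwarz ips ct dt)).
have a0 := sn_ge0 hL ct; have b0 := sn_ge0 hL dt.
exact: (mul_le_sq a0 b0).
Qed.

Definition ipB u v : R := \int[leb R]_(t in `]0, T[) ip Omega (u t) (v t).

Lemma ipB_sip : semi_ip (inL2B T (L2 Omega)) ipB.
Proof.
split.
- exact: hB.
- move=> a u v w hu hv hw; rewrite /ipB.
  rewrite -(Rintegral_lin (@mD R T) _ (ip_L2B_integrable hu hw) (ip_L2B_integrable hv hw)).
  apply: eq_Rintegral => t /set_mem; rewrite D_itv => tT.
  exact: (sip_linear ips a (L2B_inL2 hu tT) (L2B_inL2 hv tT) (L2B_inL2 hw tT)).
- move=> u v hu hv; apply: eq_Rintegral => t /set_mem; rewrite D_itv => tT.
  exact: (sip_sym ips (L2B_inL2 hu tT) (L2B_inL2 hv tT)).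
- move=> u hu; apply: Rintegral_ge0 => t; rewrite D_itv => tT.
  exact: (sip_ge0 ips (L2B_inL2 hu tT)).
Qed.

Lemma ipB_sqnorm u : inL2B T (L2 Omega) u -> ipB u u = sqnormB T (L2 Omega) u.
Proof.
move=> hu; apply: eq_Rintegral => t /set_mem; rewrite D_itv => tT.
by rewrite (snorm_L2_sq (L2B_inL2 hu tT)).
Qed.

Lemma ipB_cvg (u : nat -> R -> vfield R) w v : (forall n, inL2B T (L2 Omega) (u n)) ->
  inL2B T (L2 Omega) w -> inL2B T (L2 Omega) v ->
  (fun n => sqnormB T (L2 Omega) (u n - w)) @ \oo --> (0 : R) ->
  (fun n => ipB (u n) v) @ \oo --> ipB w v.
Proof.
move=> hu hw hv uw; apply/cvgrPdist_lt => e e0.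
pose c := sqnormB T (L2 Omega) v.
have c0 : 0 <= c by exact: sqnormB_ge0.
have q0 : 0 < e ^+ 2 / (c + 1) by rewrite divr_gt0 ?exprn_gt0// ltr_wpDl.
move: uw => /cvgr0Pnorm_lt/(_ _ q0); apply: filterS => n.
have d := lin_closedB hB (hu n) hw.
rewrite (ger0_norm (sqnormB_ge0 _ _ _)) ltr_pdivlMr ?ltr_wpDl// => h.
have -> : ipB w v - ipB (u n) v = - ipB (u n - w) v.
  by rewrite (sipBl ipB_sip (hu n) hw hv) opprB.
rewrite normrN; apply: (le_lt_trans (sip_cauchy_schwarz ipB_sip d hv)).
rewrite (ipB_sqnorm d) (ipB_sqnorm hv) -/c.
have sq := mulr_ge0 (sqrtr_ge0 (sqnormB T (L2 Omega) (u n - w))) (sqrtr_ge0 c).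
rewrite -(@ltr_pXn2r _ 2)//; last by rewrite nnegrE ltW.
rewrite exprMn.
clearbody c; have := sqnormB_ge0 T (L2 Omega) (u n - w); move: h sq; move: (sqnormB _ _ _) => x h sq x0.
rewrite (sqr_sqrtr x0) (sqr_sqrtr c0).
apply: (le_lt_trans _ h).
apply: ler_wpM2l; first exact: x0.
by rewrite lerDl.
Qed.

Lemma app_L2B A u : Linfty Omega A -> inL2B T (L2 Omega) u ->
  inL2B T (L2 Omega) (fun t => app A (u t)).
Proof.
move=> hA; have [C [C0 hC]] := app_inL2 mO hA.
have bd (p : vfield R) : inL2 Omega p -> snorm (L2 Omega) (app A p) <= Num.sqrt C * snorm (L2 Omega) p.
  move=> hp; have [h1 h2] := hC p hp.
  rewrite -sqrtrM// ler_sqrt//; apply: mulr_ge0 => //; exact: (sip_ge0 ips hp).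
apply: (inL2B_map (C := Num.sqrt C) hL hL) => [p hp|p hp|p q hp hq]; first exact: (hC p hp).1.
  exact: bd.
have -> : app A p - app A q = app A (p - q).
  by rewrite (addrC p) -scaleN1r app_lin scaleN1r addrC.
by apply: bd; exact: (lin_closedB L2c hp hq).
Qed.

Lemma snorm_wcurl (p : vfield R) : inHcurl Omega p ->
  snorm (L2 Omega) (wcurl Omega p) <= snorm (Hcurl Omega) p.
Proof.
move=> hp; have h0 := sip_ge0 ips hp.1; have h1 := sip_ge0 ips (wcurl_inL2 hp).
by rewrite /= /Hcurl_norm ler_sqrt ?addr_ge0// lerDr.
Qed.

Lemma snorm_Hcurl (p : vfield R) : inHcurl Omega p ->
  snorm (L2 Omega) p <= snorm (Hcurl Omega) p.
Proof.
move=> hp; have h0 := sip_ge0 ips hp.1; have h1 := sip_ge0 ips (wcurl_inL2 hp).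
by rewrite /= /Hcurl_norm ler_sqrt ?addr_ge0// lerDl.
Qed.

Lemma curlB_L2B z : inZ Omega T z -> inL2B T (L2 Omega) (curlB Omega z).
Proof.
move=> hz; apply: (inL2B_map (C := 1) Hcurl_seminormed hL _ _ _ hz) => [p|p|p q] hp.
- exact: wcurl_inL2.
- by rewrite mul1r; exact: snorm_wcurl.
- move=> hq; rewrite mul1r; have hpq := lin_closedB (inHcurl_closed oO bO) hp hq.
  apply: le_trans (snorm_wcurl hpq).
  by rewrite /= (ip_wcurl_sqB oO bO hp hq).
Qed.

Lemma Z_L2B z : inZ Omega T z -> inL2B T (L2 Omega) z.
Proof.
move=> hz; apply: (inL2B_map (C := 1) (L := id) Hcurl_seminormed hL _ _ _ hz) => [p|p|p q] hp.
- exact: hp.1.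
- by rewrite mul1r; exact: snorm_Hcurl.
- by move=> hq; rewrite mul1r; apply: snorm_Hcurl; exact: (lin_closedB (inHcurl_closed oO bO) hp hq).
Qed.

Lemma sqnormB_Hcurl z : inZ Omega T z ->
  sqnormB T (Hcurl Omega) z = sqnormB T (L2 Omega) z + sqnormB T (L2 Omega) (curlB Omega z).
Proof.
move=> hz; have h1 := Z_L2B hz; have h2 := curlB_L2B hz.
rewrite -(ipB_sqnorm h1) -(ipB_sqnorm h2) /ipB.
rewrite -(RintegralD (@mD R T) (ip_L2B_integrable h1 h1) (ip_L2B_integrable h2 h2)).
apply: eq_Rintegral => t /set_mem; rewrite D_itv => tT.
have ht := inL2B_carrier hz tT; rewrite /= /Hcurl_norm sqr_sqrtr//.
by apply: addr_ge0; apply: (sip_ge0 ips); [exact: ht.1|exact: wcurl_inL2].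
Qed.

(** Pairing [u] with [below b p] under [ipB] integrates [ip Omega (u s) p] over the times before
    [b]. An equation integrated in time thus consists of continuous linear functionals of [u]. *)
Definition below (b : R) (p : vfield R) : R -> vfield R := fun s => (s < b)%R%:R *: p.

Lemma below_indic b p : below b p = fun s => (\1_(`]-oo, b[%classic) s : R) *: p.
Proof.
apply/funext => s; rewrite /below indicE; congr (_%:R *: _); congr nat_of_bool.
by apply/idP/idP; rewrite inE /= in_itv.
Qed.

Lemma cst_L2B p : inL2 Omega p -> inL2B T (L2 Omega) (fun=> p).
Proof.
move=> hp; apply: (inL2B_bounded (M := snorm (L2 Omega) p) hL (sm_cst T hL hp)).
by move=> t _; exact: lexx.
Qed.

Lemma below_L2B b p : inL2 Omega p -> inL2B T (L2 Omega) (below b p).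
Proof.
move=> hp; rewrite below_indic; apply: (inL2B_indic hL _ (cst_L2B hp)).
exact: measurable_itv.
Qed.

Lemma ipB_below b p u : inL2 Omega p -> inL2B T (L2 Omega) u ->
  ipB u (below b p) = \int[leb R]_(s in `]0, T[) ((s < b)%R%:R * ip Omega (u s) p).
Proof.
move=> hp hu; apply: eq_Rintegral => t /set_mem; rewrite D_itv => tT.
by rewrite /below (sipZr ips _ hp (L2B_inL2 hu tT)).
Qed.

Lemma belowD b p q c : below b (c *: p + q) = c *: below b p + below b q.
Proof.
apply/funext => s; rewrite -[(c *: below b p + below b q) s]/(c *: below b p s + below b q s).
by rewrite /below scalerDr !scalerA mulrC.
Qed.

End ipB.

(** * Time derivatives in the dual and their integrated form *)

Section weak.
Context (R : realType) (Omega : set (point3 R)) (T : R).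
Local Notation P3 := (point3 (measurableTypeR R)).
Local Notation D := (`]0%R, T[%classic : set (measurableTypeR R)).
Hypothesis oO : open Omega.
Hypothesis T0 : 0 < T.
Let mO : measurable (Omega : set P3) := open_measurable3 oO.
Let mu : {measure set (measurableTypeR R) -> \bar R} := leb R.
Let L2c := inL2_closed mO.
Let ips := ip_sip mO.
Let hL := L2_seminormed oO.

Local Opaque ip inL2 wcurl sqnormB ipB.

Section CB.
Context (u : R -> vfield R) (hu : inCB T (L2 Omega) u).

Lemma inCB_delta t0 : 0 <= t0 <= T -> forall e, 0 < e -> exists2 d, 0 < d &
  forall s, 0 <= s <= T -> `|s - t0| < d -> snorm (L2 Omega) (u s - u t0) < e.
Proof.
move=> t0T e e0; have /cvgr0Pnorm_lt/(_ e e0) := hu.2 t0 t0T.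
rewrite near_withinE => /nbhs_ballP[d /= d0 hd]; exists d; [exact: d0|] => s sT sd.
apply: le_lt_trans (ler_norm _) (hd s _ _); first by rewrite /ball/= distrC.
by rewrite /= in_itv.
Qed.

Lemma inCB_sm : strongly_measurable T (L2 Omega) u.
Proof.
apply: (sm_continuous T0 hL hu.1) => t tT e e0.
have [d d0 hd] := inCB_delta tT e0; exists d; [exact: d0|] => s sT sd.
by rewrite (snB hL (hu.1 t tT) (hu.1 s sT)); exact: hd.
Qed.

Lemma inCB_L2B : inL2B T (L2 Omega) u.
Proof.
have cn : {within `[0, T], continuous (fun t => snorm (L2 Omega) (u t))}.
  apply/within_continuousP => t tT e e0; have [d d0 hd] := inCB_delta tT e0.
  exists d; [exact: d0|] => s sT sd; apply: le_lt_trans (hd s sT sd).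
  exact: (sn_dist hL (hu.1 s sT) (hu.1 t tT)).
have [M hM] := continuous_bounded_oo cn.
apply: (inL2B_bounded (M := M) hL inCB_sm) => t tT.
by apply: le_trans (ler_norm _) (hM t _); rewrite D_itv.
Qed.

Lemma inCB_ip_continuous p : inL2 Omega p ->
  {within `[0, T], continuous (fun t => ip Omega (u t) p)}.
Proof.
move=> hp; apply/within_continuousP => t tT e e0.
pose c := snorm (L2 Omega) p.
have c0 : 0 <= c by exact: (sn_ge0 hL hp).
have q0 : 0 < e / (c + 1) by rewrite divr_gt0// ltr_wpDl.
have [d d0 hd] := inCB_delta tT q0; exists d; [exact: d0|] => s sT sd.
have cs := hu.1 s sT; have ct := hu.1 t tT; have := hd s sT sd.
rewrite ltr_pdivlMr ?ltr_wpDl// => h; apply: le_lt_trans h.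
rewrite -(sipBl ips cs ct hp).
apply: (le_trans (sip_cauchy_schwarz ips (lin_closedB L2c cs ct) hp)).
apply: ler_wpM2l; first exact: sqrtr_ge0.
by rewrite -[X in X <= _]/c lerDl.
Qed.

End CB.

Lemma inCB_lin a u v : inCB T (L2 Omega) u -> inCB T (L2 Omega) v ->
  inCB T (L2 Omega) (a *: u + v).
Proof.
move=> hu hv; split.
  by move=> t tT; exact: (lin_closedP L2c a (hu.1 t tT) (hv.1 t tT)).
move=> t tT; apply/cvgr0Pnorm_lt => e e0.
have q0 : 0 < e / (`|a| + 1) by rewrite divr_gt0// ltr_wpDl.
have e2 : 0 < e / 2 by rewrite divr_gt0.
have q2 : 0 < e / 2 / (`|a| + 1) by rewrite divr_gt0// ltr_wpDl.
have [d1 d10 h1] := inCB_delta hu tT q2; have [d2 d20 h2] := inCB_delta hv tT e2.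
rewrite near_withinE; apply/nbhs_ballP; exists (Num.min d1 d2); first by rewrite /= lt_min d10.
move=> s; rewrite /ball/= lt_min distrC => /andP[s1 s2]; rewrite in_itv/= => sT.
have [cus cut cvs cvt] := And4 (hu.1 s sT) (hu.1 t tT) (hv.1 s sT) (hv.1 t tT).
have B1 := lin_closedB L2c cus cut; have B2 := lin_closedB L2c cvs cvt.
have -> : (a *: u + v) s - (a *: u + v) t = a *: (u s - u t) + (v s - v t).
  rewrite -[(a *: u + v) s]/(a *: u s + v s) -[(a *: u + v) t]/(a *: u t + v t).
  by rewrite opprD addrACA scalerBr.
have aB := lin_closedZ L2c a B1.
rewrite ger0_norm; last exact: (sn_ge0 hL (lin_closedD L2c aB B2)).
apply: (le_lt_trans (snD hL aB B2)); rewrite (snZ hL a B1).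
have k1 := h1 s sT s1; have k2 := h2 s sT s2; rewrite ltr_pdivlMr ?ltr_wpDl// in k1.
have p0 := sn_ge0 hL B1.
have k3 : `|a| * snorm (L2 Omega) (u s - u t) <= snorm (L2 Omega) (u s - u t) * (`|a| + 1).
  by rewrite mulrC ler_wpM2l// lerDl.
by apply: (lt_le_trans (ltrD (le_lt_trans k3 k1) k2)); rewrite -splitr.
Qed.

Section pairing.
Context (X : Defs.space (vfield R)) (kap : vfield R -> vfield R).
Hypothesis hX : seminormed X.
Hypothesis kL2 : forall p, carrier X p -> inL2 Omega (kap p).
Hypothesis kle : forall p, carrier X p -> snorm (L2 Omega) (kap p) <= snorm X p.
Hypothesis klin : forall a p q w, carrier X p -> carrier X q -> inL2 Omega w ->
  ip Omega w (kap (a *: p + q)) = a * ip Omega w (kap p) + ip Omega w (kap q).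

Let pr (w : vfield R) : vfield R -> R^o := fun p => ip Omega w (kap p).

Let pr_dual w : inL2 Omega w -> carrier (dual X) (pr w).
Proof.
move=> hw; split; first by move=> a p q hp hq; exact: klin.
exists (snorm (L2 Omega) w) => p hp.
apply: (le_trans (sip_cauchy_schwarz ips hw (kL2 hp))).
by apply: ler_wpM2l; [exact: sqrtr_ge0|exact: kle].
Qed.

Let pr_norm w G : inL2 Omega w -> carrier (dual X) G -> (forall p, carrier X p -> G p = pr w p) ->
  snorm (dual X) G <= 1 * snorm (L2 Omega) w.
Proof.
move=> hw hG GE; apply: (dual_norm_ub hX hG) => p hp p1; rewrite GE// mul1r.
apply: (le_trans (sip_cauchy_schwarz ips hw (kL2 hp))).
rewrite -[leRHS]mulr1; apply: ler_wpM2l; first exact: sqrtr_ge0.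
exact: le_trans (kle hp) p1.
Qed.

(** [kap] will be the identity or [wcurl Omega]. The functional depends on [u t] in a Lipschitz way,
    and the linearity of [kap] enters only after pairing with a field, because the curl is linear up
    to null sets. *)
Lemma pairing_L2B u : inL2B T (L2 Omega) u ->
  inL2B T (dual X) (fun t => (fun p => ip Omega (u t) (kap p)) : vfield R -> R^o).
Proof.
move=> hu; apply: (inL2B_map (C := 1) (L := pr) hL (dual_seminormed hX) _ _ _ hu).
- exact: pr_dual.
- by move=> p hp; apply: (pr_norm hp (pr_dual hp)).
- move=> p q hp hq; apply: (pr_norm (lin_closedB L2c hp hq)).
    exact: (lin_closedB (dual_closed X) (pr_dual hp) (pr_dual hq)).
  by move=> x hx; rewrite /pr (sipBl ips hp hq (kL2 hx)).
Qed.

End pairing.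

Section H1dual.
Context (X : Defs.space (vfield R)) (hX : seminormed X).

Lemma dual_eval_measurable (G : R -> vfield R -> R^o) p : inL2B T (dual X) G ->
  carrier X p -> measurable_fun D (fun t => G t p : R).
Proof.
move=> hG hp; have hd := dual_seminormed hX.
have /(inL2BP _ hd)[sG _] := hG.
apply: (sm_measurable2 (F := fun (H : vfield R -> R^o) (_ : vfield R -> R^o) => H p : R)
  (sn_closed hd) (sn_closed hd) _ sG sG).
move=> H _ s _ hH _ hs _ Hs _; apply/cvgrPdist_lt => e e0.
have q0 : 0 < e / (snorm X p + 1) by rewrite divr_gt0// ltr_wpDl// (sn_ge0 hX hp).
move: Hs => /cvgr0Pnorm_lt/(_ _ q0); apply: filterS => n.
have hHs := lin_closedB (sn_closed hd) hH (hs n).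
rewrite ger0_norm; last exact: (sn_ge0 hd hHs).
rewrite ltr_pdivlMr; last by rewrite ltr_wpDl// (sn_ge0 hX hp).
move=> h; apply: le_lt_trans h; apply: (le_trans (dual_norm_le hX hHs hp)).
apply: ler_wpM2l; first exact: (sn_ge0 hd hHs).
by rewrite lerDl.
Qed.

Lemma dual_eval_integrable (G : R -> vfield R -> R^o) p : inL2B T (dual X) G ->
  carrier X p -> mu.-integrable D (EFin \o (fun t => G t p : R)).
Proof.
move=> hG hp; have hd := dual_seminormed hX.
have /(inL2BP _ hd)[sG Gi] := hG.
apply: (integrable_le (@mD R T) (dual_eval_measurable hG hp)
  (integrable_add (@mD R T) Gi (integrable_cstD T (snorm X p ^+ 2)))).
move=> t; rewrite D_itv => tT; have ct := sG.1 t tT.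
apply: (le_trans (dual_norm_le hX ct hp)).
exact: (mul_le_sq (sn_ge0 hd ct) (sn_ge0 hX hp)).
Qed.

(** This is [du_bois_reymond] for the evaluation at [p]. Continuity in time yields the identity for
    every [b], although the equation for [dl] holds almost everywhere. *)
Lemma H1dual_integrated l dl (h : R -> R) p : H1dual_deriv T X l dl -> carrier X p ->
  {within `[0, T], continuous (fun t => l t p : R)} ->
  mu.-integrable D (EFin \o h) ->
  {ae mu, forall t : measurableTypeR R, 0 < t < T -> dl t p = h t} ->
  forall b, 0 < b < T ->
    l b p = l 0 p + \int[leb R]_(s in `]0, T[) ((s < b)%R%:R * h s).
Proof.
move=> [hl hdl hder] hp cl hi ldh b bT.
apply: (du_bois_reymond cl hi _ bT) => eta teta.
rewrite (hder p hp eta teta); congr (- _).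
have meta : measurable_fun D eta.
  apply: measurable_funTS; apply: continuous_measurable_fun.
  exact: smooth_continuous teta.1.
apply: (@ae_eq_Rintegral _ (measurableTypeR R) R mu D (@mD R T)).
- by apply: measurable_funM => //; exact: dual_eval_measurable.
- by apply: measurable_funM => //; exact: (integrable_measurable hi).
- by apply: (ae_imp ldh) => t ht; rewrite D_itv => tT; rewrite ht.
Qed.

(** The constant [c p] disappears because the derivative of a test function has integral 0; what is
    left is integration by parts for a primitive. *)
Lemma integrated_H1dual l dl (c : vfield R -> R) : inL2B T (dual X) l -> inL2B T (dual X) dl ->
  (forall p, carrier X p -> forall b, 0 < b < T ->
    l b p = c p + \int[leb R]_(s in `]0, T[) ((s < b)%R%:R * (dl s p : R))) ->
  H1dual_deriv T X l dl.
Proof.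
move=> hl hdl hldl; split=> // p hp eta teta.
have li := dual_eval_integrable hl hp; have dli := dual_eval_integrable hdl hp.
have cd := smooth_continuous (smooth_derive1 teta.1).
have md : measurable_fun D (derive1 eta).
  by apply: measurable_funTS; exact: continuous_measurable_fun.
have bd : exists M, forall x, D x -> `|derive1 eta x| <= M.
  by apply: continuous_bounded_oo; exact: continuous_subspaceT.
have di : mu.-integrable D (EFin \o derive1 eta).
  by apply: continuous_integrable_oo; exact: continuous_subspaceT.
have lci := integrable_lin (@mD R T) (-1) (integrable_cstD T (c p)) li.
have lcdi := integrable_mul_bounded (@mD R T) md bd lci.
rewrite -(integral_primitive_parts dli teta).
transitivity (\int[mu]_(t in D) (c p * derive1 eta t + derive1 eta t * (-1 * cst (c p) t + l t p))).
  by apply: eq_Rintegral => t _; rewrite /=; ring.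
rewrite (Rintegral_lin (@mD R T) (c p) di lcdi) (Rintegral_derive1 T0 (smooth_derivable teta.1) cd).
rewrite !(test_fun_out teta) ?ltxx ?andbF// subrr mulr0 add0r.
apply: eq_Rintegral => t /set_mem; rewrite D_itv => tT; rewrite mulrC; congr (_ * _).
by rewrite (hldl p hp t tT) /= mulN1r addKr.
Qed.

End H1dual.

End weak.

Section integrated.
Context (R : realType) (Omega : set (point3 R)) (T : R).
Local Notation P3 := (point3 (measurableTypeR R)).
Local Notation D := (`]0%R, T[%classic : set (measurableTypeR R)).
Hypothesis oO : open Omega.
Hypothesis bO : bounded_set Omega.
Hypothesis T0 : 0 < T.
Let mO : measurable (Omega : set P3) := open_measurable3 oO.
Let leb1 : {measure set (measurableTypeR R) -> \bar R} := leb R.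
Let L2c := inL2_closed mO.
Let ips := ip_sip mO.
Let hL := L2_seminormed oO.
Let hB := inL2B_closed T hL.
Let ipBs := ipB_sip T oO.

Local Opaque ip inL2 wcurl sqnormB ipB.

Context (eps mu sigma : tensor3 R).
Hypothesis heps : Linfty Omega eps.
Hypothesis hmui : Linfty Omega (tinv mu).
Hypothesis hsigma : Linfty Omega sigma.

(* The weak formulation integrated over ]0, b[, in which no time derivative
   occurs. *)
Definition integrated_solution (E0 B0 : vfield R) (f E B : R -> vfield R) :=
  [/\ inCB T (L2 Omega) E /\ inCB T (L2 Omega) B,
    forall psi, carrier (H0curl Omega) psi -> forall b, 0 < b < T ->
      ip Omega (app eps (E b)) psi = ip Omega (app eps E0) psi +
        (ipB Omega T (f - (fun t => app sigma (E t))) (below b psi) +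
         ipB Omega T (fun t => app (tinv mu) (B t)) (below b (wcurl Omega psi))),
    forall phi, carrier (Hcurl Omega) phi -> forall b, 0 < b < T ->
      ip Omega (B b) phi = ip Omega B0 phi - ipB Omega T E (below b (wcurl Omega phi)),
    eq_aeL2 Omega (E 0) E0 & eq_aeL2 Omega (B 0) B0].

Lemma ipB_below_pair G M p q b : inL2B T (L2 Omega) G -> inL2B T (L2 Omega) M ->
  inL2 Omega p -> inL2 Omega q ->
  \int[leb R]_(s in `]0, T[) ((s < b)%R%:R * (ip Omega (G s) p + ip Omega (M s) q)) =
  ipB Omega T G (below b p) + ipB Omega T M (below b q).
Proof.
move=> hG hM hp hq.
have i1 := ip_L2B_integrable oO hG (below_L2B T oO b hp).
have i2 := ip_L2B_integrable oO hM (below_L2B T oO b hq).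
rewrite (ipB_below oO b hp hG) (ipB_below oO b hq hM).
have e1 : {in D, (fun s => ip Omega (G s) (below b p s)) =1 (fun s => (s < b)%R%:R * ip Omega (G s) p)}.
  by move=> s /set_mem; rewrite D_itv => sT; rewrite /below (sipZr ips _ hp (L2B_inL2 hG sT)).
have e2 : {in D, (fun s => ip Omega (M s) (below b q s)) =1 (fun s => (s < b)%R%:R * ip Omega (M s) q)}.
  by move=> s /set_mem; rewrite D_itv => sT; rewrite /below (sipZr ips _ hq (L2B_inL2 hM sT)).
rewrite -(eq_Rintegral leb1 e1) -(eq_Rintegral leb1 e2) -(RintegralD (@mD R T) i1 i2).
by apply: eq_Rintegral => s sD; rewrite (e1 s sD) (e2 s sD) mulrDr.
Qed.

Lemma rhs_L2B f E : inL2B T (L2 Omega) f -> inL2B T (L2 Omega) E ->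
  inL2B T (L2 Omega) (f - (fun t => app sigma (E t))).
Proof. by move=> hf hE; apply: (lin_closedB hB hf); exact: (app_L2B oO hsigma hE). Qed.

Lemma weak_integrated E0 B0 f E B : inL2 Omega E0 -> inL2 Omega B0 -> inL2B T (L2 Omega) f ->
  weak_solution Omega T eps mu sigma E0 B0 f E B -> integrated_solution E0 B0 f E B.
Proof.
move=> hE0 hB0 hf [[cE cB] [dE [dEder dEeq]] [dB [dBder dBeq]] eE0 eB0].
have LE := inCB_L2B oO T0 cE; have LB := inCB_L2B oO T0 cB.
have LG := rhs_L2B hf LE; have LM := app_L2B oO hmui LB.
have z0T : (0 : R) <= 0 <= T by apply/andP; split => //; exact: ltW.
split=> // [psi hpsi b bT|phi hphi b bT].
  have hp : inL2 Omega psi := hpsi.1.1; have hw := wcurl_inL2 hpsi.1.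
  have [C [_ hC]] := app_inL2 mO (Linfty_tr heps); have hep := (hC psi hp).1.
  pose h t := ip Omega ((f - (fun t => app sigma (E t))) t) psi +
     ip Omega (app (tinv mu) (B t)) (wcurl Omega psi).
  have hi : leb1.-integrable D (EFin \o h).
    apply: (integrable_add (@mD R T)).
      exact: (ip_L2B_integrable oO LG (cst_L2B T oO hp)).
    exact: (ip_L2B_integrable oO LM (cst_L2B T oO hw)).
  have cl : {within `[0, T], continuous (fun t => ip Omega (app eps (E t)) psi)}.
    (* Moving [eps] to the test function by transposition reduces the claim to the continuity of
       [E]. *)
    rewrite (_ : (fun t => _) = (fun t => ip Omega (E t) (app (fun x => (eps x)^T) psi))).
      exact: (inCB_ip_continuous oO cE hep).
    by apply/funext => t; rewrite ip_tr.
  rewrite (H1dual_integrated (H0curl_seminormed oO bO) dEder hpsi cl hi _ bT).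
    rewrite /h (ipB_below_pair b LG LM hp hw); congr (_ + _).
    rewrite !ip_tr; apply: (eq_aeL2_ip mO) => //; exact: cE.1.
  apply: (@ae_imp _ (measurableTypeR R) R leb1 _ _ dEeq) => t ht tT.
  have := ht tT psi hpsi; have hsE : inL2 Omega (app sigma (E t)).
    by have := L2B_inL2 (app_L2B oO hsigma LE) tT.
  rewrite /h -[(f - _) t]/(f t - app sigma (E t)) (sipBl ips (L2B_inL2 hf tT) hsE hp) => <-.
  by rewrite addrAC subrK addrK.
have hp : inL2 Omega phi := hphi.1; have hw := wcurl_inL2 hphi.
pose h t := - ip Omega (E t) (wcurl Omega phi).
have hi0 := ip_L2B_integrable oO LE (cst_L2B T oO hw).
have hi : leb1.-integrable D (EFin \o h).
  have := integrableZ (@mD R T) (-1) hi0; congr (_.-integrable D (EFin \o _)).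
  by apply/funext => t; rewrite mulN1r.
have cl := inCB_ip_continuous oO cB hp.
rewrite (H1dual_integrated (Hcurl_seminormed oO bO) dBder hphi cl hi _ bT).
  congr (_ + _); first by apply: (eq_aeL2_ip mO) => //; exact: cB.1.
  have LN := lin_closedN hB LE.
  rewrite -mulN1r -(sipZl ipBs _ LE (below_L2B T oO b hw)) scaleN1r (ipB_below oO b hw LN).
  apply: eq_Rintegral => s /set_mem; rewrite D_itv => sT; congr (_ * _).
  have -> : (- E) s = -1 *: E s by rewrite scaleN1r.
  by rewrite (sipZl ips _ (L2B_inL2 LE sT) hw) mulN1r.
apply: (@ae_imp _ (measurableTypeR R) R leb1 _ _ dBeq) => t ht tT.
by have /eqP := ht tT phi hphi; rewrite addr_eq0 => /eqP.
Qed.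

Lemma integrated_weak E0 B0 f E B : inL2B T (L2 Omega) f ->
  integrated_solution E0 B0 f E B -> weak_solution Omega T eps mu sigma E0 B0 f E B.
Proof.
move=> hf [[cE cB] hE hBe eE0 eB0].
have LE := inCB_L2B oO T0 cE; have LB := inCB_L2B oO T0 cB.
have LG := rhs_L2B hf LE; have LM := app_L2B oO hmui LB.
have h0 := H0curl_seminormed oO bO; have hc := Hcurl_seminormed oO bO.
have wlin a p q w : inHcurl Omega p -> inHcurl Omega q -> inL2 Omega w ->
    ip Omega w (wcurl Omega (a *: p + q)) =
    a * ip Omega w (wcurl Omega p) + ip Omega w (wcurl Omega q).
  move=> hp hq hw; have cp := wcurl_inL2 hp; have cq := wcurl_inL2 hq.
  have cpq := wcurl_inL2 (lin_closedP (inHcurl_closed oO bO) a hp hq).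
  rewrite (sip_sym ips hw cpq) (ip_wcurl_lin oO bO a hp hq hw).
  by rewrite (sip_sym ips cp hw) (sip_sym ips cq hw).
have idlin a p q w : inL2 Omega p -> inL2 Omega q -> inL2 Omega w ->
    ip Omega w (a *: p + q) = a * ip Omega w p + ip Omega w q.
  move=> hp hq hw; rewrite (sipDr ips (lin_closedZ L2c a hp) hq hw).
  by rewrite (sipZr ips a hp hw).
split=> //.
(* The derivative in the dual is defined to be what the equation prescribes, so the equation holds
   at every time by construction. *)
- pose dE := (fun t => (fun p => ip Omega ((f - (fun t => app sigma (E t))) t) p) : vfield R -> R^o) +
     (fun t => (fun p => ip Omega (app (tinv mu) (B t)) (wcurl Omega p)) : vfield R -> R^o).
  exists dE; split; last first.
    apply: aeW => t tT psi hpsi; have hp : inL2 Omega psi := hpsi.1.1.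
    have hsE : inL2 Omega (app sigma (E t)) := L2B_inL2 (app_L2B oO hsigma LE) tT.
    rewrite -[dE t psi]/(ip Omega (f t - app sigma (E t)) psi + ip Omega (app (tinv mu) (B t)) (wcurl Omega psi)).
    by rewrite (sipBl ips (L2B_inL2 hf tT) hsE hp) addrAC addrK subrK.
  have h0d := dual_seminormed h0.
  have kid : forall u, inL2B T (L2 Omega) u ->
      inL2B T (dual (H0curl Omega)) (fun t => (fun p => ip Omega (u t) p) : vfield R -> R^o).
    move=> u hu; apply: (pairing_L2B oO (kap := id) h0 _ _ _ hu) => [p hp|p hp|a p q w hp hq].
    - exact: hp.1.1.
    - exact: (snorm_Hcurl oO hp.1).
    - exact: (idlin a p q w hp.1.1 hq.1.1).
  have kw : inL2B T (dual (H0curl Omega))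
      (fun t => (fun p => ip Omega (app (tinv mu) (B t)) (wcurl Omega p)) : vfield R -> R^o).
    apply: (pairing_L2B oO (kap := wcurl Omega) h0 _ _ _ LM) => [p hp|p hp|a p q w hp hq].
    - exact: (wcurl_inL2 hp.1).
    - exact: (snorm_wcurl oO hp.1).
    - exact: (wlin a p q w hp.1 hq.1).
  apply: (integrated_H1dual T0 h0 (c := fun p => ip Omega (app eps E0) p)).
  - exact: (kid _ (app_L2B oO heps LE)).
  - exact: (lin_closedD (inL2B_closed T h0d) (kid _ LG) kw).
  - move=> p hp b bT; rewrite (hE p hp b bT); congr (_ + _).
    by rewrite -(ipB_below_pair b LG LM hp.1.1 (wcurl_inL2 hp.1)).
- exists (fun t => (fun p => ip Omega ((- E) t) (wcurl Omega p)) : vfield R -> R^o).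
  have LN := lin_closedN hB LE.
  split; last first.
    apply: aeW => t tT phi hphi; have hw := wcurl_inL2 hphi.
    have -> : (- E) t = -1 *: E t by rewrite scaleN1r.
    by rewrite (sipZl ips _ (L2B_inL2 LE tT) hw) mulN1r addNr.
  apply: (integrated_H1dual T0 hc (c := fun p => ip Omega B0 p)).
  - apply: (pairing_L2B oO (kap := id) hc _ _ _ LB) => [p hp|p hp|a p q w hp hq].
    + exact: hp.1.
    + exact: (snorm_Hcurl oO hp).
    + exact: (idlin a p q w hp.1 hq.1).
  - apply: (pairing_L2B oO (kap := wcurl Omega) hc _ _ _ LN) => [p hp|p hp|a p q w hp hq].
    + exact: (wcurl_inL2 hp).
    + exact: (snorm_wcurl oO hp).
    + exact: (wlin a p q w hp hq).
  - move=> p hp b bT; have hw := wcurl_inL2 hp; rewrite (hBe p hp b bT); congr (_ + _).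
    rewrite -(ipB_below oO b hw LN) -[- E]scaleN1r.
    by rewrite (sipZl ipBs _ LE (below_L2B T oO b hw)) mulN1r.
Qed.

End integrated.

(** * Closedness of the control-to-state map *)

Lemma cvg_extraction (T : topologicalType) (u : nat -> T) (l : T) (f : nat -> nat) :
  (forall k, k <= f k)%N -> u @ \oo --> l -> (fun k => u (f k)) @ \oo --> l.
Proof.
move=> hf ul A nA; have [N _ hN] := ul A nA.
by exists N => // k /= Nk; apply: hN => /=; exact: leq_trans (hf k).
Qed.

Lemma measurable_lower_rays (R : realType) :
  @measurable _ (measurableTypeR R) = <<s [set A | exists b : R, A = `]-oo, b[%classic] >>.
Proof. exact: RGenInftyO.measurableE. Qed.

Lemma setI_closed_lower_rays (R : realType) :
  setI_closed [set A : set R | exists b : R, A = `]-oo, b[%classic].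
Proof.
move=> _ _ [x ->] [y ->]; exists (Num.min x y); apply/seteqP; split=> z /=; rewrite !in_itv/= lt_min.
  by move=> [-> ->].
by move=> /andP[].
Qed.

(** Otherwise a nonempty interval would be contained in a null set. The minimum and the maximum in
    its definition allow [b] to be an endpoint. *)
Lemma ae_itv_dense (R : realType) (T : R) (P : R -> Prop) : 0 < T ->
  {ae leb R, forall t : measurableTypeR R, 0 < t < T -> P t} ->
  forall b d, 0 <= b <= T -> 0 < d -> exists t, [/\ 0 < t < T, `|t - b| < d & P t].
Proof.
move=> T0 [N [mN N0 hN]] b d /andP[b0 bT] d0; apply: contrapT => nP.
pose I : set (measurableTypeR R) := `]Num.max 0 (b - d), Num.min T (b + d)[%classic.
have mI : measurable I by exact: measurable_itv.
have IN : I `<=` N.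
  move=> t; rewrite /I /= in_itv/= gt_max lt_min => /andP[/andP[t0 tb] /andP[tT tb']].
  apply: hN => /= h; apply: nP; exists t; split; first by rewrite t0 tT.
  - by rewrite ltr_norml; apply/andP; split; lra.
  - by apply: h; rewrite t0 tT.
have : (leb R I <= 0)%E by rewrite -N0; apply: le_measure; rewrite ?inE.
have -> : leb R I = (Num.min T (b + d) - Num.max 0 (b - d))%:E.
  have := lebesgue_measure_itv `]Num.max 0 (b - d), Num.min T (b + d)[; rewrite /leb /= => ->.
  rewrite lte_fin; have -> : Num.max 0 (b - d) < Num.min T (b + d).
    by rewrite gt_max !lt_min T0/=; apply/andP; split; [lra|apply/andP; split; lra].
  by rewrite -EFinB.
rewrite lee_fin subr_le0 leNgt gt_max !lt_min T0/= => /negP; apply.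
by apply/andP; split; [lra|apply/andP; split; lra].
Qed.

Lemma sqrtr_lt_sqr (R : rcfType) (x a : R) : 0 < a -> x < a ^+ 2 -> Num.sqrt x < a.
Proof.
move=> a0 h; rewrite -[ltRHS]gtr0_norm// -sqrtr_sqr ltr_sqrt//; exact: exprn_gt0.
Qed.

(** * Primitives of square integrable functions of time *)

Section primitive.
Context (R : realType) (Omega : set (point3 R)) (T : R).
Local Notation P3 := (point3 (measurableTypeR R)).
Local Notation D := (`]0%R, T[%classic : set (measurableTypeR R)).
Hypothesis oO : open Omega.
Hypothesis T0 : 0 < T.
Let mO : measurable (Omega : set P3) := open_measurable3 oO.
Let leb1 : {measure set (measurableTypeR R) -> \bar R} := leb R.
Let L2c := inL2_closed mO.
Let ips := ip_sip mO.
Let hL := L2_seminormed oO.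
Let hB := inL2B_closed T hL.
Let ipBs := ipB_sip T oO.

Local Opaque ip inL2 wcurl sqnormB.

Lemma Rintegral_itv_indic_le (s t : R) : s <= t ->
  \int[leb R]_(r in `]0, T[) ((s <= r < t)%R%:R : R) <= t - s.
Proof.
move=> st.
have -> : \int[leb R]_(r in `]0, T[) ((s <= r < t)%R%:R : R) =
    \int[leb1]_(r in D) (((cst 1 : R -> R) \_ `[s, t[%classic) r).
  apply: eq_Rintegral => r _; rewrite patchE.
  by have [/set_mem|/negP h] := boolP (r \in `[s, t[%classic); rewrite /= ?in_itv/=;
    [move=> ->|case: (boolP (s <= r < t)) => // h'; case: h; apply/mem_set; rewrite /= in_itv].
rewrite -Rintegral_mkcondr.
have mI : measurable (`[s, t[%classic : set (measurableTypeR R)) by exact: measurable_itv.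
have mDI : measurable (D `&` (`[s, t[%classic : set (measurableTypeR R))).
  by apply: measurableI => //; exact: mD.
rewrite (Rintegral_cst leb1 mDI) mul1r.
have le : (leb1 (D `&` (`[s, t[%classic : set (measurableTypeR R))) <= (t - s)%:E)%E.
  apply: (@le_trans _ _ (leb1 (`[s, t[%classic : set (measurableTypeR R)))).
    by apply: le_measure; rewrite ?inE//; exact: subIsetr.
  have := lebesgue_measure_itv `[s, t[; rewrite /leb1 /leb /= => ->.
  by rewrite lte_fin; case: ifP => _; rewrite -?EFinB lee_fin// subr_ge0.
rewrite -lee_fin fineK//; rewrite ge0_fin_numE//; exact: le_lt_trans le (ltry _).
Qed.

Lemma ipB_below_diff p (s t : R) : inL2 Omega p -> s <= t ->
  ipB Omega T (below t p - below s p) (below t p - below s p) =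
  \int[leb R]_(r in `]0, T[) (ip Omega p p * (s <= r < t)%R%:R).
Proof.
move=> hp st; rewrite /ipB; apply: eq_Rintegral => r _.
rewrite -[(below t p - below s p) r]/((r < t)%R%:R *: p - (r < s)%R%:R *: p) -scalerBl.
rewrite (sipZl ips _ hp (lin_closedZ L2c _ hp)) (sipZr ips _ hp hp) mulrA mulrC; congr (_ * _).
rewrite leNgt; case: (ltP r s) => rs /=; last by rewrite subr0; case: (r < t); rewrite ?mulr0 ?mulr1.
by rewrite (lt_le_trans rs st) subrr mulr0.
Qed.

Lemma ipBE u v : ipB Omega T u v = \int[leb1]_(t in D) ip Omega (u t) (v t).
Proof. by []. Qed.

Local Opaque ipB.

(** Cauchy-Schwarz against [p] times the indicator of the times between [s] and [t]: the pairing is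
    Hölder continuous of exponent 1/2 in its endpoint, which is the source of the continuity of
    primitives. *)
Lemma ipB_below_dist u p (s t : R) : inL2B T (L2 Omega) u -> inL2 Omega p ->
  `|ipB Omega T u (below t p) - ipB Omega T u (below s p)| <=
  Num.sqrt (ipB Omega T u u) * (Num.sqrt `|t - s| * Num.sqrt (ip Omega p p)).
Proof.
move=> hu hp; have p0 := sip_ge0 ips hp.
have bb := fun b => below_L2B T oO b hp.
wlog st : s t / s <= t.
  move=> h; have [st|/ltW ts] := leP s t; first exact: (h s t st).
  have := h t s ts; rewrite (distrC s t) => h'; apply: le_trans h'.
  by rewrite -[X in X <= _]normrN opprB.
rewrite -(sipBr ipBs (bb t) (bb s) hu).
have hv := lin_closedB hB (bb t) (bb s).
apply: (le_trans (sip_cauchy_schwarz ipBs hu hv)); apply: ler_wpM2l; first exact: sqrtr_ge0.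
rewrite -(sqrtrM _ (normr_ge0 (t - s))); apply: ler_wsqrtr.
rewrite ger0_norm ?subr_ge0//.
have mi : leb1.-integrable D (EFin \o (fun r : R => (s <= r < t)%R%:R : R)).
  apply: measurable_bounded_integrable; [exact: mD|exact: measure_D_lty| |].
    apply: measurable_funTS.
    rewrite (_ : (fun r => _) = (\1_(`[s, t[%classic) : R -> R)).
      by apply: measurable_indic; exact: measurable_itv.
    apply/funext => r; rewrite indicE; congr (_%:R); congr nat_of_bool.
    by apply/idP/idP; rewrite inE /= in_itv.
  exists 1; split; first exact: num_real.
  by move=> M M1 r _ /=; apply: le_trans (ltW M1); case: (_ && _); rewrite ?normr1 ?normr0.
rewrite (ipB_below_diff hp st).
rewrite (RintegralZl _ (@mD R T) mi) mulrC; apply: ler_wpM2r; first exact: p0.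
exact: Rintegral_itv_indic_le.
Qed.

Lemma ipB_below0 u p : inL2B T (L2 Omega) u -> inL2 Omega p -> ipB Omega T u (below 0 p) = 0.
Proof.
move=> hu hp; rewrite (ipB_below oO 0 hp hu).
transitivity (\int[leb1]_(s in D) (0 : R)); last by rewrite Rintegral_cst ?mul0r//; exact: mD.
apply: eq_Rintegral => s /set_mem; rewrite D_itv => /andP[s0 _].
by rewrite ltNge (ltW s0) mul0r.
Qed.

Lemma L2B_primitive w : inL2B T (L2 Omega) w -> exists W,
  [/\ inCB T (L2 Omega) W, eq_aeL2 Omega (W 0) 0 &
    forall t p, inL2 Omega p -> ip Omega (W t) p = ipB Omega T w (below t p)].
Proof.
move=> hw; pose c := Num.sqrt (ipB Omega T w w).
have c0 : 0 <= c by exact: sqrtr_ge0.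
have /choice[W hW] : forall t, exists p, inL2 Omega p /\
    forall q, inL2 Omega q -> ip Omega p q = ipB Omega T w (below t q).
  move=> t; have [||p hp hpq] := riesz (C := inL2 Omega) (F := fun q => ipB Omega T w (below t q))
      (c := c * Num.sqrt `|t|) ips (L2_complete mO).
  - move=> a u v hu hv; rewrite belowD.
    have ht := below_L2B T oO t hu.
    rewrite (sipDr ipBs (lin_closedZ hB a ht) (below_L2B T oO t hv) hw).
    by rewrite (sipZr ipBs a ht hw).
  - move=> q hq; have := ipB_below_dist 0 t hw hq.
    by rewrite (ipB_below0 hw hq) !subr0 mulrA.
  by exists p.
have WL t := (hW t).1.
exists W; split; last by move=> t; exact: (hW t).2.
- split=> [t _|t0 _]; first exact: WL.
  have dist t : snorm (L2 Omega) (W t - W t0) <= c * Num.sqrt `|t - t0|.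
    (* The increment is tested with itself and the inequality divided by its norm. *)
    pose q := W t - W t0; have hq : inL2 Omega q := lin_closedB L2c (WL t) (WL t0).
    have := ipB_below_dist t0 t hw hq.
    rewrite -((hW t).2 q hq) -((hW t0).2 q hq) -(sipBl ips (WL t) (WL t0) hq) -/q -/c mulrA.
    rewrite (ger0_norm (sip_ge0 ips hq)) /= -/q.
    have := sqr_sqrtr (sip_ge0 ips hq); move: (Num.sqrt (ip Omega q q)) (sqrtr_ge0 (ip Omega q q)) => x x0 <-.
    rewrite expr2; have [->|xn] := eqVneq x 0; first by move=> _; rewrite mulr_ge0// sqrtr_ge0.
    by rewrite ler_pM2r// lt_def xn.
  apply/cvgr0Pnorm_lt => e e0; rewrite near_withinE; apply/nbhs_ballP.
  have q0 : 0 < e / (c + 1) by rewrite divr_gt0// ltr_wpDl.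
  exists ((e / (c + 1)) ^+ 2); first by rewrite /= exprn_gt0.
  move=> t; rewrite /ball/= distrC => tt _.
  rewrite ger0_norm ?sqrtr_ge0//; apply: (le_lt_trans (dist t)).
  have : Num.sqrt `|t - t0| < e / (c + 1).
    exact: sqrtr_lt_sqr.
  rewrite ltr_pdivlMr ?ltr_wpDl//; apply: le_lt_trans.
  by rewrite mulrC; apply: ler_wpM2l; [exact: sqrtr_ge0|rewrite lerDl].
- by apply: (ip_eq0_ae mO (WL 0)); rewrite (hW 0).2// ipB_below0.
Qed.

(** Hölder continuity in the endpoint extends the identity from almost every time to all of
    [[0, T]]; for [t] outside this interval the cut-off is constant on []0, T[]. *)
Lemma ipB_below_ae_eq0 w : inL2B T (L2 Omega) w ->
  (forall p, inL2 Omega p ->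
    {ae leb R, forall t : measurableTypeR R, 0 < t < T -> ipB Omega T w (below t p) = 0}) ->
  forall p t, inL2 Omega p -> ipB Omega T w (below t p) = 0.
Proof.
move=> hw h0 p t hp.
have h0T b : 0 <= b <= T -> ipB Omega T w (below b p) = 0.
  move=> bT; pose K := Num.sqrt (ipB Omega T w w) * Num.sqrt (ip Omega p p).
  have K0 : 0 <= K by rewrite mulr_ge0 ?sqrtr_ge0.
  apply/eqP; rewrite -normr_eq0 eq_le normr_ge0 andbT; apply/ler_addgt0Pl => e e0.
  have q0 : 0 < e / (K + 1) by rewrite divr_gt0// ltr_wpDl.
  have d0 : 0 < (e / (K + 1)) ^+ 2 by rewrite exprn_gt0.
  have [s [sT sb hs]] := ae_itv_dense T0 (h0 p hp) bT d0.
  have := ipB_below_dist s b hw hp; rewrite hs subr0 addr0 => h; apply: (le_trans h).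
  rewrite mulrCA -/K distrC.
  have : Num.sqrt `|s - b| < e / (K + 1).
    exact: sqrtr_lt_sqr.
  rewrite ltr_pdivlMr ?ltr_wpDl// => /ltW; apply: le_trans.
  by apply: ler_wpM2l; [exact: sqrtr_ge0|rewrite lerDl].
have [tT|Tt] := leP t T; last first.
  transitivity (ipB Omega T w (below T p)); last by apply: h0T; rewrite (ltW T0)/=.
  rewrite (ipB_below oO t hp hw) (ipB_below oO T hp hw).
  apply: eq_Rintegral => s /set_mem; rewrite D_itv => /andP[_ sT].
  by rewrite sT (lt_trans sT Tt).
have [t0|t0] := leP 0 t; first by rewrite h0T// t0.
transitivity (ipB Omega T w (below 0 p)); last by apply: h0T; rewrite (ltW T0) andbT.
rewrite (ipB_below oO t hp hw) (ipB_below oO 0 hp hw).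
apply: eq_Rintegral => s /set_mem; rewrite D_itv => /andP[s0 _].
by rewrite ltNge (ltW (lt_trans t0 s0)) ltNge (ltW s0).
Qed.

(** Lower rays form a generating pi-system, so for each fixed [p] the pairing with [w t] vanishes
    for almost every [t]. The null set depends on [p], which forbids the choice [p = w t]; instead
    [w] is shown orthogonal to all simple functions, which are dense. *)
Lemma ipB_below_eq0 w : inL2B T (L2 Omega) w ->
  (forall p t, inL2 Omega p -> ipB Omega T w (below t p) = 0) ->
  sqnormB T (L2 Omega) w = 0.
Proof.
move=> hw h0.
have ae0 p : inL2 Omega p -> {ae leb1, forall t, D t -> ip Omega (w t) p = 0}.
  move=> hp; have hi := ip_L2B_integrable oO hw (cst_L2B T oO hp).
  apply: (@integral_pi_system_ae_eq0 _ (measurableTypeR R) R leb1 D (@mD R T) _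
    (fun t => ip Omega (w t) p) (measurable_lower_rays R) (@setI_closed_lower_rays R) hi).
    transitivity (ipB Omega T w (below T p)); last exact: h0.
    rewrite (ipB_below oO T hp hw); apply: eq_Rintegral => s /set_mem.
    by rewrite D_itv => /andP[_ ->]; rewrite mul1r.
  move=> _ [b ->]; rewrite Rintegral_mkcondr.
  transitivity (ipB Omega T w (below b p)); last exact: h0.
  rewrite (ipB_below oO b hp hw); apply: eq_Rintegral => s _; rewrite patchE.
  case: (boolP (s < b)) => sb; first by rewrite mem_set ?mul1r//= in_itv.
  by rewrite mul0r memNset//= in_itv/=; apply/negP.
have simple0 s : simple_in (L2 Omega) s -> ipB Omega T w s = 0.
  move=> hs; have [n [A [v [hAv sE]]]] := hs.
  have hi i : inL2B T (L2 Omega) (fun t => (\1_(A i) t : R) *: v i).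
    by apply: (inL2B_indic hL (hAv i).1); apply: (cst_L2B T oO); exact: (hAv i).2.
  pose r i : R -> vfield R := fun t => (\1_(A i) t : R) *: v i.
  have sr : s = \sum_(i < n) r i.
    apply/funext => t; rewrite sE.
    rewrite (big_morph (fun g : R -> vfield R => g t) (id1 := 0) (op1 := +%R) (fun _ _ => erefl) erefl).
    by apply: eq_bigr.
  have [_] : inL2B T (L2 Omega) (\sum_(i < n) r i) /\ ipB Omega T w (\sum_(i < n) r i) = 0.
    elim/big_ind: _ => [|x y [hx x0] [hy y0]|i _].
    - by split; [exact: (lin_closed0 hB)|rewrite (sip_sym ipBs hw (lin_closed0 hB)) (sip0l ipBs hw)].
    - by split; [exact: (lin_closedD hB hx hy)|rewrite (sipDr ipBs hx hy hw) x0 y0 addr0].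
    - split; first exact: hi.
      transitivity (\int[leb1]_(s in D) (0 : R)); last by rewrite Rintegral_cst ?mul0r//; exact: mD.
      rewrite ipBE; apply: (@ae_eq_Rintegral _ (measurableTypeR R) R leb1 D (@mD R T)).
      + exact: integrable_measurable (ip_L2B_integrable oO hw (hi i)).
      + exact: measurable_cst.
      + apply: (@ae_imp _ (measurableTypeR R) R leb1 _ _ (ae0 _ (hAv i).2)) => t ht Dt.
        have tT : 0 < t < T by move: Dt; rewrite D_itv.
        by rewrite (sipZr ips _ (hAv i).2 (L2B_inL2 hw tT)) (ht Dt) mulr0.
  by rewrite -sr.
rewrite -(ipB_sqnorm oO hw).
apply/eqP; rewrite eq_le (sip_ge0 ipBs hw) andbT; apply/ler_addgt0Pl => e e0; rewrite addr0.
pose c := Num.sqrt (ipB Omega T w w); have c0 : 0 <= c by exact: sqrtr_ge0.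
have q0 : 0 < e / (c + 1) by rewrite divr_gt0// ltr_wpDl.
have [s hs ws] := simple_dense hL hw (exprn_gt0 2 q0).
have sB := inL2B_simple T hL hs; have wsB := lin_closedB hB hw sB.
have -> : ipB Omega T w w = ipB Omega T w (w - s).
  by rewrite (sipBr ipBs hw sB hw) (simple0 s hs) subr0.
apply: (le_trans (ler_norm _)); apply: (le_trans (sip_cauchy_schwarz ipBs hw wsB)).
rewrite -/c mulrC (ipB_sqnorm oO wsB).
have : Num.sqrt (sqnormB T (L2 Omega) (w - s)) < e / (c + 1).
  exact: sqrtr_lt_sqr.
rewrite ltr_pdivlMr ?ltr_wpDl// => /ltW; apply: le_trans.
by apply: ler_wpM2l; [exact: sqrtr_ge0|rewrite lerDl].
Qed.

End primitive.

(** * Linear combinations and limits of integrated solutions *)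

Section linear.
Context (R : realType) (Omega : set (point3 R)) (T : R).
Local Notation P3 := (point3 (measurableTypeR R)).
Local Notation D := (`]0%R, T[%classic : set (measurableTypeR R)).
Hypothesis oO : open Omega.
Hypothesis T0 : 0 < T.
Let mO : measurable (Omega : set P3) := open_measurable3 oO.
Let leb1 : {measure set (measurableTypeR R) -> \bar R} := leb R.
Let ips := ip_sip mO.
Let hL := L2_seminormed oO.
Let ipBs := ipB_sip T oO.

Local Opaque ip inL2 wcurl sqnormB.

Lemma ipB_eq_ae u v w : inL2B T (L2 Omega) u -> inL2B T (L2 Omega) v -> inL2B T (L2 Omega) w ->
  (forall t, 0 < t < T -> eq_aeL2 Omega (u t) (v t)) -> ipB Omega T u w = ipB Omega T v w.
Proof.
move=> hu hv hw uv; rewrite /ipB; apply: eq_Rintegral => t /set_mem; rewrite D_itv => tT.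
exact: (eq_aeL2_ip mO (L2B_inL2 hu tT) (L2B_inL2 hv tT) (L2B_inL2 hw tT) (uv t tT)).
Qed.

Local Opaque ipB.

Context (eps mu sigma : tensor3 R).
Hypothesis heps : Linfty Omega eps.
Hypothesis hmui : Linfty Omega (tinv mu).
Hypothesis hsigma : Linfty Omega sigma.
Local Notation sol := (integrated_solution Omega T eps mu sigma).

Lemma app_lin_fun A a (u v : R -> vfield R) :
  (fun t => app A ((a *: u + v) t)) = a *: (fun t => app A (u t)) + (fun t => app A (v t)).
Proof. by apply/funext => t; rewrite -[(a *: u + v) t]/(a *: u t + v t) app_lin. Qed.

Let app_ip A u : Linfty Omega A -> inL2 Omega u -> inL2 Omega (app A u).
Proof. by move=> hA hu; have [C [_ hC]] := app_inL2 mO hA; exact: (hC u hu).1. Qed.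

Lemma integrated_lin a E0 B0 f E B E0' B0' f' E' B' :
  inL2 Omega E0 -> inL2 Omega B0 -> inL2B T (L2 Omega) f ->
  inL2 Omega E0' -> inL2 Omega B0' -> inL2B T (L2 Omega) f' ->
  sol E0 B0 f E B -> sol E0' B0' f' E' B' ->
  sol (a *: E0 + E0') (a *: B0 + B0') (a *: f + f') (a *: E + E') (a *: B + B').
Proof.
move=> hE0 hB0 hf hE0' hB0' hf' [[cE cB] sE sB iE iB] [[cE' cB'] sE' sB' iE' iB'].
have LE := inCB_L2B oO T0 cE; have LB := inCB_L2B oO T0 cB.
have LE' := inCB_L2B oO T0 cE'; have LB' := inCB_L2B oO T0 cB'.
split.
- by split; exact: (inCB_lin oO).
- move=> psi hpsi b bT; have hp : inL2 Omega psi := hpsi.1.1; have hw := wcurl_inL2 hpsi.1.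
  have bp := below_L2B T oO b hp; have bw := below_L2B T oO b hw.
  have eb := app_ip heps (L2B_inL2 LE bT); have eb' := app_ip heps (L2B_inL2 LE' bT).
  rewrite -[(a *: E + E') b]/(a *: E b + E' b) !app_lin !app_lin_fun.
  have e0 := app_ip heps hE0; have e0' := app_ip heps hE0'.
  rewrite (sip_linear ips a eb eb' hp) (sip_linear ips a e0 e0' hp).
  have M := app_L2B oO hmui LB; have M' := app_L2B oO hmui LB'.
  rewrite (sip_linear ipBs a M M' bw).
  have G := rhs_L2B oO hsigma hf LE; have G' := rhs_L2B oO hsigma hf' LE'.
  pose S := fun t => app sigma (E t); pose S' := fun t => app sigma (E' t).
  have -> : a *: f + f' - (a *: S + S') = a *: (f - S) + (f' - S') by rewrite opprD addrACA scalerBr.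
  rewrite (sip_linear ipBs a G G' bp).
  rewrite (sE psi hpsi b bT) (sE' psi hpsi b bT).
  by rewrite !mulrDr addrACA; congr (_ + _); rewrite addrACA.
- move=> phi hphi b bT; have hp : inL2 Omega phi := hphi.1; have hw := wcurl_inL2 hphi.
  have bw := below_L2B T oO b hw.
  rewrite -[(a *: B + B') b]/(a *: B b + B' b).
  rewrite (sip_linear ips a (L2B_inL2 LB bT) (L2B_inL2 LB' bT) hp).
  rewrite (sip_linear ips a hB0 hB0' hp) (sip_linear ipBs a LE LE' bw).
  rewrite (sB phi hphi b bT) (sB' phi hphi b bT).
  by rewrite mulrBr opprD addrACA.
- by rewrite -[(a *: E + E') 0]/(a *: E 0 + E' 0); exact: eq_aeL2_lin.
- by rewrite -[(a *: B + B') 0]/(a *: B 0 + B' 0); exact: eq_aeL2_lin.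
Qed.

Lemma integrated_eq_ae E0 B0 f g E B : inL2B T (L2 Omega) f -> inL2B T (L2 Omega) g ->
  (forall t, 0 < t < T -> eq_aeL2 Omega (f t) (g t)) -> sol E0 B0 f E B -> sol E0 B0 g E B.
Proof.
move=> hf hg fg [[cE cB] sE sB iE iB].
have LE := inCB_L2B oO T0 cE; split; [by split| |exact: sB|exact: iE|exact: iB].
move=> psi hpsi b bT; rewrite (sE psi hpsi b bT).
have e : forall t, 0 < t < T -> eq_aeL2 Omega ((f - (fun t => app sigma (E t))) t) ((g - (fun t => app sigma (E t))) t).
  move=> t tT; exact: (eq_aeL2B (fg t tT) (eq_aeL2_refl _ _)).
by rewrite (ipB_eq_ae (rhs_L2B oO hsigma hf LE) (rhs_L2B oO hsigma hg LE) (below_L2B T oO b hpsi.1.1) e).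
Qed.

(** Mean-square convergence gives pointwise convergence along a subsequence only, for almost every
    [t]. The right-hand sides converge at every time along the whole sequence, so the two limits can
    be compared. *)
Lemma ae_limit_pairing (u : nat -> R -> vfield R) (w : R -> vfield R) (r : nat -> R -> R) (l : R -> R) p :
  (forall n, inL2B T (L2 Omega) (u n)) -> inL2B T (L2 Omega) w -> inL2 Omega p ->
  (fun n => sqnormB T (L2 Omega) (u n - w)) @ \oo --> (0 : R) ->
  (forall n t, 0 < t < T -> ip Omega (u n t) p = r n t) ->
  (forall t, 0 < t < T -> (fun n => r n t) @ \oo --> l t) ->
  {ae leb1, forall t : measurableTypeR R, 0 < t < T -> ip Omega (w t) p = l t}.
Proof.
move=> hu hw hp uw ur rl.
have [f [hf ae]] := ae_cvg_subsequence hL hu hw uw.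
apply: (@ae_imp _ (measurableTypeR R) R leb1 _ _ ae) => t ht tT.
have Dt : D t by rewrite D_itv.
have wt := L2B_inL2 hw tT; have ut n := L2B_inL2 (hu n) tT.
have h1 : (fun k => ip Omega (u (f k) t) p) @ \oo --> ip Omega (w t) p.
  apply: (ip_cvg oO wt hp (fun k => ut (f k)) (fun _ => hp)).
    by have := ht Dt; under eq_fun do rewrite (snB hL (ut _) wt).
  by under eq_fun do rewrite subrr (sn0 hL); exact: cvg_cst.
have h2 : (fun k => ip Omega (u (f k) t) p) @ \oo --> l t.
  under eq_fun do rewrite (ur _ _ tT).
  exact: (cvg_extraction hf (rl t tT)).
exact: (cvg_unique _ h1 h2).
Qed.

End linear.

Lemma app0 (R : realType) (A : tensor3 R) : app A 0 = 0.
Proof. by apply/funext => x; exact: mulmx0. Qed.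

Section closed.
Context (R : realType) (Omega : set (point3 R)) (T : R).
Local Notation P3 := (point3 (measurableTypeR R)).
Local Notation D := (`]0%R, T[%classic : set (measurableTypeR R)).
Hypothesis oO : open Omega.
Hypothesis T0 : 0 < T.
Let mO : measurable (Omega : set P3) := open_measurable3 oO.
Let leb1 : {measure set (measurableTypeR R) -> \bar R} := leb R.
Let L2c := inL2_closed mO.
Let ips := ip_sip mO.
Let hL := L2_seminormed oO.
Let hB := inL2B_closed T hL.
Let ipBs := ipB_sip T oO.

Local Opaque ip inL2 wcurl sqnormB.

(** Tensors are moved to the fixed test field, so that limits have to be taken only in the states
    themselves. *)
Lemma ipB_app_below (A : tensor3 R) (u : R -> vfield R) b p :
  ipB Omega T (fun t => app A (u t)) (below b p) =
  ipB Omega T u (below b (app (fun x => (A x)^T) p)).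
Proof.
rewrite /ipB; apply: eq_Rintegral => t _; rewrite ip_tr /below.
by rewrite -[_ *: p]addr0 app_lin app0 addr0.
Qed.

Local Opaque ipB.

Context (eps mu sigma : tensor3 R).
Hypothesis heps : Linfty Omega eps.
Hypothesis hmui : Linfty Omega (tinv mu).
Hypothesis hsigma : Linfty Omega sigma.
Local Notation sol := (integrated_solution Omega T eps mu sigma).
Local Notation tr A := (fun x => (A x)^T).

Let app_ip A u : Linfty Omega A -> inL2 Omega u -> inL2 Omega (app A u).
Proof. by move=> hA hu; have [C [_ hC]] := app_inL2 mO hA; exact: (hC u hu).1. Qed.

(* The primitives of the limits solve the homogeneous equations, so they
   vanish. *)
Lemma integrated_limit_eq0 (g E B : nat -> R -> vfield R) (w1 w2 : R -> vfield R) :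
  (forall F G, sol 0 0 0 F G -> eq_aeB T Omega F 0 /\ eq_aeB T Omega G 0) ->
  (forall n, inL2B T (L2 Omega) (g n)) ->
  (forall n, sol 0 0 (g n) (E n) (B n)) ->
  inL2B T (L2 Omega) w1 -> inL2B T (L2 Omega) w2 ->
  (fun n => sqnormB T (L2 Omega) (g n - 0)) @ \oo --> (0 : R) ->
  (fun n => sqnormB T (L2 Omega) (E n - w1)) @ \oo --> (0 : R) ->
  (fun n => sqnormB T (L2 Omega) (B n - w2)) @ \oo --> (0 : R) ->
  sqnormB T (L2 Omega) w1 = 0 /\ sqnormB T (L2 Omega) w2 = 0.
Proof.
move=> uniq hg hsol hw1 hw2 gl El Bl.
have zB := lin_closed0 hB; have z2 := lin_closed0 L2c.
have LE n : inL2B T (L2 Omega) (E n) by have [[c _] _ _ _ _] := hsol n; exact: (inCB_L2B oO T0 c).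
have LB n : inL2B T (L2 Omega) (B n) by have [[_ c] _ _ _ _] := hsol n; exact: (inCB_L2B oO T0 c).
have [W1 [cW1 W10 W1E]] := L2B_primitive oO hw1.
have [W2 [cW2 W20 W2E]] := L2B_primitive oO hw2.
have LW1 := inCB_L2B oO T0 cW1; have LW2 := inCB_L2B oO T0 cW2.
have LN := lin_closedZ hB (-1) LW1.
have lim u w b p : (forall n, inL2B T (L2 Omega) (u n)) -> inL2B T (L2 Omega) w -> inL2 Omega p ->
    (fun n => sqnormB T (L2 Omega) (u n - w)) @ \oo --> (0 : R) ->
    (fun n => ipB Omega T (u n) (below b p)) @ \oo --> ipB Omega T w (below b p).
  by move=> hu hw hp uw; exact: (ipB_cvg oO hu hw (below_L2B T oO b hp) uw).
(* In the limit, the integrals of [w1] and [w2] up to [t] are pairings with [W1 t] and [W2 t]: the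
   integrated equation of the states becomes a pointwise relation between the limits and their
   primitives. *)
have id1 psi : inH0curl Omega psi ->
    {ae leb1, forall t : measurableTypeR R, 0 < t < T -> ip Omega (w1 t) (app (tr eps) psi) =
      ip Omega ((-1 *: W1) t) (app (tr sigma) psi) +
      ip Omega (W2 t) (app (tr (tinv mu)) (wcurl Omega psi))}.
  move=> hpsi; have hp : inL2 Omega psi := hpsi.1.1; have hw := wcurl_inL2 hpsi.1.
  have ep := app_ip (Linfty_tr heps) hp; have sp := app_ip (Linfty_tr hsigma) hp.
  have mp := app_ip (Linfty_tr hmui) hw.
  apply: (ae_limit_pairing oO (r := fun n t => ipB Omega T (g n) (below t psi) -
      ipB Omega T (E n) (below t (app (tr sigma) psi)) +
      ipB Omega T (B n) (below t (app (tr (tinv mu)) (wcurl Omega psi)))) LE hw1 ep El).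
  - move=> n t tT; have [_ sE _ _ _] := hsol n; have := sE psi hpsi t tT.
    rewrite app0 (sip0l ips hp) add0r ip_tr => ->.
    rewrite (sipBl ipBs (hg n) (app_L2B oO hsigma (LE n)) (below_L2B T oO t hp)).
    by rewrite !ipB_app_below.
  - move=> t tT; have L1 := L2B_inL2 LW1 tT.
    have -> : (-1 *: W1) t = -1 *: W1 t by [].
    rewrite (sipZl ips (-1) L1 sp) mulN1r (W1E t _ sp) (W2E t _ mp).
    apply: cvgD; last exact: (lim _ _ _ _ LB hw2 mp Bl).
    rewrite -[X in _ --> X]add0r; apply: cvgB; last exact: (lim _ _ _ _ LE hw1 sp El).
    have := lim g 0 t psi hg zB hp gl.
    by rewrite (sip0l ipBs (below_L2B T oO t hp)).
(* The pairing with 0 gives this identity the shape of [id1], so that [int] integrates both. *)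
have id2 phi : inHcurl Omega phi ->
    {ae leb1, forall t : measurableTypeR R, 0 < t < T -> ip Omega (w2 t) phi =
      ip Omega ((-1 *: W1) t) (wcurl Omega phi) + ip Omega (W2 t) 0}.
  move=> hphi; have hp : inL2 Omega phi := hphi.1; have hw := wcurl_inL2 hphi.
  apply: (ae_limit_pairing oO (r := fun n t => - ipB Omega T (E n) (below t (wcurl Omega phi))) LB hw2 hp Bl).
  - move=> n t tT; have [_ _ sB _ _] := hsol n; rewrite (sB phi hphi t tT).
    by rewrite (sip0l ips hp) add0r.
  - move=> t tT; have L1 := L2B_inL2 LW1 tT; have L2' := L2B_inL2 LW2 tT.
    have -> : (-1 *: W1) t = -1 *: W1 t by [].
    rewrite (sipZl ips (-1) L1 hw) mulN1r (W1E t _ hw) (sip_sym ips L2' z2) (sip0l ips L2') addr0.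
    by apply: cvgN; exact: (lim _ _ _ _ LE hw1 hw El).
have Wsol : sol 0 0 0 W1 W2.
  (* The second integration in time. Its left-hand side is the value at [b] of the primitive of [w],
     paired with [p]. *)
  have int w p q r b : inL2B T (L2 Omega) w -> inL2 Omega p -> inL2 Omega q -> inL2 Omega r ->
      {ae leb1, forall t : measurableTypeR R, 0 < t < T ->
         ip Omega (w t) p = ip Omega ((-1 *: W1) t) q + ip Omega (W2 t) r} ->
      ipB Omega T w (below b p) = ipB Omega T (-1 *: W1) (below b q) + ipB Omega T W2 (below b r).
    move=> hw hp hq hr ae; rewrite -(ipB_below_pair oO b LN LW2 hq hr) (ipB_below oO b hp hw).
    have mb : measurable_fun D (fun s : R => (s < b)%R%:R : R).
      apply: measurable_funTS; rewrite (_ : (fun r => _) = (\1_(`]-oo, b[%classic) : R -> R)).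
        by apply: measurable_indic; exact: measurable_itv.
      apply/funext => s; rewrite indicE; congr (_%:R); congr nat_of_bool.
      by apply/idP/idP; rewrite inE /= in_itv.
    have i1 := ip_L2B_integrable oO LN (cst_L2B T oO hq).
    have i2 := ip_L2B_integrable oO LW2 (cst_L2B T oO hr).
    have i0 := ip_L2B_integrable oO hw (cst_L2B T oO hp).
    apply: (@ae_eq_Rintegral _ (measurableTypeR R) R leb1 D (@mD R T)).
    - exact: (measurable_funM mb (integrable_measurable i0)).
    - exact: (measurable_funM mb (integrable_measurable (integrable_add (@mD R T) i1 i2))).
    - apply: (@ae_imp _ (measurableTypeR R) R leb1 _ _ ae) => t ht.
      by rewrite D_itv => tT; rewrite (ht tT).
  split.
  - by split.
  - move=> psi hpsi b bT; have hp : inL2 Omega psi := hpsi.1.1; have hw := wcurl_inL2 hpsi.1.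
    have ep := app_ip (Linfty_tr heps) hp; have sp := app_ip (Linfty_tr hsigma) hp.
    have mp := app_ip (Linfty_tr hmui) hw.
    rewrite app0 (sip0l ips hp) add0r ip_tr (W1E b _ ep).
    rewrite (int w1 _ _ _ b hw1 ep sp mp (id1 psi hpsi)).
    have -> : 0 - (fun t => app sigma (W1 t)) = (fun t => app sigma ((-1 *: W1) t)).
      apply/funext => t; rewrite -[LHS]/(0 - app sigma (W1 t)) -[(-1 *: W1) t]/(-1 *: W1 t).
      by rewrite sub0r -[-1 *: W1 t]addr0 app_lin app0 addr0 scaleN1r.
    by rewrite !ipB_app_below.
  - move=> phi hphi b bT; have hp : inL2 Omega phi := hphi.1; have hw := wcurl_inL2 hphi.
    rewrite (sip0l ips hp) add0r (W2E b _ hp).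
    rewrite (int w2 _ _ _ b hw2 hp hw z2 (id2 phi hphi)).
    rewrite (sipZl ipBs _ LW1 (below_L2B T oO b hw)) mulN1r.
    have -> : below b (0 : vfield R) = 0 by apply/funext => s; rewrite /below scaler0.
    by rewrite (sip_sym ipBs LW2 zB) (sip0l ipBs LW2) addr0.
  - exact: W10.
  - exact: W20.
have [aeW1 aeW2] := uniq _ _ Wsol.
(* A vanishing primitive makes the integrals of [w] up to almost every time vanish, whence [w] has
   norm 0. *)
have fin w W : inL2B T (L2 Omega) w -> inL2B T (L2 Omega) W ->
    (forall t p, inL2 Omega p -> ip Omega (W t) p = ipB Omega T w (below t p)) ->
    eq_aeB T Omega W 0 -> sqnormB T (L2 Omega) w = 0.
  move=> hw hW WE W0; apply: (ipB_below_eq0 oO hw) => p t hp.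
  apply: (ipB_below_ae_eq0 oO T0 hw) hp => q hq.
  apply: (@ae_imp _ (measurableTypeR R) R leb1 _ _ W0) => s hs sT.
  by rewrite -(WE s q hq) (eq_aeL2_ip mO (L2B_inL2 hW sT) z2 hq (hs sT)) (sip0l ips hq).
by split; [exact: (fin w1 W1)|exact: (fin w2 W2)].
Qed.

End closed.

(** * The control-to-state map: affinity and closed graph *)

Section state.
Context (R : realType) (Omega : set (point3 R)) (T : R).
Local Notation P3 := (point3 (measurableTypeR R)).
Hypothesis oO : open Omega.
Hypothesis bO : bounded_set Omega.
Hypothesis T0 : 0 < T.
Let mO : measurable (Omega : set P3) := open_measurable3 oO.
Let leb1 : {measure set (measurableTypeR R) -> \bar R} := leb R.
Let hL := L2_seminormed oO.
Let hB := inL2B_closed T hL.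
Let hZ := inL2B_closed T (Hcurl_seminormed oO bO).

Local Opaque ip inL2 wcurl sqnormB ipB.

Lemma wcurl_mid (p q : vfield R) : inHcurl Omega p -> inHcurl Omega q ->
  eq_aeL2 Omega (2^-1 *: (wcurl Omega p + wcurl Omega q)) (wcurl Omega (2^-1 *: (p + q))).
Proof.
move=> hp hq; have hqz := lin_closedZ (inHcurl_closed oO bO) 2^-1 hq.
have z0 := lin_closed0 (inHcurl_closed oO bO).
have h1 := wcurl_lin oO bO 2^-1 hp hqz.
have h2 := wcurl_lin oO bO 2^-1 hq z0.
have w0 : eq_aeL2 Omega (wcurl Omega 0) 0.
  have h := wcurl_lin oO bO (-1) z0 z0.
  by rewrite !scaleN1r !addNr in h.
rewrite addr0 in h2.
have h3 : eq_aeL2 Omega (wcurl Omega (2^-1 *: q)) (2^-1 *: wcurl Omega q).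
  rewrite -[X in eq_aeL2 _ _ X]addr0; apply: (eq_aeL2_trans h2).
  exact: (eq_aeL2_lin 2^-1 (eq_aeL2_refl _ _) w0).
apply: eq_aeL2_sym; rewrite !scalerDr; apply: (eq_aeL2_trans h1).
exact: (eq_aeL2_lin 2^-1 (eq_aeL2_refl _ _) h3).
Qed.

Lemma curlB_mid z z' : inZ Omega T z -> inZ Omega T z' -> forall t, 0 < t < T ->
  eq_aeL2 Omega ((2^-1 *: (curlB Omega z + curlB Omega z')) t) (curlB Omega (2^-1 *: (z + z')) t).
Proof. by move=> hz hz' t tT; exact: (wcurl_mid (inL2B_carrier hz tT) (inL2B_carrier hz' tT)). Qed.

Lemma inZ_mid z z' : inZ Omega T z -> inZ Omega T z' -> inZ Omega T (2^-1 *: (z + z')).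
Proof. by move=> hz hz'; exact: (lin_closedZ hZ 2^-1 (lin_closedD hZ hz hz')). Qed.

Context (eps mu sigma : tensor3 R) (Isrc : R -> vfield R) (E0 B0 : vfield R).
Context (S : (R -> vfield R) -> (R -> vfield R) * (R -> vfield R)).
Hypothesis heps : Linfty Omega eps.
Hypothesis hmui : Linfty Omega (tinv mu).
Hypothesis hsigma : Linfty Omega sigma.
Hypothesis hIsrc : inL2B T (L2 Omega) Isrc.
Hypothesis hE0 : inL2 Omega E0.
Hypothesis hB0 : inL2 Omega B0.
Hypothesis hS : control_to_state Omega T eps mu sigma Isrc E0 B0 S.
Local Notation sol := (integrated_solution Omega T eps mu sigma).
Local Notation f z := (Isrc + curlB Omega z).

Let f_L2B z : inZ Omega T z -> inL2B T (L2 Omega) (f z).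
Proof. by move=> hz; exact: (lin_closedD hB hIsrc (curlB_L2B oO bO hz)). Qed.

Lemma state_sol z : inZ Omega T z -> sol E0 B0 (f z) (S z).1 (S z).2.
Proof.
move=> hz; have [ws _] := hS hz.
exact: (weak_integrated oO bO T0 heps hmui hsigma hE0 hB0 (f_L2B hz) ws).
Qed.

Lemma state_L2B z : inZ Omega T z ->
  inL2B T (L2 Omega) (S z).1 /\ inL2B T (L2 Omega) (S z).2.
Proof. by move=> /state_sol[[c c'] _ _ _ _]; split; exact: (inCB_L2B oO T0). Qed.

Lemma state_unique z E B : inZ Omega T z -> sol E0 B0 (f z) E B ->
  eq_aeB T Omega E (S z).1 /\ eq_aeB T Omega B (S z).2.
Proof.
move=> hz s; have [_ u] := hS hz.
exact: (u E B (integrated_weak oO bO T0 heps hmui hsigma (f_L2B hz) s)).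
Qed.

(** A homogeneous solution added to the state of the zero control is again a solution with the data
    of the zero control. *)
Lemma homogeneous_unique F G : sol 0 0 0 F G -> eq_aeB T Omega F 0 /\ eq_aeB T Omega G 0.
Proof.
move=> s; have z0 := lin_closed0 hZ; have z2 := lin_closed0 (inL2_closed mO).
have := integrated_lin oO T0 heps hmui hsigma 1 z2 z2 (lin_closed0 hB) hE0 hB0 (f_L2B z0) s (state_sol z0).
rewrite !scale1r !add0r => /(state_unique z0)[hF hG].
have sub (u v : R -> vfield R) : eq_aeB T Omega (u + v) v -> eq_aeB T Omega u 0.
  move=> h; apply: (@ae_imp _ (measurableTypeR R) R leb1 _ _ h) => t ht tT.
  have := eq_aeL2B (ht tT) (eq_aeL2_refl Omega (v t)).
  by rewrite -[(u + v) t]/(u t + v t) addrK subrr.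
by split; [exact: sub hF|exact: sub hG].
Qed.

Lemma state_diff z z' : inZ Omega T z -> inZ Omega T z' ->
  sol 0 0 (curlB Omega z - curlB Omega z') ((S z).1 - (S z').1) ((S z).2 - (S z').2).
Proof.
move=> hz hz'.
have := integrated_lin oO T0 heps hmui hsigma (-1) hE0 hB0 (f_L2B hz') hE0 hB0 (f_L2B hz)
  (state_sol hz') (state_sol hz).
have -> : -1 *: f z' + f z = curlB Omega z - curlB Omega z'.
  by rewrite scaleN1r opprD addrACA addNr add0r addrC.
have e (u v : R -> vfield R) : -1 *: u + v = v - u by rewrite scaleN1r addrC.
by rewrite !e !scaleN1r !addNr.
Qed.

Lemma state_mid z z' : inZ Omega T z -> inZ Omega T z' ->
  eq_aeB T Omega (2^-1 *: ((S z).1 + (S z').1)) (S (2^-1 *: (z + z'))).1 /\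
  eq_aeB T Omega (2^-1 *: ((S z).2 + (S z').2)) (S (2^-1 *: (z + z'))).2.
Proof.
move=> hz hz'; have hm := inZ_mid hz hz'.
have cz := curlB_L2B oO bO hz; have cz' := curlB_L2B oO bO hz'.
have z2 := lin_closed0 (inL2_closed mO).
(* The midpoint is written as half a difference of states plus a state, so that the initial values
   come out as [E0] and [B0]. The curl of the midpoint matches the resulting source only almost
   everywhere, which is settled by [integrated_eq_ae]. *)
have := integrated_lin oO T0 heps hmui hsigma 2^-1 z2 z2 (lin_closedB hB cz cz') hE0 hB0 (f_L2B hz')
  (state_diff hz hz') (state_sol hz').
have half (u v : R -> vfield R) : 2^-1 *: (u - v) + v = 2^-1 *: (u + v).
  rewrite scalerBr scalerDr -addrA; congr (_ + _).
  rewrite -[v in - _ + v]scale1r -scaleNr -scalerDl; congr (_ *: _).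
  by rewrite {2}(splitr 1) mul1r addKr.
have half_src (u : R -> vfield R) : 2^-1 *: (curlB Omega z - curlB Omega z') + (u + curlB Omega z') =
    u + 2^-1 *: (curlB Omega z + curlB Omega z') by rewrite addrCA half.
rewrite half_src !half !scaler0 !add0r => s.
have hmid := lin_closedZ hB 2^-1 (lin_closedD hB cz cz').
apply: (state_unique hm); apply: (integrated_eq_ae oO T0 hsigma _ _ _ s).
- exact: (lin_closedD hB hIsrc hmid).
- exact: f_L2B hm.
- move=> t tT.
  have := eq_aeL2_lin 1 (eq_aeL2_refl Omega (Isrc t)) (curlB_mid hz hz' tT).
  by rewrite !scale1r.
Qed.

Lemma sqnormB_curlB z z' : inZ Omega T z -> inZ Omega T z' ->
  sqnormB T (Hcurl Omega) (z - z') =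
  sqnormB T (L2 Omega) (z - z') + sqnormB T (L2 Omega) (curlB Omega z - curlB Omega z').
Proof.
move=> hz hz'.
have c := curlB_L2B oO bO (lin_closedB hZ hz hz').
have d := lin_closedB hB (curlB_L2B oO bO hz) (curlB_L2B oO bO hz').
have e : sqnormB T (L2 Omega) (curlB Omega (z - z')) =
    sqnormB T (L2 Omega) (curlB Omega z - curlB Omega z').
  rewrite -(ipB_sqnorm oO c) -(ipB_sqnorm oO d) !ipBE; apply: eq_Rintegral => t /set_mem.
  by rewrite D_itv => tT; exact: (ip_wcurl_sqB oO bO (inL2B_carrier hz tT) (inL2B_carrier hz' tT)).
by rewrite (sqnormB_Hcurl oO bO (lin_closedB hZ hz hz')) e.
Qed.

(** Subtracting [S z] removes the initial data and leaves sources that tend to 0, which is the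
    situation of [integrated_limit_eq0]. *)
Lemma state_closed (z_ : nat -> R -> vfield R) z w1 w2 :
  (forall n, inZ Omega T (z_ n)) -> inZ Omega T z ->
  inL2B T (L2 Omega) w1 -> inL2B T (L2 Omega) w2 ->
  (fun n => sqnormB T (Hcurl Omega) (z_ n - z)) @ \oo --> (0 : R) ->
  (fun n => sqnormB T (L2 Omega) ((S (z_ n)).1 - w1)) @ \oo --> (0 : R) ->
  (fun n => sqnormB T (L2 Omega) ((S (z_ n)).2 - w2)) @ \oo --> (0 : R) ->
  sqnormB T (L2 Omega) (w1 - (S z).1) = 0 /\ sqnormB T (L2 Omega) (w2 - (S z).2) = 0.
Proof.
move=> hz_ hz h1 h2 zl l1 l2.
have [s1 s2] := state_L2B hz.
have sub (u v w : R -> vfield R) : u - v - (w - v) = u - w by rewrite opprB addrA subrK.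
have l1' : (fun n => sqnormB T (L2 Omega) ((S (z_ n)).1 - (S z).1 - (w1 - (S z).1))) @ \oo --> (0 : R).
  have -> : (fun n => sqnormB T (L2 Omega) ((S (z_ n)).1 - (S z).1 - (w1 - (S z).1))) =
    (fun n => sqnormB T (L2 Omega) ((S (z_ n)).1 - w1)) by apply/funext => n; rewrite sub.
  exact: l1.
have l2' : (fun n => sqnormB T (L2 Omega) ((S (z_ n)).2 - (S z).2 - (w2 - (S z).2))) @ \oo --> (0 : R).
  have -> : (fun n => sqnormB T (L2 Omega) ((S (z_ n)).2 - (S z).2 - (w2 - (S z).2))) =
    (fun n => sqnormB T (L2 Omega) ((S (z_ n)).2 - w2)) by apply/funext => n; rewrite sub.
  exact: l2.
have gl : (fun n => sqnormB T (L2 Omega) (curlB Omega (z_ n) - curlB Omega z - 0)) @ \oo --> (0 : R).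
  apply: (squeeze_cvgr _ (cvg_cst 0) zl); near=> n.
  rewrite subr0 (sqnormB_curlB (hz_ n) hz) sqnormB_ge0/=.
  by rewrite lerDr; exact: sqnormB_ge0.
have gL2 n := lin_closedB hB (curlB_L2B oO bO (hz_ n)) (curlB_L2B oO bO hz).
have sn n := state_diff (hz_ n) hz.
exact: (integrated_limit_eq0 oO T0 heps hmui hsigma homogeneous_unique
  gL2 sn (lin_closedB hB h1 s1) (lin_closedB hB h2 s2) gl l1' l2').
Unshelve. all: by end_near. Qed.

End state.

(** * The cost functional *)

Lemma semi_ip_scale (R : realType) (V : lmodType R) (C : set V) b (c : R) :
  0 <= c -> semi_ip C b -> semi_ip C (fun u v => c * b u v).
Proof.
move=> c0 h; split.
- exact: sip_closed h.
- by move=> a u v w hu hv hw; rewrite (sip_linear h a hu hv hw) mulrDr mulrCA.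
- by move=> u v hu hv; rewrite (sip_sym h hu hv).
- by move=> u hu; rewrite mulr_ge0// (sip_ge0 h hu).
Qed.

Lemma semi_ip_prod (R : realType) (V W : lmodType R) (C : set V) (D : set W) b d :
  semi_ip C b -> semi_ip D d ->
  semi_ip [set u : V * W | C u.1 /\ D u.2] (fun u v => b u.1 v.1 + d u.2 v.2).
Proof.
move=> hb hd; split.
- split; first by split; [exact: lin_closed0 (sip_closed hb)|exact: lin_closed0 (sip_closed hd)].
  move=> a u v [u1 u2] [v1 v2].
  by split; [exact: (lin_closedP (sip_closed hb))|exact: (lin_closedP (sip_closed hd))].
- move=> a u v w [u1 u2] [v1 v2] [w1 w2] /=.
  by rewrite (sip_linear hb a u1 v1 w1) (sip_linear hd a u2 v2 w2) mulrDr addrACA.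
- by move=> u v [u1 u2] [v1 v2]; rewrite (sip_sym hb u1 v1) (sip_sym hd u2 v2).
- by move=> u [u1 u2]; rewrite addr_ge0// ?(sip_ge0 hb u1) ?(sip_ge0 hd u2).
Qed.

Lemma semi_ip_symmetrize (R : realType) (V : lmodType R) (C : set V) (a : V -> V -> R) :
  lin_closed C ->
  (forall c u v w, C u -> C v -> C w -> a (c *: u + v) w = c * a u w + a v w) ->
  (forall c u v w, C u -> C v -> C w -> a w (c *: u + v) = c * a w u + a w v) ->
  (forall u, C u -> 0 <= a u u) ->
  semi_ip C (fun u v => 2^-1 * (a u v + a v u)).
Proof.
move=> hC al ar a0; split=> //.
- move=> c u v w hu hv hw; rewrite al// ar//; ring.
- by move=> u v _ _; rewrite addrC.
- by move=> u hu; rewrite mulr_ge0 ?invr_ge0// addr_ge0// a0.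
Qed.

(** Nonnegativity of [b] at [u_ n - u] bounds [b u u] by [b (u_ n) (u_ n)] plus
    [2 * (b u u - b (u_ n) u)], so only the pairings with the limit itself have to converge. *)
Lemma sip_weak_lsc (R : realType) (V : lmodType R) (C : set V) b (u_ : nat -> V) u (j : R) :
  semi_ip C b -> (forall n, C (u_ n)) -> C u ->
  (fun n => b (u_ n) u) @ \oo --> b u u ->
  (forall n, b (u_ n) (u_ n) <= j + n.+1%:R^-1) -> b u u <= j.
Proof.
move=> hb hu_ hu lim le.
have le2 n : b u u <= j + n.+1%:R^-1 + 2 * (b u u - b (u_ n) u).
  have := sip_ge0 hb (lin_closedB (sip_closed hb) (hu_ n) hu).
  rewrite (sip_sqB hb (hu_ n) hu); have := le n.
  move: (n.+1%:R^-1) (b (u_ n) (u_ n)) (b (u_ n) u) (b u u) => x y z t; lra.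
apply/ler_addgt0Pl => e e0; have e2 : 0 < e / 4 by rewrite divr_gt0.
move: lim => /cvgrPdist_lt/(_ _ e2)[N _ hN].
have [M hM] := inv_succ_cvg0 (ler01 : 0 <= 1 :> R) e2.
pose n := maxn N M; have nN : (N <= n)%N by rewrite leq_maxl.
have nM : (M <= n)%N by rewrite leq_maxr.
have := hM n n nM nM; have := hN n nN; have := le2 n; rewrite /= ltr_norml mul1r.
have x0 : 0 < n.+1%:R^-1 :> R by rewrite invr_gt0.
by move: (n.+1%:R^-1) x0 (b (u_ n) u) (b u u) => x x0 z t h1 /andP[h2 h3] h4; lra.
Qed.

(** * Quadratic forms weighted by tensors *)

Section forms.
Context (R : realType) (Omega : set (point3 R)) (T : R).
Local Notation P3 := (point3 (measurableTypeR R)).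
Local Notation D := (`]0%R, T[%classic : set (measurableTypeR R)).
Hypothesis oO : open Omega.
Let mO : measurable (Omega : set P3) := open_measurable3 oO.
Let leb1 : {measure set (measurableTypeR R) -> \bar R} := leb R.
Let ips := ip_sip mO.
Let hL := L2_seminormed oO.
Let hB := inL2B_closed T hL.
Let ipBs := ipB_sip T oO.

Local Opaque ip inL2 wcurl sqnormB ipB.

Definition appB (A : tensor3 R) (u : R -> vfield R) : R -> vfield R := fun t => app A (u t).

(** The symmetric part of the bilinear form of [A], a semi-inner product by construction; the
    diagonal is unchanged by [formE]. *)
Definition form (A : tensor3 R) (u v : R -> vfield R) : R :=
  2^-1 * (ipB Omega T (appB A u) v + ipB Omega T (appB A v) u).

Lemma formE A u : form A u u = ipB Omega T (appB A u) u.
Proof. by rewrite /form; move: (ipB _ _ _ _) => x; lra. Qed.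

Lemma ipB_tr A u v : ipB Omega T (appB A u) v = ipB Omega T u (appB (fun x => (A x)^T) v).
Proof. by rewrite !ipBE; apply: eq_Rintegral => t _; exact: ip_tr. Qed.

Section coercive.
Context (A : tensor3 R) (a0 : R).
Hypothesis a0_gt0 : 0 < a0.
Hypothesis hA : Linfty Omega A.
Hypothesis cA : coercive_ae Omega a0 A.

Lemma form_coercive u : inL2B T (L2 Omega) u -> a0 * ipB Omega T u u <= form A u u.
Proof.
move=> hu; rewrite formE !ipBE.
have i1 := ip_L2B_integrable oO hu hu; have i2 := ip_L2B_integrable oO (app_L2B oO hA hu) hu.
rewrite -(RintegralZl _ (@mD R T) i1).
apply: (le_Rintegral (@mD R T) (integrableZ (@mD R T) a0 i1) i2) => t.
by rewrite D_itv => tT; exact: (coercive_ip mO a0_gt0 hA cA (L2B_inL2 hu tT)).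
Qed.

Lemma form_sip : semi_ip (inL2B T (L2 Omega)) (form A).
Proof.
have L u : inL2B T (L2 Omega) u -> inL2B T (L2 Omega) (appB A u) by exact: app_L2B.
apply: semi_ip_symmetrize => [|c u v w hu hv hw|c u v w hu hv hw|u hu].
- exact: hB.
- have -> : appB A (c *: u + v) = c *: appB A u + appB A v by exact: app_lin_fun.
  by rewrite (sip_linear ipBs c (L u hu) (L v hv) hw).
- rewrite (sipDr ipBs (lin_closedZ hB c hu) hv (L w hw)).
  by rewrite (sipZr ipBs c hu (L w hw)).
- rewrite -formE; apply: le_trans (form_coercive hu).
  by apply: mulr_ge0; [exact: ltW|exact: (sip_ge0 ipBs hu)].
Qed.

Lemma form_cvg (u : nat -> R -> vfield R) w : (forall n, inL2B T (L2 Omega) (u n)) ->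
  inL2B T (L2 Omega) w -> (fun n => sqnormB T (L2 Omega) (u n - w)) @ \oo --> (0 : R) ->
  (fun n => form A (u n) w) @ \oo --> form A w w.
Proof.
move=> hu hw uw.
have Aw : inL2B T (L2 Omega) (appB A w) := app_L2B oO hA hw.
have Atw : inL2B T (L2 Omega) (appB (fun x => (A x)^T) w) := app_L2B oO (Linfty_tr hA) hw.
apply: cvgM; first exact: cvg_cst; apply: cvgD.
  under eq_fun do rewrite ipB_tr; rewrite ipB_tr; exact: (ipB_cvg oO hu hw Atw uw).
have e v : inL2B T (L2 Omega) v -> ipB Omega T (appB A w) v = ipB Omega T v (appB A w).
  by move=> hv; exact: (sip_sym ipBs Aw hv).
under eq_fun do rewrite (e _ (hu _)); rewrite (e w hw); exact: (ipB_cvg oO hu hw Aw uw).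
Qed.

End coercive.

Lemma ipB_eq_aeB u v w : inL2B T (L2 Omega) u -> inL2B T (L2 Omega) v -> inL2B T (L2 Omega) w ->
  eq_aeB T Omega u v -> ipB Omega T u w = ipB Omega T v w.
Proof.
move=> hu hv hw uv; rewrite !ipBE.
apply: (@ae_eq_Rintegral _ (measurableTypeR R) R leb1 D (@mD R T)).
- exact: integrable_measurable (ip_L2B_integrable oO hu hw).
- exact: integrable_measurable (ip_L2B_integrable oO hv hw).
- apply: (@ae_imp _ (measurableTypeR R) R leb1 _ _ uv) => t ht; rewrite D_itv => tT.
  exact: (eq_aeL2_ip mO (L2B_inL2 hu tT) (L2B_inL2 hv tT) (L2B_inL2 hw tT) (ht tT)).
Qed.

Lemma sqnormB_eq0 u : inL2B T (L2 Omega) u -> sqnormB T (L2 Omega) u = 0 -> eq_aeB T Omega u 0.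
Proof.
move=> hu; rewrite -(ipB_sqnorm oO hu) ipBE => u0.
have i := ip_L2B_integrable oO hu hu.
have u_ge0 t : D t -> 0 <= ip Omega (u t) (u t).
  by rewrite D_itv => tT; exact: (sip_ge0 ips (L2B_inL2 hu tT)).
have h := Rintegral_eq0_ae (@mD R T) i u_ge0 u0.
apply: (@ae_imp _ (measurableTypeR R) R leb1 _ _ h) => t ht tT.
by apply: (ip_eq0_ae mO (L2B_inL2 hu tT)); apply: ht; rewrite D_itv.
Qed.

Lemma form_eq_aeB A a0 u v : 0 < a0 -> Linfty Omega A -> coercive_ae Omega a0 A ->
  inL2B T (L2 Omega) u -> inL2B T (L2 Omega) v -> eq_aeB T Omega u v ->
  form A u u = form A v v.
Proof.
move=> a00 hA cA hu hv uv.
have Au : inL2B T (L2 Omega) (appB A u) := app_L2B oO hA hu.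
have Av : inL2B T (L2 Omega) (appB A v) := app_L2B oO hA hv.
have uvA : eq_aeB T Omega (appB A u) (appB A v).
  apply: (@ae_imp _ (measurableTypeR R) R leb1 _ _ uv) => t ht tT.
  by apply: (@ae_imp _ P3 R (leb3 R) _ _ (ht tT)) => x hx Ox; rewrite /appB /app hx.
rewrite !formE (ipB_eq_aeB Au Av hu uvA) (sip_sym ipBs Av hu) (sip_sym ipBs Av hv).
exact: (ipB_eq_aeB hu hv Av uv).
Qed.

End forms.

Lemma half_sum (R : realType) (a b x y z w : R) :
  2^-1 * (x + y) + a / 2 * z + b / 2 * w = 2^-1 * ((x + y) + (a * z + b * w)).
Proof. ring. Qed.

Lemma half_sumB (R : realType) (x y w : R) :
  2^-1 * (2^-1 * x + 2^-1 * y - 4^-1 * w) = 2^-1 * (2^-1 * x) + 2^-1 * (2^-1 * y) - 8^-1 * w.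
Proof. lra. Qed.

Lemma scaled_sum_le (R : realType) (k x y z w x' y' z' w' : R) :
  k * x <= x' -> k * y <= y' -> k * z <= z' -> k * w <= w' ->
  k * (x + y + (z + w)) <= (x' + y') + (z' + w').
Proof. by move=> *; rewrite !mulrDr; apply: lerD; exact: lerD. Qed.

Lemma scaled_split (R : realType) (k x y z e : R) : 0 < k -> 0 <= x -> 0 <= y -> 0 <= z ->
  k * (x + y + z) <= e -> [/\ x <= k^-1 * e, y <= k^-1 * e & z <= k^-1 * e].
Proof.
move=> k0 x0 y0 z0; rewrite -ler_pdivlMl// => h.
by split; apply: le_trans h; lra.
Qed.

Lemma squeeze_cvg0 (R : realType) (u v : nat -> R) c : (forall n, 0 <= u n <= c * v n) ->
  v @ \oo --> (0 : R) -> u @ \oo --> (0 : R).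
Proof.
move=> uv v0.
have lim : (fun n => c * v n) @ \oo --> (0 : R).
  by rewrite -[X in _ --> X](mulr0 c); apply: cvgM; [exact: cvg_cst|exact: v0].
by apply: (squeeze_cvgr _ (cvg_cst 0) lim); near=> n; exact: uv.
Unshelve. all: by end_near. Qed.

Section cost.
Context (R : realType) (Omega : set (point3 R)) (T : R).
Local Notation P3 := (point3 (measurableTypeR R)).
Local Notation D := (`]0%R, T[%classic : set (measurableTypeR R)).
Hypothesis oO : open Omega.
Hypothesis bO : bounded_set Omega.
Hypothesis T0 : 0 < T.
Let mO : measurable (Omega : set P3) := open_measurable3 oO.
Let leb1 : {measure set (measurableTypeR R) -> \bar R} := leb R.
Let hL := L2_seminormed oO.
Let hB := inL2B_closed T hL.
Let hH := Hcurl_seminormed oO bO.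
Let hZ := inL2B_closed T hH.
Let ipBs := ipB_sip T oO.
Context (eps mu sigma : tensor3 R) (Isrc : R -> vfield R) (E0 B0 : vfield R).
Context (S : (R -> vfield R) -> (R -> vfield R) * (R -> vfield R)).
Context (eps0 mui0 alpha1 alpha2 : R) (Ed Bd : R -> vfield R).
Hypothesis eps0_gt0 : 0 < eps0.
Hypothesis mui0_gt0 : 0 < mui0.
Hypothesis alpha1_gt0 : 0 < alpha1.
Hypothesis alpha2_gt0 : 0 < alpha2.
Hypothesis heps : Linfty Omega eps.
Hypothesis hmui : Linfty Omega (tinv mu).
Hypothesis hsigma : Linfty Omega sigma.
Hypothesis ceps : coercive_ae Omega eps0 eps.
Hypothesis cmui : coercive_ae Omega mui0 (tinv mu).
Hypothesis hIsrc : inL2B T (L2 Omega) Isrc.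
Hypothesis hE0 : inL2 Omega E0.
Hypothesis hB0 : inL2 Omega B0.
Hypothesis hS : control_to_state Omega T eps mu sigma Isrc E0 B0 S.
Hypothesis hEd : inL2B T (L2 Omega) Ed.
Hypothesis hBd : inL2B T (L2 Omega) Bd.

Local Opaque ip inL2 wcurl sqnormB ipB.

Local Notation F := (R -> vfield R).
Local Notation J := (cost Omega T eps mu S Ed Bd alpha1 alpha2).

Let feps := @form_sip R Omega T oO eps eps0 eps0_gt0 heps ceps.
Let fmui := @form_sip R Omega T oO (tinv mu) mui0 mui0_gt0 hmui cmui.
Let state_L2B' z (hz : inZ Omega T z) := state_L2B oO bO T0 heps hmui hsigma hIsrc hE0 hB0 hS hz.

(** The last component holds the curl of the control but is not tied to the third one, so the space
    is a plain product of Bochner spaces over L2. *)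
Definition cost_space : set ((F * F) * (F * F)) :=
  [set w | (inL2B T (L2 Omega) w.1.1 /\ inL2B T (L2 Omega) w.1.2) /\
           (inL2B T (L2 Omega) w.2.1 /\ inL2B T (L2 Omega) w.2.2)].

Definition cost_form (v w : (F * F) * (F * F)) : R :=
  (form Omega T eps v.1.1 w.1.1 + form Omega T (tinv mu) v.1.2 w.1.2) +
  (alpha1 * ipB Omega T v.2.1 w.2.1 + alpha2 * ipB Omega T v.2.2 w.2.2).

(* The cost is half the square of the seminorm of this affine map. *)
Definition cost_map (z : F) : (F * F) * (F * F) :=
  (((S z).1 - Ed, (S z).2 - Bd), (z, curlB Omega z)).

Lemma cost_form_sip : semi_ip cost_space cost_form.
Proof.
exact: (semi_ip_prod (semi_ip_prod feps fmui)
  (semi_ip_prod (semi_ip_scale (ltW alpha1_gt0) ipBs) (semi_ip_scale (ltW alpha2_gt0) ipBs))).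
Qed.

Let cfs := cost_form_sip.

Lemma cost_map_in z : inZ Omega T z -> cost_space (cost_map z).
Proof.
move=> hz; have [h1 h2] := state_L2B' hz.
split; split; [exact: (lin_closedB hB h1 hEd)|exact: (lin_closedB hB h2 hBd)|exact: (Z_L2B oO bO hz)|].
exact: (curlB_L2B oO bO hz).
Qed.

Lemma costE z : inZ Omega T z -> J z = 2^-1 * cost_form (cost_map z) (cost_map z).
Proof.
move=> hz; have [[h1 h2] [h3 h4]] := cost_map_in hz.
have LB (w : F) : inL2B T (L2 Omega) w -> L2B_norm T (L2 Omega) w ^+ 2 = ipB Omega T w w.
  by move=> hw; rewrite (ipB_sqnorm oO hw) -(sqr_sqrtr (sqnormB_ge0 T (L2 Omega) w)).
have Y : Y_norm Omega T eps mu (S z - (Ed, Bd)) ^+ 2 =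
    form Omega T eps (cost_map z).1.1 (cost_map z).1.1 +
    form Omega T (tinv mu) (cost_map z).1.2 (cost_map z).1.2.
  have i1 := ip_L2B_integrable oO (app_L2B oO heps h1) h1.
  have i2 := ip_L2B_integrable oO (app_L2B oO hmui h2) h2.
  have p1 := sip_ge0 feps h1; have p2 := sip_ge0 fmui h2; have p := addr_ge0 p1 p2.
  rewrite -[RHS](sqr_sqrtr p); congr (Num.sqrt _ ^+ 2).
  by rewrite !formE !ipBE -(RintegralD (@mD R T) i1 i2).
have e3 : L2B_norm T (L2 Omega) z ^+ 2 = ipB Omega T z z := LB z h3.
have e4 : L2B_norm T (L2 Omega) (curlB Omega z) ^+ 2 = ipB Omega T (curlB Omega z) (curlB Omega z) := LB _ h4.
exact: (etrans (f_equal2 (fun x y => x + y)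
  (f_equal2 (fun x y => 2^-1 * x + alpha1 / 2 * y) Y e3) (f_equal (fun x => alpha2 / 2 * x) e4))
  (half_sum alpha1 alpha2 _ _ _ _)).
Qed.

Lemma cost_form_congr v w : cost_space v -> cost_space w ->
  eq_aeB T Omega v.1.1 w.1.1 -> eq_aeB T Omega v.1.2 w.1.2 ->
  eq_aeB T Omega v.2.1 w.2.1 -> eq_aeB T Omega v.2.2 w.2.2 ->
  cost_form v v = cost_form w w.
Proof.
move: v w => [[v1 v2] [v3 v4]] [[w1 w2] [w3 w4]].
move=> [[/= m1 m2] [m3 m4]] [[/= h1 h2] [h3 h4]] /= a1 a2 a3 a4.
have e x y : inL2B T (L2 Omega) x -> inL2B T (L2 Omega) y -> eq_aeB T Omega x y ->
    ipB Omega T x x = ipB Omega T y y.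
  move=> hx hy xy; have h := ipB_eq_aeB oO hx hy hx xy.
  by rewrite h (sip_sym ipBs hy hx); exact: (ipB_eq_aeB oO hx hy hy xy).
have b1 := form_eq_aeB oO eps0_gt0 heps ceps m1 h1 a1.
have b2 := form_eq_aeB oO mui0_gt0 hmui cmui m2 h2 a2.
by rewrite /cost_form /= b1 b2 (e _ _ m3 h3 a3) (e _ _ m4 h4 a4).
Qed.

(** Through [S] and [wcurl], the map respects midpoints only up to null sets, which [cost_form] does
    not see. *)
Lemma cost_map_mid z z' : inZ Omega T z -> inZ Omega T z' ->
  cost_form (cost_map (2^-1 *: (z + z'))) (cost_map (2^-1 *: (z + z'))) =
  cost_form (2^-1 *: (cost_map z + cost_map z')) (2^-1 *: (cost_map z + cost_map z')).
Proof.
move=> hz hz'; have hm := inZ_mid oO bO hz hz'.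
have [e1 e2] := state_mid oO bO T0 heps hmui hsigma hIsrc hE0 hB0 hS hz hz'.
have half (u v d : F) : 2^-1 *: (u - d + (v - d)) = 2^-1 *: (u + v) - d.
  rewrite addrACA -opprD scalerBr; congr (_ - _).
  by rewrite -[d in d + d]scale1r -scalerDl scalerA mulVf ?scale1r// pnatr_eq0.
have sub (u v d : F) : eq_aeB T Omega u v -> eq_aeB T Omega (v - d) (u - d).
  move=> uv; apply: (@ae_imp _ (measurableTypeR R) R leb1 _ _ uv) => t ht tT.
  exact: (eq_aeL2B (eq_aeL2_sym (ht tT)) (eq_aeL2_refl Omega (d t))).
have a1 : eq_aeB T Omega (cost_map (2^-1 *: (z + z'))).1.1 (2^-1 *: (cost_map z + cost_map z')).1.1.
  by have := sub _ _ Ed e1; rewrite -half.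
have a2 : eq_aeB T Omega (cost_map (2^-1 *: (z + z'))).1.2 (2^-1 *: (cost_map z + cost_map z')).1.2.
  by have := sub _ _ Bd e2; rewrite -half.
have a4 : eq_aeB T Omega (cost_map (2^-1 *: (z + z'))).2.2 (2^-1 *: (cost_map z + cost_map z')).2.2.
  by apply: aeW => t tT; exact: (eq_aeL2_sym (curlB_mid oO bO hz hz' tT)).
have a3 : eq_aeB T Omega (cost_map (2^-1 *: (z + z'))).2.1 (2^-1 *: (cost_map z + cost_map z')).2.1.
  by apply: aeW => t tT; exact: eq_aeL2_refl.
exact: (cost_form_congr (cost_map_in hm) (lin_closedZ (sip_closed cfs) 2^-1
  (lin_closedD (sip_closed cfs) (cost_map_in hz) (cost_map_in hz'))) a1 a2 a3 a4).
Qed.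

(** The factor 1/8 is the 1/2 of the cost times the 1/4 of the parallelogram identity. *)
Lemma cost_midpoint z z' : inZ Omega T z -> inZ Omega T z' ->
  J (2^-1 *: (z + z')) = 2^-1 * J z + 2^-1 * J z' -
    8^-1 * cost_form (cost_map z - cost_map z') (cost_map z - cost_map z').
Proof.
move=> hz hz'; rewrite (costE (inZ_mid oO bO hz hz')) (cost_map_mid hz hz') (costE hz) (costE hz').
rewrite (sip_parallelogram cfs (cost_map_in hz) (cost_map_in hz')).
exact: half_sumB.
Qed.

Lemma cost_form_coercive : exists2 k, 0 < k & forall z z', inZ Omega T z -> inZ Omega T z' ->
  k * (sqnormB T (L2 Omega) ((S z).1 - (S z').1) + sqnormB T (L2 Omega) ((S z).2 - (S z').2) +
       sqnormB T (Hcurl Omega) (z - z')) <=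
  cost_form (cost_map z - cost_map z') (cost_map z - cost_map z').
Proof.
(* The least of the four coercivity constants, so that one factor serves all components. *)
pose k := Num.min (Num.min eps0 mui0) (Num.min alpha1 alpha2).
have k0 : 0 < k by rewrite !lt_min eps0_gt0 mui0_gt0 alpha1_gt0 alpha2_gt0.
have [k1 k2 k3 k4] : [/\ k <= eps0, k <= mui0, k <= alpha1 & k <= alpha2].
  by rewrite /k; split; rewrite !ge_min lexx ?orbT.
exists k; [exact: k0|] => z z' hz hz'.
have [h1 h2] := state_L2B' hz; have [h1' h2'] := state_L2B' hz'.
have s1 := lin_closedB hB h1 h1'; have s2 := lin_closedB hB h2 h2'.
have s3 := lin_closedB hB (Z_L2B oO bO hz) (Z_L2B oO bO hz').
have s4 := lin_closedB hB (curlB_L2B oO bO hz) (curlB_L2B oO bO hz').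
have sub (u v d : F) : u - d - (v - d) = u - v by rewrite opprB addrA subrK.
have -> : cost_map z - cost_map z' =
    (((S z).1 - (S z').1, (S z).2 - (S z').2), (z - z', curlB Omega z - curlB Omega z')).
  rewrite -(sub (S z).1 (S z').1 Ed) -(sub (S z).2 (S z').2 Bd).
  by [].
rewrite (sqnormB_curlB oO bO hz hz') -(ipB_sqnorm oO s1) -(ipB_sqnorm oO s2) -(ipB_sqnorm oO s3) -(ipB_sqnorm oO s4).
have c1 := form_coercive oO eps0_gt0 heps ceps s1.
have c2 := form_coercive oO mui0_gt0 hmui cmui s2.
have le (c x : R) : k <= c -> 0 <= x -> k * x <= c * x by move=> kc x0; exact: ler_wpM2r.
have l1 := le_trans (le _ _ k1 (sip_ge0 ipBs s1)) c1.
have l2 := le_trans (le _ _ k2 (sip_ge0 ipBs s2)) c2.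
exact: (scaled_sum_le l1 l2 (le _ _ k3 (sip_ge0 ipBs s3)) (le _ _ k4 (sip_ge0 ipBs s4))).
Qed.

Local Opaque form.

Lemma cost_form_weak_cvg (z_ : nat -> R -> vfield R) z :
  (forall n, inZ Omega T (z_ n)) -> inZ Omega T z ->
  (fun n => sqnormB T (Hcurl Omega) (z_ n - z)) @ \oo --> (0 : R) ->
  (fun n => sqnormB T (L2 Omega) ((S (z_ n)).1 - (S z).1)) @ \oo --> (0 : R) ->
  (fun n => sqnormB T (L2 Omega) ((S (z_ n)).2 - (S z).2)) @ \oo --> (0 : R) ->
  (fun n => cost_form (cost_map (z_ n)) (cost_map z)) @ \oo --> cost_form (cost_map z) (cost_map z).
Proof.
move=> hz_ hz zl l1 l2.
have sub (u v d : R -> vfield R) : u - d - (v - d) = u - v by rewrite opprB addrA subrK.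
have d1 n := lin_closedB hB (state_L2B' (hz_ n)).1 hEd; have d2 n := lin_closedB hB (state_L2B' (hz_ n)).2 hBd.
have e1 := lin_closedB hB (state_L2B' hz).1 hEd; have e2 := lin_closedB hB (state_L2B' hz).2 hBd.
have split_ n := sqnormB_curlB oO bO (hz_ n) hz.
have k1 : (fun n => sqnormB T (L2 Omega) (z_ n - z)) @ \oo --> (0 : R).
  apply: (squeeze_cvg0 (c := 1) _ zl) => n; rewrite mul1r sqnormB_ge0/= split_ lerDl.
  exact: sqnormB_ge0.
have k2 : (fun n => sqnormB T (L2 Omega) (curlB Omega (z_ n) - curlB Omega z)) @ \oo --> (0 : R).
  apply: (squeeze_cvg0 (c := 1) _ zl) => n; rewrite mul1r sqnormB_ge0/= split_ lerDr.
  exact: sqnormB_ge0.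
have l1' : (fun n => sqnormB T (L2 Omega) ((S (z_ n)).1 - Ed - ((S z).1 - Ed))) @ \oo --> (0 : R).
  have -> : (fun n => sqnormB T (L2 Omega) ((S (z_ n)).1 - Ed - ((S z).1 - Ed))) =
    (fun n => sqnormB T (L2 Omega) ((S (z_ n)).1 - (S z).1)) by apply/funext => n; rewrite sub.
  exact: l1.
have l2' : (fun n => sqnormB T (L2 Omega) ((S (z_ n)).2 - Bd - ((S z).2 - Bd))) @ \oo --> (0 : R).
  have -> : (fun n => sqnormB T (L2 Omega) ((S (z_ n)).2 - Bd - ((S z).2 - Bd))) =
    (fun n => sqnormB T (L2 Omega) ((S (z_ n)).2 - (S z).2)) by apply/funext => n; rewrite sub.
  exact: l2.
have f1 := form_cvg oO heps d1 e1 l1'; have f2 := form_cvg oO hmui d2 e2 l2'.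
have f3 := ipB_cvg oO (fun n => Z_L2B oO bO (hz_ n)) (Z_L2B oO bO hz) (Z_L2B oO bO hz) k1.
have cz := curlB_L2B oO bO hz.
have f4 := ipB_cvg oO (fun n => curlB_L2B oO bO (hz_ n)) cz cz k2.
exact: (cvgD (cvgD f1 f2) (cvgD (cvgM (cvg_cst alpha1) f3) (cvgM (cvg_cst alpha2) f4))).
Qed.

Lemma exists_minimizer : exists2 z, inZ Omega T z & forall z', inZ Omega T z' -> J z <= J z'.
Proof.
have J0 z : inZ Omega T z -> 0 <= J z.
  move=> hz; rewrite (costE hz); apply: mulr_ge0; first by rewrite invr_ge0.
  exact: (sip_ge0 cfs (cost_map_in hz)).
have [j [z_ [hj hz_ Jz_ Dz_]]] := minimizing_sequence
  (D := fun u v => 8^-1 * cost_form (cost_map u - cost_map v) (cost_map u - cost_map v)) hZ J0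
  (fun u v hu hv => eq_ind_r (fun x => x <= _) (lexx _) (cost_midpoint hu hv)).
have [k k0 coer] := cost_form_coercive.
have bound n p := scaled_split k0 (sqnormB_ge0 T (L2 Omega) ((S (z_ n)).1 - (S (z_ p)).1))
  (sqnormB_ge0 T (L2 Omega) ((S (z_ n)).2 - (S (z_ p)).2))
  (sqnormB_ge0 T (Hcurl Omega) (z_ n - z_ p)) (coer _ _ (hz_ n) (hz_ p)).
have k8 : 0 <= k^-1 * 8 by rewrite mulr_ge0// invr_ge0 ltW.
have small n p : k^-1 * cost_form (cost_map (z_ n) - cost_map (z_ p)) (cost_map (z_ n) - cost_map (z_ p)) <=
    k^-1 * 8 * (n.+1%:R^-1 + p.+1%:R^-1).
  rewrite -mulrA; apply: ler_wpM2l; first by rewrite invr_ge0 ltW.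
  by have := Dz_ n p; rewrite ler_pdivrMl.
(* The same convexity gap bounds the distances of the controls and of both state components, so one
   argument makes all three sequences Cauchy. *)
have cauchy (V : lmodType R) (X : Defs.space V) (u : nat -> R -> V) :
    (forall n p, sqnormB T X (u n - u p) <= k^-1 * cost_form (cost_map (z_ n) - cost_map (z_ p)) (cost_map (z_ n) - cost_map (z_ p))) ->
    forall e, 0 < e -> exists N, forall n p, (N <= n)%N -> (N <= p)%N -> sqnormB T X (u n - u p) < e.
  move=> h e e0; have [N hN] := inv_succ_cvg0 k8 e0; exists N => n p Nn Np.
  exact: (le_lt_trans (le_trans (h n p) (small n p)) (hN n p Nn Np)).
have c1 n p := let: And3 h _ _ := bound n p in h.
have c2 n p := let: And3 _ h _ := bound n p in h.
have c3 n p := let: And3 _ _ h := bound n p in h.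
have [z hz zl] := L2B_complete hH (Hcurl_complete oO bO) hz_ (cauchy _ _ z_ c3).
have [w1 hw1 wl1] := L2B_complete hL (L2_complete mO) (fun n => (state_L2B' (hz_ n)).1)
  (cauchy _ _ (fun n => (S (z_ n)).1) c1).
have [w2 hw2 wl2] := L2B_complete hL (L2_complete mO) (fun n => (state_L2B' (hz_ n)).2)
  (cauchy _ _ (fun n => (S (z_ n)).2) c2).
have [n1 n2] := state_closed oO bO T0 heps hmui hsigma hIsrc hE0 hB0 hS hz_ hz hw1 hw2 zl wl1 wl2.
(* The limits [w1] and [w2] are at distance 0 from the state of [z] without being equal to it; the
   convergence is carried over to the state. *)
have transfer (u : nat -> R -> vfield R) w v : (forall n, inL2B T (L2 Omega) (u n)) ->
    inL2B T (L2 Omega) w -> inL2B T (L2 Omega) v -> sqnormB T (L2 Omega) (w - v) = 0 ->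
    (fun n => sqnormB T (L2 Omega) (u n - w)) @ \oo --> (0 : R) ->
    (fun n => sqnormB T (L2 Omega) (u n - v)) @ \oo --> (0 : R).
  move=> hu hw hv wv; apply: (squeeze_cvg0 (c := 2)) => n; rewrite sqnormB_ge0/=.
  by have := sqnormB_trans hL (hu n) hv hw; rewrite wv mulr0 addr0.
have l1 := transfer _ _ _ (fun n => (state_L2B' (hz_ n)).1) hw1 (state_L2B' hz).1 n1 wl1.
have l2 := transfer _ _ _ (fun n => (state_L2B' (hz_ n)).2) hw2 (state_L2B' hz).2 n2 wl2.
have lim := cost_form_weak_cvg hz_ hz zl l1 l2.
have h2 : (0 : R) <= 2^-1 by rewrite invr_ge0.
have le n : 2^-1 * cost_form (cost_map (z_ n)) (cost_map (z_ n)) <= j + n.+1%:R^-1 by rewrite -(costE (hz_ n)).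
have Jj : J z <= j.
  have lim' : (fun n => 2^-1 * cost_form (cost_map (z_ n)) (cost_map z)) @ \oo -->
      2^-1 * cost_form (cost_map z) (cost_map z).
    by apply: cvgM; [exact: cvg_cst|exact: lim].
  rewrite (costE hz).
  exact: (@sip_weak_lsc _ _ cost_space (fun v w => 2^-1 * cost_form v w) (fun n => cost_map (z_ n))
    (cost_map z) j (semi_ip_scale h2 cfs) (fun n => cost_map_in (hz_ n)) (cost_map_in hz) lim' le).
by exists z; [exact: hz|] => z' hz'; exact: (le_trans Jj (hj z' hz')).
Qed.

Lemma minimizer_unique z z' : inZ Omega T z -> inZ Omega T z' ->
  (forall v, inZ Omega T v -> J z <= J v) -> (forall v, inZ Omega T v -> J z' <= J v) ->
  eq_aeB T Omega z z'.
Proof.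
move=> hz hz' min_z min_z'.
have hm := inZ_mid oO bO hz hz'.
have [k k0 coer] := cost_form_coercive.
(* The midpoint is no cheaper than either minimizer, so the convexity gap cannot be positive. *)
have q0 : cost_form (cost_map z - cost_map z') (cost_map z - cost_map z') <= 0.
  have := min_z _ hm; have := min_z' _ hm; rewrite (cost_midpoint hz hz').
  move: (J z) (J z') (cost_form _ _) => x y w; lra.
have [_ _] := scaled_split k0 (sqnormB_ge0 T (L2 Omega) ((S z).1 - (S z').1))
  (sqnormB_ge0 T (L2 Omega) ((S z).2 - (S z').2))
  (sqnormB_ge0 T (Hcurl Omega) (z - z')) (le_trans (coer _ _ hz hz') q0).
rewrite mulr0 (sqnormB_curlB oO bO hz hz') => le.
have n1 := sqnormB_ge0 T (L2 Omega) (z - z').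
have n2 := sqnormB_ge0 T (L2 Omega) (curlB Omega z - curlB Omega z').
have n0 : sqnormB T (L2 Omega) (z - z') = 0.
  by move: le n1 n2; move: (sqnormB _ _ _) (sqnormB _ _ _) => x y; lra.
have h := sqnormB_eq0 oO (lin_closedB hB (Z_L2B oO bO hz) (Z_L2B oO bO hz')) n0.
apply: (@ae_imp _ (measurableTypeR R) R leb1 _ _ h) => t ht tT.
apply: (@ae_imp _ P3 R (leb3 R) _ _ (ht tT)) => x hx Ox.
exact: (subr0_eq (hx Ox)).
Qed.

End cost.

Theorem theorem3 (R : realType) (Omega : set (point3 R)) (T : R)
    (eps mu sigma : tensor3 R) (eps0 mu0 : R)
    (Isrc : R -> vfield R) (E0 B0 : vfield R)
    (S : (R -> vfield R) -> (R -> vfield R) * (R -> vfield R))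
    (alpha1 alpha2 : R) (Ed Bd : R -> vfield R)
    (hOmega : bounded_lipschitz_domain Omega) (hT : 0 < T)
    (heps : Linfty Omega eps) (hmu : Linfty Omega mu)
    (hsigma : Linfty Omega sigma)
    (heps_sym : symmetric_ae Omega eps) (hmu_sym : symmetric_ae Omega mu)
    (hsigma_sym : symmetric_ae Omega sigma)
    (heps0 : 0 < eps0) (hmu0 : 0 < mu0)
    (heps_coer : coercive_ae Omega eps0 eps)
    (hmu_coer : coercive_ae Omega mu0 mu)
    (hsigma_psd : psd_ae Omega sigma)
    (hIsrc : inL2B T (L2 Omega) Isrc)
    (hE0 : inL2 Omega E0) (hB0 : inL2 Omega B0)
    (hdivB0 : weak_div_free Omega B0)
    (hS : control_to_state Omega T eps mu sigma Isrc E0 B0 S)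
    (halpha1 : 0 < alpha1) (halpha2 : 0 < alpha2)
    (hd : inY Omega T (Ed, Bd)) :
  exists zstar : R -> vfield R,
    is_minimizer [set z | inZ Omega T z]
      (cost Omega T eps mu S Ed Bd alpha1 alpha2) zstar /\
    forall z : R -> vfield R,
      is_minimizer [set z' | inZ Omega T z']
        (cost Omega T eps mu S Ed Bd alpha1 alpha2) z ->
      eq_aeB T Omega z zstar.
Proof.
have [_ oO _ bO _] := hOmega; have [hEd hBd] := hd.
(* The magnetic part of the cost is weighted by the inverse of [mu]; its boundedness and coercivity
   are deduced from those of [mu]. *)
have hmui := Linfty_tinv hmu0 hmu hmu_coer.
have [mui0 mui0_gt0 cmui] := coercive_tinv hmu0 hmu hmu_coer.
have [z hz zmin] := exists_minimizer oO bO hT heps0 mui0_gt0 halpha1 halpha2 heps hmui hsigma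
  heps_coer cmui hIsrc hE0 hB0 hS hEd hBd.
exists z; split; [by split|] => z' [hz' z'min].
exact: (minimizer_unique oO bO hT heps0 mui0_gt0 halpha1 halpha2 heps hmui hsigma
  heps_coer cmui hIsrc hE0 hB0 hS hEd hBd hz' hz z'min zmin).
Qed.
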